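(* Let $\mathcal{F}\in\{\mathcal{A},\mathcal{S}\}$ and let $a,b$ be non-negative integers. Then \[\zeta_{\mathcal{F}_1}(\{2\}^a,1,\{2\}^b)=4(-1)^{a+b}\frac{a-b}{2a+1}\Bigl(1-\frac{1}{4^{a+b}}\Bigr)\binom{2a+2b+1}{2b+1}\mathfrak{Z}_{\mathcal{F}_1}(2a+2b+1),\] \[\zeta^\star_{\mathcal{F}_1}(\{2\}^a,1,\{2\}^b)=\frac{4(b-a)}{2a+1}\Bigl(1-\frac{1}{4^{a+b}}\Bigr)\binom{2a+2b+1}{2b+1}\mathfrak{Z}_{\mathcal{F}_1}(2a+2b+1).\]
   Context: $\{2\}^a$ denotes $a$ repetitions of $2$. An index is a finite tuple of positive integers. Let $\mathcal{A}_1=\prod_p\mathbb{Z}/p\mathbb{Z}\big/\bigoplus_p\mathbb{Z}/p\mathbb{Z}$ ($p$ over all primes), $\zeta_{\mathcal{A}_1}(\boldsymbol{k})=\bigl(\sum_{0<m_1<\cdots<m_r<p}m_1^{-k_1}\cdots m_r^{-k_r}\bmod p\bigr)_p$ and $\zeta^\star_{\mathcal{A}_1}(\boldsymbol{k})=\bigl(\sum_{1\le m_1\le\cdots\le m_r\le p-1}m_1^{-k_1}\cdots m_r^{-k_r}\bmod p\bigr)_p$. Let $\mathcal{Z}\subset\mathbb{R}$ be the $\mathbb{Q}$-algebra generated by all multiple zeta values $\zeta(k_1,\dots,k_r)=\sum_{0<m_1<\cdots<m_r}m_1^{-k_1}\cdots m_r^{-k_r}$ ($k_r\ge2$), and $\overline{\mathcal{Z}}=\mathcal{Z}/\zeta(2)\mathcal{Z}$.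 For $\bullet\in\{*,\text{sh}\}$ let $\zeta^\bullet(\boldsymbol{k})$ be the harmonic (stuffle), resp. shuffle, regularized multiple zeta value (with $\zeta^\bullet(1)=0$, $\zeta^\bullet(\varnothing)=1$). The symmetric multiple zeta value is $\zeta_{\mathcal{S}_1}(\boldsymbol{k})=\sum_{i=0}^r(-1)^{k_{i+1}+\cdots+k_r}\zeta^\bullet(k_1,\dots,k_i)\zeta^\bullet(k_r,\dots,k_{i+1})\bmod\zeta(2)\in\overline{\mathcal{Z}}$ (independent of $\bullet$), and $\zeta^\star_{\mathcal{S}_1}(k_1,\dots,k_r)=\sum\zeta_{\mathcal{S}_1}(k_1\square\cdots\square k_r)$, the sum over all ways of replacing each $\square$ by a comma or a plus. $\mathfrak{Z}_{\mathcal{A}_1}(k)=\bigl(\frac{B_{p-k}}{k}\bmod p\bigr)_p$ ($B_j$ Bernoulli numbers), $\mathfrak{Z}_{\mathcal{S}_1}(k)=\zeta(k)\bmod\zeta(2)\in\overline{\mathcal{Z}}$ for $k\ge2$, and $\mathfrak{Z}_{\mathcal{F}_1}(1)$ is interpreted so that the right-hand sides (which carry the factor $1-4^{-(a+b)}$) vanish when $a=b=0$. *)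

(* Defs.v *)
From HB Require Import structures.
From mathcomp Require Import all_boot all_order all_algebra.
From mathcomp Require Import all_classical all_reals all_analysis.
From mathcomp Require Import zify.

Set Implicit Arguments.
Unset Strict Implicit.
Unset Printing Implicit Defensive.

Import Order.TTheory GRing.Theory Num.Theory.
Import numFieldNormedType.Exports.

Local Open Scope ring_scope.

(* MathComp's {ideal_quot I} only covers proper ideals, but it is not known
   that zeta(2) generates a proper ideal of the ring of multiple zeta values. *)
Record ideal (A : comPzRingType) := Ideal {
  in_ideal :> A -> Prop;
  ideal0 : in_ideal 0;
  idealB : forall x y, in_ideal x -> in_ideal y -> in_ideal (x - y);
  idealMl : forall a x, in_ideal x -> in_ideal (a * x) }.

Section IdealQuotient.
Variables (A : comPzRingType) (I : ideal A).
Local Open Scope quotient_scope.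

Definition ideal_equiv : rel A := fun x y => `[< I (x - y) >].

Lemma idealN x : I x -> I (- x).
Proof. by move=> Ix; rewrite -(sub0r x); apply: idealB Ix; apply: ideal0. Qed.

Lemma idealD x y : I x -> I y -> I (x + y).
Proof. by move=> Ix /idealN Iy; rewrite -(opprK y); apply: idealB. Qed.

Lemma ideal_equiv_is_equiv : equiv_class_of ideal_equiv.
Proof.
split=> [x | x y | y x z]; rewrite /ideal_equiv.
- by apply/asboolP; rewrite subrr; apply: ideal0.
- by apply/idP/idP => /asboolP /idealN; rewrite opprB => ?; apply/asboolP.
- move=> /asboolP h1 /asboolP h2; apply/asboolP.
  by rewrite -(subrKA y); apply: idealD.
Qed.

Canonical ideal_equivRel := EquivRelPack ideal_equiv_is_equiv.

Definition quot := {eq_quot ideal_equiv}.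

HB.instance Definition _ := Choice.on quot.
HB.instance Definition _ : EqQuotient A ideal_equiv quot := EqQuotient.on quot.

Definition qclass (x : A) : quot := \pi_quot x.

Lemma qclassP x y : qclass x = qclass y <-> I (x - y).
Proof.
split=> [/eqP|h]; first by rewrite /qclass eqmodE => /asboolP.
by apply/eqP; rewrite /qclass eqmodE; apply/asboolP.
Qed.

Lemma qclass_surj (q : quot) : exists x, q = qclass x.
Proof. by exists (repr q); rewrite /qclass reprK. Qed.

Let qzero : quot := qclass 0.
Let qone : quot := qclass 1.
Let qopp (p : quot) : quot := qclass (- repr p).
Let qadd (p q : quot) : quot := qclass (repr p + repr q).
Let qmul (p q : quot) : quot := qclass (repr p * repr q).

Let reprI x : I (repr (qclass x) - x).
Proof. by apply/qclassP; rewrite /qclass reprK. Qed.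

Let qoppE x : qopp (qclass x) = qclass (- x).
Proof. by apply/qclassP; rewrite -opprD; apply/idealN/reprI. Qed.

Let qaddE x y : qadd (qclass x) (qclass y) = qclass (x + y).
Proof. by apply/qclassP; rewrite opprD addrACA; apply: idealD; apply: reprI. Qed.

Let qmulE x y : qmul (qclass x) (qclass y) = qclass (x * y).
Proof.
apply/qclassP; set x' := repr _; set y' := repr _.
have -> : x' * y' - x * y = y' * (x' - x) + x * (y' - y).
  by rewrite !mulrBr (mulrC y' x') (mulrC y' x) addrA subrK.
by apply: idealD; apply/idealMl/reprI.
Qed.

Let qaddA : associative qadd.
Proof.
move=> p q r; have [[x ->] [y ->] [z ->]] :=
  And3 (qclass_surj p) (qclass_surj q) (qclass_surj r).
by rewrite !qaddE addrA.
Qed.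
Let qaddC : commutative qadd.
Proof. by move=> p q; rewrite /qadd addrC. Qed.
Let qadd0 : left_id qzero qadd.
Proof. by move=> p; have [x ->] := qclass_surj p; rewrite qaddE add0r. Qed.
Let qaddN : left_inverse qzero qopp qadd.
Proof. by move=> p; have [x ->] := qclass_surj p; rewrite qoppE qaddE addNr. Qed.

HB.instance Definition _ := GRing.isZmodule.Build quot qaddA qaddC qadd0 qaddN.

Let qmulA : associative qmul.
Proof.
move=> p q r; have [[x ->] [y ->] [z ->]] :=
  And3 (qclass_surj p) (qclass_surj q) (qclass_surj r).
by rewrite !qmulE mulrA.
Qed.
Let qmulC : commutative qmul.
Proof. by move=> p q; rewrite /qmul mulrC. Qed.
Let qmul1 : left_id qone qmul.
Proof. by move=> p; have [x ->] := qclass_surj p; rewrite qmulE mul1r. Qed.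
Let qmulDl : left_distributive qmul qadd.
Proof.
move=> p q r; have [[x ->] [y ->] [z ->]] :=
  And3 (qclass_surj p) (qclass_surj q) (qclass_surj r).
by rewrite !(qaddE, qmulE) mulrDl.
Qed.

HB.instance Definition _ :=
  GRing.Zmodule_isComPzRing.Build quot qmulA qmulC qmul1 qmulDl.

Lemma qclass_is_zmod_morphism : zmod_morphism qclass.
Proof. by move=> x y; rewrite -qaddE -qoppE. Qed.
HB.instance Definition _ :=
  GRing.isZmodMorphism.Build A quot qclass qclass_is_zmod_morphism.

Lemma qclass_is_monoid_morphism : monoid_morphism qclass.
Proof. by split=> // x y; rewrite -qmulE. Qed.
HB.instance Definition _ :=
  GRing.isMonoidMorphism.Build A quot qclass qclass_is_monoid_morphism.

End IdealQuotient.

Definition mindex := seq nat.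

Definition is_index (k : mindex) : bool := all (leq 1) k.

Definition admissible (k : mindex) : bool := is_index k && (2 <= last 2 k)%N.

(* Sum over m_1, ..., m_r in {1, ..., N - 1} with e m_i m_(i+1) for all i. *)
Definition nested_sum (F : unitRingType) (e : rel nat) (k : mindex) (N : nat) : F :=
  \sum_(m : (size k).-tuple 'I_N |
          all (leq 1) (map val m) && sorted e (map val m))
     \prod_(i < size k) (val (tnth m i))%:R ^- nth 0%N k i.

Definition prime_number := {p : nat | prime p}.

Definition prime_prod := forall p : prime_number, 'F_(sval p).

HB.instance Definition _ :=
  Choice.copy prime_prod (forall p : prime_number, 'F_(sval p)).

Section PrimeProd.
Implicit Types f g h : prime_prod.

Let padd f g : prime_prod := fun p => f p + g p.
Let popp f : prime_prod := fun p => - f p.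
Let pmul f g : prime_prod := fun p => f p * g p.
Let pzero : prime_prod := fun=> 0.
Let pone : prime_prod := fun=> 1.

Let paddA : associative padd.
Proof. by move=> f g h; apply: functional_extensionality_dep => p; apply: addrA. Qed.
Let paddC : commutative padd.
Proof. by move=> f g; apply: functional_extensionality_dep => p; apply: addrC. Qed.
Let padd0 : left_id pzero padd.
Proof. by move=> f; apply: functional_extensionality_dep => p; apply: add0r. Qed.
Let paddN : left_inverse pzero popp padd.
Proof. by move=> f; apply: functional_extensionality_dep => p; apply: addNr. Qed.

HB.instance Definition _ := GRing.isZmodule.Build prime_prod paddA paddC padd0 paddN.

Let pmulA : associative pmul.
Proof. by move=> f g h; apply: functional_extensionality_dep => p; apply: mulrA. Qed.
Let pmulC : commutative pmul.
Proof. by move=> f g; apply: functional_extensionality_dep => p; apply: mulrC. Qed.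
Let pmul1 : left_id pone pmul.
Proof. by move=> f; apply: functional_extensionality_dep => p; apply: mul1r. Qed.
Let pmulDl : left_distributive pmul padd.
Proof. by move=> f g h; apply: functional_extensionality_dep => p; apply: mulrDl. Qed.

HB.instance Definition _ :=
  GRing.Zmodule_isComPzRing.Build prime_prod pmulA pmulC pmul1 pmulDl.

Definition finitely_supported f : Prop := finite_set [set p | f p <> 0]%classic.

Let fs0 : finitely_supported 0.
Proof. by apply: (@sub_finite_set _ _ set0) => // p /=. Qed.
Let fsB f g :
  finitely_supported f -> finitely_supported g -> finitely_supported (f - g).
Proof.
move=> hf hg.
apply: (@sub_finite_set _ _ ([set p | f p <> 0] `|` [set p | g p <> 0])%classic).
  move=> p /= hp; have [f0|] := pselect (f p = 0); last by left.
  right=> g0; apply: hp.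
  by rewrite -[LHS]/(f p - g p) f0 g0 subrr.
by rewrite finite_setU.
Qed.
Let fsM f g : finitely_supported g -> finitely_supported (f * g).
Proof.
move=> hg; apply: sub_finite_set hg => p /= hp g0; apply: hp.
by rewrite -[LHS]/(f p * g p) g0 mulr0.
Qed.

(* The direct sum of the Z/pZ, as an ideal of their product. *)
Definition prime_dirsum : ideal prime_prod := Ideal fs0 fsB fsM.

End PrimeProd.

Definition A1 : comPzRingType := quot prime_dirsum.

Definition A1_of (f : prime_prod) : A1 := qclass prime_dirsum f.

(* The embedding of Q in A_1: ratr q is the residue of q for all the primes p
   not dividing its denominator, hence for all but finitely many p. *)
Definition ratA (q : rat) : A1 := A1_of (fun p => ratr q).

Definition zetaA (k : mindex) : A1 :=
  A1_of (fun p => nested_sum 'F_(sval p) ltn k (sval p)).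

Definition zetaA_star (k : mindex) : A1 :=
  A1_of (fun p => nested_sum 'F_(sval p) leq k (sval p)).

Fixpoint bernoullis (n : nat) : seq rat :=
  if n is m.+1 then
    let s := bernoullis m in
    rcons s (((m == 0)%:R - \sum_(j < m) 'C(m.+1, j)%:R * s`_j) / m.+1%:R)
  else [::].

Definition bernoulli_nb (n : nat) : rat := (bernoullis n.+1)`_n.

Lemma size_bernoullis n : size (bernoullis n) = n.
Proof. by elim: n => //= n IH; rewrite size_rcons IH. Qed.

Lemma nth_bernoullis n j : (j < n)%N -> (bernoullis n)`_j = bernoulli_nb j.
Proof.
elim: n => // n IH; rewrite ltnS leq_eqVlt => /orP[/eqP -> //|jn].
by rewrite [bernoullis _]/= nth_rcons size_bernoullis jn IH.
Qed.

Lemma bernoulli_nbE (n : nat) :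
  \sum_(j < n.+1) 'C(n.+1, j)%:R * bernoulli_nb j = (n == 0)%:R.
Proof.
have E : bernoulli_nb n =
    ((n == 0)%:R - \sum_(j < n) 'C(n.+1, j)%:R * bernoulli_nb j) / n.+1%:R.
  rewrite /bernoulli_nb [bernoullis _]/= nth_rcons size_bernoullis ltnn eqxx.
  by under eq_bigr => j _ do rewrite nth_bernoullis //.
by rewrite big_ord_recr /= binSn mulrC [in X in _ + X]E divfK ?pnatr_eq0 // subrKC.
Qed.

(* For primes p < k or p dividing k the component is junk, as it is for all p
   when k = 1 (B_(p-1) is not p-integral); the former do not matter in A_1. *)
Definition ZfrakA (k : nat) : A1 :=
  A1_of (fun p => ratr (bernoulli_nb (sval p - k) / k%:R)).

(* Iterated products of indices, as lists with multiplicity. *)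
Fixpoint stuffle (k l : mindex) {struct k} : seq mindex :=
  if k is a :: k' then
    (fix stuffle_k (l : mindex) : seq mindex :=
       if l is b :: l' then
         map (cons a) (stuffle k' l) ++ map (cons b) (stuffle_k l')
           ++ map (cons (a + b)%N) (stuffle k' l')
       else [:: k]) l
  else [:: l].

Fixpoint word_shuffle (u v : seq bool) {struct u} : seq (seq bool) :=
  if u is a :: u' then
    (fix shuffle_u (v : seq bool) : seq (seq bool) :=
       if v is b :: v' then
         map (cons a) (word_shuffle u' v) ++ map (cons b) (shuffle_u v')
       else [:: u]) v
  else [:: v].

(* The word of (k_1, ..., k_r) is x_1 x_0^(k_1 - 1) ... x_1 x_0^(k_r - 1), with
   true for x_1 = dt/(1 - t) and false for x_0 = dt/t; zeta(k) is its iterated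
   integral over 0 < t_1 < t_2 < ... < 1. *)
Definition word_of_index (k : mindex) : seq bool :=
  flatten [seq true :: nseq a.-1 false | a <- k].

Fixpoint parse_word (w : seq bool) : nat * mindex :=
  match w with
  | [::] => (0%N, [::])
  | false :: w' => ((parse_word w').1.+1, (parse_word w').2)
  | true :: w' => (0%N, (parse_word w').1.+1 :: (parse_word w').2)
  end.

Definition index_of_word (w : seq bool) : mindex := (parse_word w).2.

Lemma word_of_indexK k : is_index k -> index_of_word (word_of_index k) = k.
Proof.
have E : forall k, is_index k -> parse_word (word_of_index k) = (0%N, k).
  elim=> //= -[|a] k' IH //= /IH {}IH.
  rewrite /word_of_index /= -/(word_of_index k').
  suff -> : parse_word (nseq a false ++ word_of_index k') = (a, k') by [].
  by elim: a => //= a ->.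
by move=> /E; rewrite /index_of_word => ->.
Qed.

Definition shuffle (k l : mindex) : seq mindex :=
  map index_of_word (word_shuffle (word_of_index k) (word_of_index l)).

Variant regularization := Harmonic | Shuffle.

Definition index_prod (bul : regularization) : mindex -> mindex -> seq mindex :=
  if bul is Harmonic then stuffle else shuffle.

Section MZV.
Variable R : realType.

Definition mzv (k : mindex) : R := limn (nested_sum R ltn k).

(* A non-admissible index is of the form (k', 1), and zreg is computed from the
   relation zeta(k') zeta(1) = 0: its left-hand side expands as a positive
   multiple of zeta(k', 1), plus values at indices with fewer trailing ones.
   The first argument bounds the number of trailing ones. *)
Fixpoint zreg_rec (bul : regularization) (n : nat) (k : mindex) : R :=
  if admissible k then mzv k
  else if n is n'.+1 then
    let s := index_prod bul (take (size k).-1 k) [:: 1%N] in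
    - (\sum_(l <- s | l != k) zreg_rec bul n' l) / (count_mem k s)%:R
  else 0.

Definition zreg (bul : regularization) (k : mindex) : R :=
  zreg_rec bul (size k) k.

End MZV.

(* Length of the longest suffix of s all of whose items satisfy p, used to bound
   the recursion depth in zreg_rec. *)
Fixpoint trail (T : Type) (p : pred T) (s : seq T) : nat :=
  if s is _ :: s' then (trail p s' + all p s)%N else 0.

Section Trail.
Variables (T : Type) (p : pred T).

Lemma trail_le s : (trail p s <= size s)%N.
Proof. by elim: s => //= a s; lia. Qed.

Lemma trail_all s : all p s = (trail p s == size s).
Proof.
elim: s => //= a s IH; have := trail_le s; rewrite IH.
by case: (p a) => /=; case: eqP; lia.
Qed.

Lemma trail_rcons s a : p a -> trail p (rcons s a) = (trail p s).+1.
Proof. by move=> pa; elim: s => [|b s IH] /=; rewrite ?pa // IH all_rcons pa. Qed.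

Lemma trail_cons_le s t a b : (size t <= size s)%N -> (p a -> p b) ->
  (trail p s <= trail p t)%N -> (trail p (a :: s) <= trail p (b :: t))%N.
Proof.
move=> le_ts pab le; rewrite /= leq_add //; case: andP => //= -[/pab -> ].
rewrite !trail_all => /eqP h; have := trail_le t; rewrite /= lt0b => ?.
by apply/eqP; lia.
Qed.

End Trail.

Lemma trail0_admissible k :
  is_index k -> trail (pred1 1%N) k = 0%N -> admissible k.
Proof.
rewrite /admissible => ik; rewrite ik /=.
case/lastP: k ik => // k a; rewrite /is_index all_rcons last_rcons.
case: a => [|[|a]] //= _; by rewrite trail_rcons.
Qed.

Lemma stuffle_one k l : is_index k -> l \in stuffle k [:: 1%N] ->
  [/\ is_index l, (size k <= size l)%N &
      l = rcons k 1%N \/ (trail (pred1 1%N) l <= trail (pred1 1%N) k)%N].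
Proof.
elim: k l => [|a k IH] l /=.
  by move=> _; rewrite inE => /eqP ->; split=> //; left.
move=> /andP[a0 ik]; rewrite !mem_cat /= !inE => /orP[|/orP[]].
- case/mapP => l' /(IH _ ik)[il' sz [->|tr]] ->.
    by rewrite /= /is_index /= a0 all_rcons size_rcons; split=> //; left.
  split; rewrite /= ?a0 //; right; exact: trail_cons_le.
- move=> /eqP ->; rewrite /is_index /= a0; split=> //.
  have [a1|a1] := boolP (all (pred1 1%N) (a :: k)).
    left; rewrite -rcons_cons (all_pred1P _ _ a1) -cats1.
    by rewrite -[[:: 1%N]]/(nseq 1 1%N) -nseqD addn1.
  by right; rewrite /= in a1 *; rewrite (negbTE a1) !addn0.
- case/mapP => l'; case: k ik {IH} => [|b k] ik /=; rewrite inE => /eqP -> ->.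
    by rewrite /is_index /= addn1 eqSS; split=> //; right; case: a a0.
  move: ik; rewrite /is_index /= addn1 => ->; split=> //; right.
  by rewrite eqSS leq_add2l; case: a a0.
Qed.

Lemma mem_stuffle_one k : rcons k 1%N \in stuffle k [:: 1%N].
Proof.
elim: k => [|a k IH] /=; first by rewrite inE.
by rewrite mem_cat map_f.
Qed.

Lemma word_shuffle_one u w : w \in word_shuffle u [:: true] ->
  size w = (size u).+1 /\ (w = rcons u true \/ (trail id w <= trail id u)%N).
Proof.
elim: u w => [|a u IH] w /=.
  by rewrite inE => /eqP ->; split=> //; left.
rewrite mem_cat /= inE => /orP[/mapP[w' /IH[sz [->|tr]] ->]|/eqP ->].
- by rewrite /= size_rcons; split=> //; left.
- by rewrite /= sz; split=> //; right; apply: trail_cons_le; rewrite ?sz.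
- split=> //; have [a1|a1] := boolP (all id (a :: u)).
    left; have au : all (pred1 true) (a :: u) by rewrite (eq_all (a2 := id)) // => -[].
    rewrite -rcons_cons (all_pred1P _ _ au) -cats1.
    by rewrite -[[:: true]]/(nseq 1 true) -nseqD addn1.
  by right; rewrite /= in a1 *; rewrite (negbTE a1) !addn0.
Qed.

Lemma mem_word_shuffle_one u : rcons u true \in word_shuffle u [:: true].
Proof.
elim: u => [|a u IH] /=; first by rewrite inE.
by rewrite mem_cat map_f.
Qed.

Lemma word_of_index_rcons1 k : word_of_index (rcons k 1%N) = rcons (word_of_index k) true.
Proof. by rewrite /word_of_index map_rcons flatten_rcons cats1. Qed.

Lemma index_of_wordP w : is_index (index_of_word w).
Proof. by elim: w => // -[] w IH //=. Qed.

Lemma trail_index_of_word w :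
  trail (pred1 1%N) (index_of_word w) = trail id w.
Proof.
have E v : all id v = ((parse_word v).1 == 0%N) && all (pred1 1%N) (parse_word v).2.
  by elim: v => // -[] v //= ->.
rewrite /index_of_word; elim: w => // -[] w IH /=; last by rewrite IH addn0.
by rewrite IH E.
Qed.

Lemma index_prod_one bul k l : is_index k -> l \in index_prod bul k [:: 1%N] ->
  is_index l /\
  (l = rcons k 1%N \/ (trail (pred1 1%N) l <= trail (pred1 1%N) k)%N).
Proof.
case: bul => ik; first by case/(stuffle_one ik).
case/mapP => w /word_shuffle_one[_ [->|tr]] ->; split; try exact: index_of_wordP.
  left; rewrite -word_of_index_rcons1 word_of_indexK //.
  by rewrite /is_index all_rcons.
right; rewrite trail_index_of_word (leq_trans tr) //.
by rewrite -[in leqRHS](word_of_indexK ik) trail_index_of_word.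
Qed.

Lemma mem_index_prod_one bul k :
  is_index k -> rcons k 1%N \in index_prod bul k [:: 1%N].
Proof.
case: bul => ik; first exact: mem_stuffle_one.
apply/mapP; exists (rcons (word_of_index k) true); first exact: mem_word_shuffle_one.
by rewrite -word_of_index_rcons1 word_of_indexK // /is_index all_rcons.
Qed.

(* zreg bul is the only candidate for the multiplicative extension of zeta to
   all indices that vanishes at (1). *)
Lemma zreg_unique (R : realType) (bul : regularization) (f : mindex -> R) :
    (forall k, admissible k -> f k = mzv R k) -> f [:: 1%N] = 0 ->
    (forall k l, is_index k -> is_index l ->
      f k * f l = \sum_(m <- index_prod bul k l) f m) ->
  forall k, is_index k -> f k = zreg R bul k.
Proof.
move=> fadm f1 fM k; have := trail_le (pred1 1%N) k; rewrite /zreg.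
move: (size k) => n; elim: n k => [|n IH] k.
  rewrite leqn0 => /eqP tr ik /=; have ad := trail0_admissible ik tr.
  by rewrite ad fadm.
move=> tr ik /=; have [ad|nad] := boolP (admissible k); first exact: fadm.
case/lastP: k => [//|k a] in tr ik nad *.
have [ik' a1] : is_index k /\ a = 1%N.
  move: ik nad; rewrite /admissible /is_index all_rcons last_rcons.
  by case: a {tr} => [|[|a]] //= ->.
rewrite {}a1 in tr ik nad *.
rewrite size_rcons /= -cats1 take_size_cat // cats1.
set s := index_prod _ _ _.
have c0 : (count_mem (rcons k 1%N) s)%:R != 0 :> R.
  by rewrite pnatr_eq0 -lt0n -has_count has_pred1 mem_index_prod_one.
have := fM k [:: 1%N] ik' erefl; rewrite f1 mulr0 -/s.
rewrite (bigID (pred1 (rcons k 1%N))) /=.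
rewrite (eq_bigr (fun=> f (rcons k 1%N))); last by move=> l /eqP ->.
rewrite big_const_seq iter_addr_0 => /esym/eqP; rewrite addr_eq0 => /eqP E.
suff -> : \sum_(l <- s | l != rcons k 1%N) zreg_rec R bul n l =
          \sum_(l <- s | l != rcons k 1%N) f l.
  by rewrite -E -[f _ *+ _]mulr_natr mulfK.
rewrite big_seq_cond [RHS]big_seq_cond; apply: eq_bigr => l /andP[ls nl].
have [il [El|tl]] := index_prod_one ik' ls; first by rewrite El eqxx in nl.
apply/esym/IH => //; apply: leq_trans tl _; move: tr.
by rewrite trail_rcons // ltnS.
Qed.

Section MZVRing.
Variable R : realType.

Inductive is_mzv_poly : R -> Prop :=
| MzvGen k : admissible k -> is_mzv_poly (mzv R k)
| MzvRat q : is_mzv_poly (ratr q)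
| MzvAdd x y : is_mzv_poly x -> is_mzv_poly y -> is_mzv_poly (x + y)
| MzvMul x y : is_mzv_poly x -> is_mzv_poly y -> is_mzv_poly (x * y).

Definition mzv_poly : {pred R} := fun x => `[< is_mzv_poly x >].

Lemma mzv_polyP x : reflect (is_mzv_poly x) (x \in mzv_poly).
Proof. exact: asboolP. Qed.

Lemma mzv_poly_subring : subring_closed mzv_poly.
Proof.
have oppr x : is_mzv_poly x -> is_mzv_poly (- x).
  move=> hx; rewrite -mulN1r -(rmorph1 (ratr : rat -> R)) -rmorphN.
  by apply: MzvMul hx; apply: MzvRat.
split=> [|x y /mzv_polyP hx /mzv_polyP hy|x y /mzv_polyP hx /mzv_polyP hy].
- by apply/mzv_polyP; rewrite -(rmorph1 (ratr : rat -> R)); apply: MzvRat.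
- by apply/mzv_polyP; apply: MzvAdd => //; apply: oppr.
- by apply/mzv_polyP; apply: MzvMul.
Qed.

HB.instance Definition _ := GRing.isSubringClosed.Build R mzv_poly mzv_poly_subring.

Record mzv_ring := MzvRing { mzv_val :> R; _ : mzv_val \in mzv_poly }.

HB.instance Definition _ := [isSub for mzv_val].
HB.instance Definition _ := [Choice of mzv_ring by <:].
HB.instance Definition _ := [SubChoice_isSubComNzRing of mzv_ring by <:].

Lemma mzv_in k : admissible k -> mzv R k \in mzv_poly.
Proof. by move=> ak; apply/mzv_polyP; apply: MzvGen. Qed.

Lemma ratr_in q : ratr q \in mzv_poly.
Proof. by apply/mzv_polyP; apply: MzvRat. Qed.

Lemma zreg_in bul k : zreg R bul k \in mzv_poly.
Proof.
rewrite /zreg; elim: (size k) {2}k => [|n IH] {}k /=; case: ifPn => [/mzv_in //|_].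
  exact: rpred0.
rewrite -(ratr_nat R) -fmorphV.
by rewrite rpredM ?ratr_in // rpredN rpred_sum.
Qed.

Definition zregZ bul k : mzv_ring := MzvRing (zreg_in bul k).

Definition ratZ (q : rat) : mzv_ring := MzvRing (ratr_in q).

(* The Riemann zeta value zeta(k) for k >= 2, and 0 for k < 2. *)
Definition zetaZ (k : nat) : mzv_ring :=
  if boolP (admissible [:: k]) is AltTrue ak then MzvRing (mzv_in ak) else 0.

Definition zeta2_multiple (x : mzv_ring) : Prop := exists y, x = zetaZ 2 * y.

Let z20 : zeta2_multiple 0.
Proof. by exists 0; rewrite mulr0. Qed.
Let z2B x y : zeta2_multiple x -> zeta2_multiple y -> zeta2_multiple (x - y).
Proof. by move=> [u ->] [v ->]; exists (u - v); rewrite mulrBr. Qed.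
Let z2M a x : zeta2_multiple x -> zeta2_multiple (a * x).
Proof. by move=> [u ->]; exists (a * u); rewrite mulrCA. Qed.

Definition zeta2_ideal : ideal mzv_ring := Ideal z20 z2B z2M.

Definition Zbar : comPzRingType := quot zeta2_ideal.

Definition Zbar_of (x : mzv_ring) : Zbar := qclass zeta2_ideal x.

Definition ratS (q : rat) : Zbar := Zbar_of (ratZ q).

Definition zetaS (bul : regularization) (k : mindex) : Zbar :=
  Zbar_of (\sum_(i < (size k).+1)
    (-1) ^+ sumn (drop i k) * zregZ bul (take i k) * zregZ bul (rev (drop i k))).

(* merge_from a k lists the indices obtained from a [] k_1 [] ... [] k_r by
   replacing each box by a comma or a plus. *)
Fixpoint merge_from (a : nat) (k : mindex) : seq mindex :=
  if k is b :: k' then map (cons a) (merge_from b k') ++ merge_from (a + b) k'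
  else [:: [:: a]].

Definition merges (k : mindex) : seq mindex :=
  if k is a :: k' then merge_from a k' else [:: [::]].

Definition zetaS_star (bul : regularization) (k : mindex) : Zbar :=
  \sum_(l <- merges k) zetaS bul l.

(* The value 0 at k = 1 realizes the convention that the terms in which it
   occurs, all with coefficient 0, vanish. *)
Definition ZfrakS (k : nat) : Zbar := Zbar_of (zetaZ k).

End MZVRing.

(* The second one carries the regularization that defines zeta_S. *)
Variant setting := SettingA | SettingS of regularization.

Section Settings.
Variable R : realType.

Definition ring_F (F : setting) : comPzRingType :=
  match F with SettingA => A1 | SettingS _ => Zbar R end.

Definition rat_F (F : setting) (q : rat) : ring_F F :=
  match F return ring_F F with
  | SettingA => ratA q | SettingS _ => ratS R q end.

Definition zeta_F (F : setting) (k : mindex) : ring_F F :=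
  match F return ring_F F with
  | SettingA => zetaA k | SettingS bul => zetaS R bul k end.

Definition zeta_star_F (F : setting) (k : mindex) : ring_F F :=
  match F return ring_F F with
  | SettingA => zetaA_star k | SettingS bul => zetaS_star R bul k end.

Definition Zfrak_F (F : setting) (k : nat) : ring_F F :=
  match F return ring_F F with
  | SettingA => ZfrakA k | SettingS _ => ZfrakS R k end.

End Settings.

(* Main.v *)
(* Write (a, b) for the index ({2}^a, 1, {2}^b), e_N(i) for the sum truncated at
   N with index {2}^i, and P_N(z) for the product of 1 - z^2/k^2 over k <= N.
   The generating polynomial over b of the truncated sums zeta_N(a, b), with
   signs, is P_N(y) times the sum over n <= N of (-1)^a e_(n-1)(a) / (n P_n(y)).
   Telescoping over the shifts y + j turns 1 / (n P_n(y)) into an alternating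
   sum of 1 / (n^2 P_n(y + j)), and for each shift the sum over n is then
   evaluated by a Wilf-Zeilberger pair.

   Modulo p = 2h + 1, the list 1, ..., p - 1 is 1, ..., h, -h, ..., -1. For N = h
   one has P_h(y) = 1 - y^(p-1), hence e_h(i) = 0 for 0 < i < h, and the identity
   with p - 1 shifts becomes polynomial; its coefficients are alternating power
   sums, that is, Bernoulli numbers.

   In the symmetric case zeta_S is the class of the limit of the sums over the
   list 1, ..., N, -N, ..., -1, in which the divergent harmonic numbers cancel.
   As e(i) is a multiple of zeta(2) for i > 0, letting N tend to infinity in the
   identity with 2N shifts gives zeta(a, b) modulo zeta(2) for a > 0, and the
   sum of zeta(i, n - i) over i <= n then gives zeta(0, n).

   For any finite list, sums S, star sums S* and elementary sums e satisfy
   sum_(i, j) (-1)^(i+j) e(i) e(j) S*(a - i, b - j) = (-1)^(a+b) S(b, a), which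
   deduces the star values from the others. *)

Require Import Defs.
From mathcomp Require Import all_boot all_order all_algebra.
From mathcomp Require Import all_classical all_reals all_analysis.
From mathcomp Require Import zify ring lra.

Set Implicit Arguments.
Unset Strict Implicit.
Unset Printing Implicit Defensive.

Import Order.TTheory GRing.Theory Num.Theory.
Import numFieldNormedType.Exports.
Local Open Scope ring_scope.

(** * Nested sums over lists *)

(** The two cases differ in how the telescoping closes. In characteristic p a shift by p returns to
    the starting point, so one alternating sum expresses 1 / P_n(y) exactly. Over the reals it never
    closes. Instead the alternating sums started at y and at -y are subtracted: their near ends
    differ by the wanted term because the telescoped product is invariant under z -> 1 - z, and
    their far ends after 2N shifts are O(1/N). The real identity has no limit as it stands: the
    shift by j contributes a term of order 1/j, and zeta(a, 0) itself diverges. Subtracting (-1)^a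
    e_N(a) times the identity for a = 0 removes both divergences, and for a > 0 it alters the
    convergent values only by multiples of zeta(2). For a = 0 it leaves 0 = 0, so zeta(0, n) has to
    come from a separate sum formula. Coefficients of powers of y pass to the limit through
    polynomial approximations whose error constants are independent of N. *)

Section NestedSums.
Variable F : fieldType.
Implicit Types (k l : mindex) (s : seq F) (x : F).

(** Summation runs along an arbitrary list, in list order, so that one recursion covers 1, ..., N,
    its residues modulo p, the symmetric list with its negative half, and all prefixes and suffixes
    of these. *)
Fixpoint ns s k : F :=
  if s is x :: s' then
    ns s' k + (if k is a :: k' then x ^- a * ns s' k' else 0)
  else (k == [::])%:R.

(** The inner fixpoint keeps [x] available after it has been used, which is how equal positions
    enter. *)
Fixpoint nst s : mindex -> F :=
  if s is x :: s' then
    fix nst_x k := if k is a :: k' then nst s' k + x ^- a * nst_x k' else 1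
  else fun k => (k == [::])%:R.

Arguments ns : simpl never.
Arguments nst : simpl never.

Lemma ns0 k : ns [::] k = (k == [::])%:R.
Proof. by []. Qed.

Lemma nst0 k : nst [::] k = (k == [::])%:R.
Proof. by []. Qed.

Lemma ns_nil s : ns s [::] = 1.
Proof. by elim: s => // x s; rewrite {2}/ns -/ns => ->; rewrite addr0. Qed.

Lemma nst_nil s : nst s [::] = 1.
Proof. by case: s. Qed.

Lemma ns_cons x s a k : ns (x :: s) (a :: k) = ns s (a :: k) + x ^- a * ns s k.
Proof. by []. Qed.

Lemma nst_cons x s a k :
  nst (x :: s) (a :: k) = nst s (a :: k) + x ^- a * nst (x :: s) k.
Proof. by []. Qed.

Lemma ns_cat s1 s2 k :
  ns (s1 ++ s2) k = \sum_(i < (size k).+1) ns s1 (take i k) * ns s2 (drop i k).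
Proof.
elim: s1 k => [|x s1 IH] k.
  rewrite big_ord_recl /= take0 drop0 ns_nil mul1r big1 ?addr0 // => i _.
  by case: k i => [|a k] i; [case: i | rewrite /= ns0 mul0r].
case: k => [|a k].
  by rewrite big_ord1 /= !ns_nil mulr1.
rewrite cat_cons ns_cons !IH [in RHS]big_ord_recl [in LHS]big_ord_recl /= !ns_nil.
rewrite -addrA; congr (_ + _).
rewrite big_distrr -big_split; apply: eq_bigr => i _ /=.
by rewrite ns_cons mulrDl mulrA.
Qed.

Lemma ns1 x k : ns [:: x] k =
  match k with [::] => 1 | [:: a] => x ^- a | _ => 0 end.
Proof.
case: k => [|a [|b k]]; rewrite ?ns_nil // ns_cons !ns0 /=.
  by rewrite add0r mulr1.
by rewrite mulr0 addr0.
Qed.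

Lemma ns_rcons s x k a :
  ns (rcons s x) (rcons k a) = ns s (rcons k a) + x ^- a * ns s k.
Proof.
rewrite -[rcons s x]cats1 ns_cat size_rcons 2!big_ord_recr /= big1 => [|i _].
  rewrite add0r -[rcons k a]cats1 take_size_cat // drop_size_cat // ns1.
  rewrite -[(size k).+1]addn1 -[1%N]/(size [:: a]) -size_cat take_size drop_size.
  by rewrite ns_nil mulr1 addrC [_ * x ^- a]mulrC.
rewrite ns1 /=; have: size (drop i (rcons k a)) = (size k - i).+1.
  by rewrite size_drop size_rcons subSn // ltnW.
have := ltn_ord i; case: (drop _ _) => [|b [|c l]] //=; last by rewrite mulr0.
by move=> ? []; lia.
Qed.

Lemma ns_rev s k : ns (rev s) (rev k) = ns s k.
Proof.
elim: s k => [|x s IH] k.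
  by rewrite !ns0; case/lastP: k => // k a; rewrite rev_rcons; case: k.
rewrite rev_cons; case: k => [|a k]; first by rewrite !ns_nil.
by rewrite rev_cons ns_rcons -rev_cons !IH.
Qed.

Lemma ns_opp s k : ns (map -%R s) k = (-1) ^+ sumn k * ns s k.
Proof.
elim: s k => [|x s IH] [|a k]; rewrite ?ns_nil ?expr0 ?mulr1 //.
  by rewrite !ns0 mulr0.
rewrite map_cons !ns_cons !IH mulrDr; congr (_ + _) => /=.
by rewrite -exprVn invrN (exprNn x^-1) exprVn exprD mulrACA.
Qed.

(** In a star sum, a maximal block of entries placed at the same position acts as a single entry,
    their sum; the ways to cut the index into such blocks are its merges. *)
Lemma sum_merges s k : \sum_(l <- merges k) ns s l = nst s k.
Proof.
suff H a k' : \sum_(l <- merge_from a k') ns s l = nst s (a :: k').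
  by case: k => [|a k'] /=; [rewrite big_seq1 ns_nil nst_nil | exact: H].
elim: s a k' => [|x s IH] a k'.
  elim: k' a => [|b k' IHk] a /=; first by rewrite big_seq1.
  by rewrite big_cat big_map IHk /= big1 ?addr0.
(* [G] collects the terms that use [x]. In the inner induction, each merge into the first entry is
   one more use of [x] in the star sum. *)
pose G l := if l is c :: l' then x ^- c * ns s l' else 0.
have -> : \sum_(l <- merge_from a k') ns (x :: s) l =
    nst s (a :: k') + \sum_(l <- merge_from a k') G l.
  by rewrite -IH -big_split.
rewrite nst_cons; congr (_ + _); elim: k' a => [|b k' IHk] a.
  by rewrite /= big_seq1 /= ns_nil nst_nil.
rewrite [merge_from _ _]/= big_cat big_map IHk /= -big_distrr /= IH.
by rewrite nst_cons exprD invfM -mulrA -mulrDr.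
Qed.

Lemma ns_stuffle s k :
  \sum_(l <- stuffle k [:: 1%N]) ns s l = ns s k * ns s [:: 1%N].
Proof.
have st0 k' : stuffle k' [::] = [:: k'] by case: k'.
elim: s k => [|x s IH] k.
  rewrite [RHS]mulr0 big_seq; apply: big1 => l.
  case: k => [|a k] /=; first by rewrite inE => /eqP ->.
  rewrite !mem_cat !inE.
  by case/or3P => [/mapP[? _ ->]|/eqP ->|/mapP[? _ ->]].
case: k => [|a k]; first by rewrite big_seq1 ns_nil mul1r.
have stE : stuffle (a :: k) [:: 1%N] =
    map (cons a) (stuffle k [:: 1%N]) ++ [:: [:: 1, a & k]; (a + 1)%N :: k].
  by rewrite /= st0.
have := IH (a :: k); rewrite stE !big_cat !big_map !big_cons !big_nil /= => E.
under eq_bigr do rewrite ns_cons.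
rewrite big_split -big_distrr /= IH !ns_cons ns_nil exprD expr1 invfM.
(* The induction hypothesis at [a :: k], solved for the terms that come from [stuffle k]. *)
have {}E := etrans (esym (addrK _ _)) (congr1 (fun u => u - _) E).
rewrite E; ring.
Qed.

End NestedSums.

Arguments ns : simpl never.
Arguments nst : simpl never.

Definition idx (a b : nat) : mindex := nseq a 2%N ++ 1%N :: nseq b 2%N.

Section ElementarySums.
Variable F : fieldType.
Implicit Types (s : seq F) (x : F).

Definition e2 s i : F := ns s (nseq i 2%N).
Definition h2 s i : F := nst s (nseq i 2%N).

Lemma e2_0 s : e2 s 0 = 1. Proof. exact: ns_nil. Qed.
Lemma h2_0 s : h2 s 0 = 1. Proof. exact: nst_nil. Qed.

Lemma e2_nil i : e2 [::] i = (i == 0%N)%:R.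
Proof. by case: i. Qed.

Lemma e2_cons x s i : e2 (x :: s) i.+1 = e2 s i.+1 + x ^- 2 * e2 s i.
Proof. by []. Qed.

Lemma h2_cons x s i : h2 (x :: s) i.+1 = h2 s i.+1 + x ^- 2 * h2 (x :: s) i.
Proof. by []. Qed.

Lemma e2_rcons x s i : e2 (rcons s x) i.+1 = e2 s i.+1 + x ^- 2 * e2 s i.
Proof.
have nE n : nseq n.+1 2%N = rcons (nseq n 2%N) 2%N.
  by rewrite -cats1 -[[:: 2%N]]/(nseq 1 2%N) -nseqD addn1.
by rewrite /e2 !nE ns_rcons.
Qed.

Lemma e2_cat s1 s2 a :
  e2 (s1 ++ s2) a = \sum_(i < a.+1) e2 s1 i * e2 s2 (a - i).
Proof.
rewrite /e2 ns_cat size_nseq; apply: eq_bigr => i _.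
by rewrite take_nseq ?drop_nseq // -ltnS.
Qed.

Lemma e2_catC s1 s2 a : e2 (s1 ++ s2) a = e2 (s2 ++ s1) a.
Proof.
rewrite !e2_cat (reindex_inj rev_ord_inj) /=; apply: eq_bigr => i _.
by rewrite subSS mulrC subKn // -ltnS.
Qed.

(** With signs, the generating function of [e2] is the product of 1 - T / x^2 over the list, and
    that of [h2 s1] is the inverse of the part over [s1]; only the factors of [s2] remain. *)
Lemma sum_e2_h2 s1 s2 a :
  \sum_(i < a.+1) (-1) ^+ i * e2 (s1 ++ s2) i * h2 s1 (a - i) =
  (-1) ^+ a * e2 s2 a.
Proof.
elim: s1 => [|x s IH].
  rewrite big_ord_recr /= big1 => [|i _]; last first.
    by rewrite /h2 nst0 -size_eq0 size_nseq subn_eq0 leqNgt ltn_ord mulr0.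
  by rewrite add0r subnn h2_0 mulr1.
case: a IH => [|a] IH; first by rewrite !big_ord1 !e2_0 h2_0 !mulr1.
rewrite -{}IH cat_cons big_ord_recl [RHS]big_ord_recl /= !e2_0 !subn0 h2_cons.
have -> : \sum_(i < a.+1) (-1) ^+ bump 0 i * e2 (x :: s ++ s2) (bump 0 i)
              * h2 (x :: s) (a.+1 - bump 0 i) =
    \sum_(i < a.+1) (-1) ^+ i.+1 * e2 (s ++ s2) i.+1 * h2 (x :: s) (a - i)
    - x ^- 2 * \sum_(i < a.+1) (-1) ^+ i * e2 (s ++ s2) i * h2 (x :: s) (a - i).
  rewrite big_distrr -sumrB; apply: eq_bigr => i _ /=.
  by rewrite /bump add1n subSS e2_cons exprS; ring.
rewrite [X in _ - _ * X]big_ord_recl [X in _ + (X - _)]big_ord_recr /=.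
rewrite [in RHS]big_ord_recr /= !e2_0 !subnn !subn0 !h2_0.
have -> : \sum_(i < a) (-1) ^+ i.+1 * e2 (s ++ s2) i.+1 * h2 (x :: s) (a - i) =
    \sum_(i < a) (-1) ^+ bump 0 i * e2 (s ++ s2) (bump 0 i) * h2 s (a.+1 - bump 0 i)
    + x ^- 2 * \sum_(i < a) (-1) ^+ bump 0 i * e2 (s ++ s2) (bump 0 i) * h2 (x :: s) (a - bump 0 i).
  rewrite big_distrr -big_split; apply: eq_bigr => i _ /=.
  rewrite /bump add1n subSS; have -> : (a - i = (a - i.+1).+1)%N by have := ltn_ord i; lia.
  by rewrite h2_cons; ring.
ring.
Qed.

Lemma ns_idx0_cons x s b :
  ns (x :: s) (idx 0 b) = ns s (idx 0 b) + x^-1 * e2 s b.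
Proof. by []. Qed.

Lemma ns_idxS_cons x s a b :
  ns (x :: s) (idx a.+1 b) = ns s (idx a.+1 b) + x ^- 2 * ns s (idx a b).
Proof. by []. Qed.

Lemma nst_idx0_cons x s b :
  nst (x :: s) (idx 0 b) = nst s (idx 0 b) + x^-1 * h2 (x :: s) b.
Proof. by []. Qed.

Lemma nst_idxS_cons x s a b :
  nst (x :: s) (idx a.+1 b) = nst s (idx a.+1 b) + x ^- 2 * nst (x :: s) (idx a b).
Proof. by []. Qed.

Lemma ns_idx s a b :
  ns s (idx a b) =
  \sum_(i < size s) e2 (take i s) a * (nth 0 s i)^-1 * e2 (drop i.+1 s) b.
Proof.
elim: s a => [|x s IH] a; first by rewrite big_ord0 ns0; case: a.
rewrite big_ord_recl /= drop0 e2_nil.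
case: a => [|a].
  rewrite ns_idx0_cons IH addrC mul1r; congr (_ + _).
  by apply: eq_bigr => i _; rewrite add0n !e2_0.
rewrite !mul0r add0r ns_idxS_cons !IH big_distrr -big_split.
by apply: eq_bigr => i _ /=; rewrite add0n e2_cons; ring.
Qed.

(** Both slices contain position [i], since equal positions are allowed around the entry 1. Because
    of this overlap, cancelling one slice leaves the other side without position [i]. *)
Lemma nst_idx s a b :
  nst s (idx a b) =
  \sum_(i < size s) h2 (take i.+1 s) a * (nth 0 s i)^-1 * h2 (drop i s) b.
Proof.
elim: s a => [|x s IH] a; first by rewrite big_ord0 nst0; case: a.
elim: a => [|a IHa]; rewrite big_ord_recl.
  rewrite nst_idx0_cons IH addrC /= take0 h2_0 mul1r; congr (_ + _).
  by apply: eq_bigr => i _; rewrite add0n !h2_0.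
rewrite nst_idxS_cons IH IHa big_ord_recl mulrDr addrCA big_distrr -big_split.
congr (_ + _).
  by rewrite /= take0 h2_cons /h2 nst0 add0r !mulrA.
by apply: eq_bigr => i _ /=; rewrite add0n h2_cons; ring.
Qed.

(** For each position of the entry 1, [sum_e2_h2] cancels the prefix against the whole list and
    leaves the strict suffix, and conversely on the other side. Hence [a] and [b] change places. *)
Lemma sum_nst_idx s a b :
  \sum_(i < a.+1) \sum_(j < b.+1)
     (-1) ^+ i * (-1) ^+ j * e2 s i * e2 s j * nst s (idx (a - i) (b - j)) =
  (-1) ^+ (a + b) * ns s (idx b a).
Proof.
rewrite ns_idx.
have -> : \sum_(i < a.+1) \sum_(j < b.+1)
     (-1) ^+ i * (-1) ^+ j * e2 s i * e2 s j * nst s (idx (a - i) (b - j)) =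
   \sum_(k < size s) (nth 0 s k)^-1
     * (\sum_(i < a.+1) (-1) ^+ i * e2 s i * h2 (take k.+1 s) (a - i))
     * (\sum_(j < b.+1) (-1) ^+ j * e2 s j * h2 (drop k s) (b - j)).
  under eq_bigr => i _ do under eq_bigr => j _ do rewrite nst_idx big_distrr /=.
  under eq_bigr => i _ do rewrite exchange_big /=.
  rewrite exchange_big /=; apply: eq_bigr => k _.
  rewrite -mulrA big_distrlr big_distrr; apply: eq_bigr => i _ /=.
  by rewrite big_distrr; apply: eq_bigr => j _ /=; ring.
rewrite big_distrr; apply: eq_bigr => k _ /=.
have := sum_e2_h2 (take k.+1 s) (drop k.+1 s) a; rewrite cat_take_drop => ->.
have -> : \sum_(j < b.+1) (-1) ^+ j * e2 s j * h2 (drop k s) (b - j) =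
    (-1) ^+ b * e2 (take k s) b.
  rewrite -(sum_e2_h2 (drop k s)); apply: eq_bigr => j _.
  by rewrite e2_catC cat_take_drop.
rewrite exprD; ring.
Qed.

Definition psum s k : F := \sum_(x <- s) x ^- k.

(** Division of the generating polynomial of [e2 (x :: s)] by its factor at [x], as a geometric
    series. *)
Lemma alt_e2_cons x s n :
  \sum_(i < n.+1) (-1) ^+ i * e2 (x :: s) (n - i) * x ^- i.*2 = e2 s n.
Proof.
elim: n => [|n IH]; first by rewrite big_ord1 !e2_0 expr0 invr1 !mulr1.
rewrite big_ord_recl /= subn0 mul1r e2_cons double0 expr0 invr1 mulr1.
have -> : \sum_(i < n.+1) (-1) ^+ bump 0 i * e2 (x :: s) (n.+1 - bump 0 i)
    * x ^- (bump 0 i).*2 = - x ^- 2 * e2 s n; last by ring.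
rewrite -IH big_distrr; apply: eq_bigr => i _ /=.
by rewrite /bump add1n subSS doubleS -[(i.*2.+2)%N]add2n exprD invfM exprS; ring.
Qed.

Lemma alt_e2_psum_cons x s r n :
  \sum_(i < n.+2) (-1) ^+ i * e2 (x :: s) (n.+1 - i) * psum (x :: s) (r + i.*2) =
  \sum_(i < n.+2) (-1) ^+ i * e2 s (n.+1 - i) * psum s (r + i.*2)
  + x ^- 2 * \sum_(i < n.+1) (-1) ^+ i * e2 s (n - i) * psum s (r + i.*2)
  + x ^- r * e2 s n.+1.
Proof.
rewrite -[in X in _ + X](alt_e2_cons x).
under eq_bigr => i _ do rewrite /psum big_cons mulrDr.
rewrite big_split /= addrC; congr (_ + _); last first.
  rewrite big_distrr; apply: eq_bigr => i _ /=.
  by rewrite exprD invfM; ring.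
rewrite !(@big_ord_recr _ _ _ n.+1) /= !subnn !e2_0 addrAC; congr (_ + _).
rewrite big_distrr -big_split; apply: eq_bigr => i _ /=.
by rewrite subSn -1?ltnS // e2_cons; rewrite /psum; ring.
Qed.

(** Multiplying [e2 s n] by [psum s 1] inserts a 1 among n entries 2, or merges it with one of them,
    which is an insertion of 3 among n - 1 entries. Eliminating the insertions of 3, 5, ... in turn
    gives the alternating sum. *)
Lemma sum_ns_idx s n :
  \sum_(i < n.+1) ns s (idx i (n - i)) =
  \sum_(i < n.+1) (-1) ^+ i * e2 s (n - i) * psum s (1 + i.*2).
Proof.
elim: s n => [|x s IH] n.
  rewrite !big1 // => i _; first by rewrite /psum big_nil mulr0.
  by rewrite ns0; case: (val i).
case: n => [|n].
  have := IH 0%N; rewrite !big_ord1 expr0 !e2_0 ns_idx0_cons e2_0 !mul1r mulr1.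
  by rewrite /psum big_cons => ->; rewrite addrC.
rewrite alt_e2_psum_cons -!IH big_ord_recl ns_idx0_cons [in RHS]big_ord_recl.
have -> : \sum_(i < n.+1) ns (x :: s) (idx (lift ord0 i) (n.+1 - lift ord0 i)) =
    \sum_(i < n.+1) ns s (idx (lift ord0 i) (n.+1 - lift ord0 i))
    + x ^- 2 * \sum_(i < n.+1) ns s (idx i (n - i)).
  rewrite big_distrr -big_split; apply: eq_bigr => i _ /=.
  by rewrite /bump add1n ns_idxS_cons subSS.
by rewrite expr1 /=; ring.
Qed.

(** Newton's identities in the variables [x ^- 2]. *)
Lemma newton s n :
  n%:R * e2 s n = \sum_(i < n) (-1) ^+ i * e2 s (n.-1 - i) * psum s (2 + i.*2).
Proof.
elim: s n => [|x s IH] [|n]; rewrite ?mul0r ?big_ord0 //.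
  by rewrite e2_nil mulr0 big1 // => i _; rewrite /psum big_nil mulr0.
case: n => [|n].
  have := IH 1%N; rewrite !big_ord1 expr0 !e2_0 e2_cons !mul1r e2_0 mulr1 /psum.
  by rewrite big_cons => ->; rewrite addrC.
rewrite alt_e2_psum_cons -(IH n.+1) -(IH n.+2) e2_cons.
by rewrite -[n.+2%:R]natr1; ring.
Qed.

End ElementarySums.

Section NestedSumLists.
Variable F : fieldType.

Lemma big_tuple_cons (T : finType) n (P : pred (n.+1.-tuple T))
    (G : n.+1.-tuple T -> F) :
  \sum_(t | P t) G t =
  \sum_x \sum_(t : n.-tuple T | P (cons_tuple x t)) G (cons_tuple x t).
Proof.
rewrite pair_big_dep /= (reindex (fun q : T * n.-tuple T => cons_tuple q.1 q.2)) //=.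
exists (fun t => (thead t, behead_tuple t)) => [[x t] _|t _] /=.
  by congr (_, _); apply: val_inj.
by apply: val_inj => /=; rewrite [in RHS](tuple_eta t).
Qed.

(** [lo] is the summation index chosen just before, so the constraint on the next one is local and
    induction on the index is possible. *)
Definition path_sum (e : rel nat) (k : mindex) (N lo : nat) : F :=
  \sum_(m : (size k).-tuple 'I_N | path e lo (map val m))
     \prod_(i < size k) (val (tnth m i))%:R ^- nth 0%N k i.

Lemma path_sum_nil e N lo : path_sum e [::] N lo = 1.
Proof.
rewrite /path_sum (bigD1 [tuple]) //= big_ord0 big1 ?addr0 // => m.
by case/andP => _ /eqP[]; apply: tuple0.
Qed.

Lemma path_sum_cons e a k N lo :
  path_sum e (a :: k) N lo =
  \sum_(x < N | e lo x) x%:R ^- a * path_sum e k N x.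
Proof.
rewrite /path_sum [LHS]big_tuple_cons [RHS]big_mkcond; apply: eq_bigr => x _ /=.
case: (e lo x) => /=; last by rewrite big_pred0_eq.
rewrite big_distrr; apply: eq_bigr => t _ /=.
rewrite big_ord_recl /= (tnth_nth x) /=; congr (_ * _).
by apply: eq_bigr => i _; rewrite !(tnth_nth x).
Qed.

Lemma path_sum_ltn k N lo :
  path_sum ltn k N lo = ns [seq i%:R | i <- iota lo.+1 (N - lo.+1)] k.
Proof.
elim: k lo => [|a k IH] lo; first by rewrite path_sum_nil ns_nil.
rewrite path_sum_cons; move E: (N - lo.+1)%N => d.
elim: d lo E => [|d IHd] lo E.
  by rewrite big_pred0 // => x; have /= := ltn_ord x; lia.
have lt : (lo.+1 < N)%N by lia.
rewrite /= ns_cons -IHd; last by lia.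
rewrite (bigD1 (Ordinal lt)) /=; last exact: ltnSn.
rewrite addrC IH; congr (_ + _ * ns _ _); last by congr (map _ (iota _ _)); lia.
apply: eq_bigl => x; rewrite [in RHS]ltn_neqAle andbC eq_sym.
by congr (_ && _).
Qed.

Lemma path_sum_leq k N lo :
  path_sum leq k N lo = nst [seq i%:R | i <- iota lo (N - lo)] k.
Proof.
elim: k lo => [|a k IH] lo; first by rewrite path_sum_nil nst_nil.
rewrite path_sum_cons; move E: (N - lo)%N => d.
elim: d lo E => [|d IHd] lo E.
  by rewrite big_pred0 // => x; have /= := ltn_ord x; lia.
have lt : (lo < N)%N by lia.
rewrite /= nst_cons -IHd; last by lia.
rewrite (bigD1 (Ordinal lt)) /=; last exact: leqnn.
rewrite addrC IH E /=; congr (_ + _).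
apply: eq_bigl => x; rewrite [in RHS]ltn_neqAle andbC eq_sym.
by congr (_ && _).
Qed.

Definition nats (n : nat) : seq F := [seq i%:R | i <- iota 1 n].

(** Positivity of the entries is encoded by a fictitious previous index: 0 for the strict relation
    here, 1 for the weak one in [nested_sum_leq]. *)
Lemma nested_sum_ltn k N : nested_sum F ltn k N = ns (nats N.-1) k.
Proof.
rewrite -subn1 -path_sum_ltn; apply: eq_bigl => m.
case: (map val m) => //= x s.
apply/andP/andP => [[/andP[] //]|[x0 h]]; rewrite x0 h; split=> //=.
elim: s x x0 h => //= y s IH x x0 /andP[xy /IH ->] //; last exact: leq_ltn_trans xy.
by rewrite (leq_ltn_trans _ xy).
Qed.

Lemma nested_sum_leq k N : nested_sum F leq k N = nst (nats N.-1) k.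
Proof.
rewrite -subn1 -path_sum_leq; apply: eq_bigl => m.
case: (map val m) => //= x s.
apply/andP/andP => [[/andP[] //]|[x0 h]]; rewrite x0 h; split=> //=.
elim: s x x0 h => //= y s IH x x0 /andP[xy /IH ->] //; last exact: leq_trans xy.
by rewrite (leq_trans _ xy).
Qed.

Lemma nats_rcons n : nats n.+1 = rcons (nats n) n.+1%:R.
Proof. by rewrite /nats -map_rcons -cats1 -[[:: n.+1]]/(iota (1 + n) 1) -iotaD addn1. Qed.

Lemma size_nats n : size (nats n) = n.
Proof. by rewrite size_map size_iota. Qed.

Lemma e2_natsS n i : e2 (nats n.+1) i.+1 = e2 (nats n) i.+1 + n.+1%:R ^- 2 * e2 (nats n) i.
Proof. by rewrite nats_rcons e2_rcons. Qed.

Lemma ns_nats_idx0 n a :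
  ns (nats n.+1) (idx a 0) = ns (nats n) (idx a 0) + n.+1%:R^-1 * e2 (nats n) a.
Proof. by rewrite nats_rcons /idx /= cats1 ns_rcons. Qed.

Lemma ns_nats_idxS n a b :
  ns (nats n.+1) (idx a b.+1) =
  ns (nats n) (idx a b.+1) + n.+1%:R ^- 2 * ns (nats n) (idx a b).
Proof.
have -> : idx a b.+1 = rcons (idx a b) 2%N.
  by rewrite /idx -[b.+1]addn1 nseqD -cat_cons catA cats1.
by rewrite nats_rcons ns_rcons.
Qed.

Lemma psum_natsS n k : psum (nats n.+1) k = psum (nats n) k + n.+1%:R ^- k.
Proof. by rewrite nats_rcons /psum -cats1 big_cat big_seq1. Qed.

End NestedSumLists.

(** * The summation identity *)

Lemma ns_oversize (F : fieldType) (s : seq F) k : (size s < size k)%N -> ns s k = 0.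
Proof.
elim: s k => [|x s IH] [|a k] //= lt.
by rewrite ns_cons !IH ?mulr0 ?addr0 // ltnW.
Qed.

Section Telescoping.
Variable K : fieldType.
Implicit Types (n N J a b : nat) (y z : K).

Local Notation e := (fun n i => e2 (nats K n) i).

(* Truncation of sin(pi z) / (pi z). *)
Definition sprod n z : K := \prod_(k < n) (1 - z ^+ 2 / k.+1%:R ^+ 2).

(** [z ^- a.*2.+2] times the expansion of [sprod n z] cut after degree 2a. *)
Definition tailsum a n z : K :=
  \sum_(i < a.+1) (-1) ^+ i * e n i * z ^- (a - i).*2.+2.

(* The sum of its values at [z] and [z + 1] is [2 / sprod n z], so alternating
   sums of [1 / sprod n (y + j)] over [j] telescope. *)
Definition rprod n z : K :=
  \prod_(k < n) (k.+1%:R ^+ 2 / ((k.+1%:R - z) * (k%:R + z))).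

Lemma sprodS n z : sprod n.+1 z = sprod n z * (1 - z ^+ 2 / n.+1%:R ^+ 2).
Proof. exact: big_ord_recr. Qed.

Lemma sprodN n z : sprod n (- z) = sprod n z.
Proof. by apply: eq_bigr => k _; rewrite sqrrN. Qed.

Lemma sprodE n z B : (n < B)%N ->
  sprod n z = \sum_(i < B) (-1) ^+ i * e n i * z ^+ i.*2.
Proof.
case: B => // B; rewrite ltnS; elim: n B => [|n IH] B lt.
  rewrite /sprod big_ord0 big_ord_recl big1 => [|i _]; first by rewrite e2_nil !mulr1 addr0.
  by rewrite e2_nil mulr0 mul0r.
case: B lt => // B lt; rewrite sprodS mulrBr mulr1 {1}(IH B.+1); last by lia.
rewrite (IH B) // [in RHS]big_ord_recl [X in X - _ = _]big_ord_recl -addrA /= !e2_0.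
congr (_ + _); rewrite big_distrl -sumrB; apply: eq_bigr => i _ /=.
by rewrite /bump add1n e2_natsS exprS doubleS -[(i.*2.+2)%N]addn2 exprD; ring.
Qed.

Lemma sprod_neq0 n z :
  (forall k, (0 < k <= n)%N -> k%:R != 0 :> K) ->
  (forall k, (0 < k <= n)%N -> (k%:R - z) * (k%:R + z) != 0) -> sprod n z != 0.
Proof.
move=> k0 kz; apply/prodf_neq0 => k _.
have := kz k.+1 (ltn_ord k); apply: contra => /eqP E; apply/eqP.
have -> : (k.+1%:R - z) * (k.+1%:R + z) = k.+1%:R ^+ 2 * (1 - z ^+ 2 / k.+1%:R ^+ 2).
  by field; rewrite nat1r; apply: k0; rewrite ltn_ord.
by rewrite E mulr0.
Qed.

(** Multiplying the cut expansion by the next factor of [sprod] overshoots by one term of degree 2a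
    + 2; the last summand takes it back. *)
Lemma tailsumS a n z : z != 0 ->
  tailsum a n.+1 z =
  (1 - z ^+ 2 / n.+1%:R ^+ 2) * tailsum a n z + (-1) ^+ a * e n a / n.+1%:R ^+ 2.
Proof.
move=> z0; case: a => [|a].
  rewrite /tailsum !big_ord1 !e2_0 double0 -[n.+1%:R ^- 2]exprVn.
  by move: (n.+1%:R^-1) => w; field.
have Ez : z ^+ 2 * tailsum a.+1 n z = tailsum a n z + (-1) ^+ a.+1 * e n a.+1.
  rewrite /tailsum big_ord_recr mulrDr big_distrr /= subnn double0; congr (_ + _).
    apply: eq_bigr => i _; rewrite subSn -1?ltnS // doubleS.
    by rewrite -[((a - i).*2.+4)%N]add2n exprD invfM; field; rewrite expf_neq0.
  by field.
have -> : tailsum a.+1 n.+1 z = tailsum a.+1 n z - tailsum a n z / n.+1%:R ^+ 2.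
  rewrite /tailsum big_ord_recl [X in _ = X - _]big_ord_recl !e2_0 -addrA; congr (_ + _).
  rewrite big_distrl -sumrB; apply: eq_bigr => i _ /=.
  by rewrite /bump add1n subSS e2_natsS exprS; ring.
have -> : tailsum a n z = z ^+ 2 * tailsum a.+1 n z - (-1) ^+ a.+1 * e n a.+1.
  by rewrite Ez; ring.
by ring.
Qed.

(* Wilf-Zeilberger: the summand is the difference in [n] of
   [tailsum a n z / sprod n z], by [tailsumS]. *)
Lemma sum_wz a N z :
  (forall k, (0 < k <= N)%N -> k%:R != 0 :> K) ->
  (forall k, (k <= N)%N -> (k%:R - z) * (k%:R + z) != 0) ->
  \sum_(n < N) (-1) ^+ a * e n a / (n.+1%:R ^+ 2 * sprod n.+1 z) =
  tailsum a N z / sprod N z - z ^- a.*2.+2.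
Proof.
move=> k0 kz.
have z0 : z != 0 by have := kz 0%N erefl; rewrite mulr0n mulf_eq0 negb_or !add0r => /andP[].
elim: N k0 kz => [|N IH] k0 kz.
  rewrite big_ord0 /sprod big_ord0 /tailsum big_ord_recl big1 => [|i _].
    by rewrite e2_0 subn0 !mul1r addr0 invr1 mulr1 subrr.
  by rewrite e2_nil mulr0 mul0r.
have S0 : sprod N.+1 z != 0.
  by apply: sprod_neq0 => // k /andP[_]; apply: kz.
have N0 : N.+1%:R != 0 :> K by apply: k0; rewrite leqnn.
rewrite big_ord_recr /= IH; first last.
- by move=> k kN; apply: kz; apply: leq_trans kN _.
- by move=> k /andP[k1 kN]; apply: k0; rewrite k1 (leq_trans kN).
rewrite tailsumS // sprodS; move: N0 S0; rewrite sprodS mulf_eq0 negb_or.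
move: (N.+1%:R : K) => c c0 /andP[S0].
have -> : 1 - z ^+ 2 / c ^+ 2 = (c ^+ 2 - z ^+ 2) / c ^+ 2 by field.
rewrite mulf_eq0 negb_or => /andP[S1 _].
by field; rewrite S0 S1 c0 expf_neq0.
Qed.

Lemma rprod_sprod n z :
  (forall k, (0 < k <= n)%N -> k%:R != 0 :> K) ->
  (forall k, (k <= n)%N -> (k%:R - z) * (k%:R + z) != 0) ->
  rprod n z = (z + n%:R) / (z * sprod n z) /\
  rprod n (z + 1) = (z - n%:R) / (z * sprod n z).
Proof.
move=> k0 kz.
have z0 : z != 0 by have := kz 0%N erefl; rewrite mulr0n mulf_eq0 negb_or !add0r => /andP[].
elim: n k0 kz => [|n IH] k0 kz.
  by rewrite /rprod /sprod !big_ord0 addr0 subr0 mulr1 divff.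
have [||E1 E2] := IH.
- by move=> k /andP[k1 kN]; apply: k0; rewrite k1 (leq_trans kN).
- by move=> k kN; apply: kz; apply: leq_trans kN _.
have N0 : n.+1%:R != 0 :> K by apply: k0; rewrite leqnn.
have S0 : sprod n z != 0.
  apply: sprod_neq0 => k /andP[k1 kn]; first by apply: k0; rewrite k1 ltnW.
  by apply: kz; apply: ltnW.
have := kz n.+1 (leqnn _); rewrite mulf_eq0 negb_or => /andP[m1 m2].
have := kz n (leqnSn _); rewrite mulf_eq0 negb_or => /andP[m3 m4].
rewrite /rprod !big_ord_recr /= -/(rprod n z) -/(rprod n (z + 1)) E1 E2 sprodS.
move: m3 m4; have -> : n%:R = n.+1%:R - 1 :> K by rewrite -natr1 addrK.
move: (n.+1%:R : K) N0 m1 m2 => c c0 m1 m2 m3 m4.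
have -> : 1 - z ^+ 2 / c ^+ 2 = (c - z) * (c + z) / c ^+ 2 by field.
have -> : c - (z + 1) = c - 1 - z by ring.
have -> : c - 1 + (z + 1) = c + z by ring.
by split; field; rewrite z0 S0 c0 m1 m2 ?m3 ?m4.
Qed.

Lemma rprod1B n z : rprod n (1 - z) = rprod n z.
Proof.
apply: eq_bigr => k _; congr (_ / _); rewrite -natr1; ring.
Qed.

Lemma sum_alt_sprodV n J y : 2%:R != 0 :> K ->
  (forall k, (0 < k <= n)%N -> k%:R != 0 :> K) ->
  (forall k j, (k <= n)%N -> (0 < j <= J)%N ->
     (k%:R - (y + j%:R)) * (k%:R + (y + j%:R)) != 0) ->
  \sum_(j < J) (-1) ^+ j.+1 / sprod n (y + j.+1%:R) =
  (- rprod n (y + 1) + (-1) ^+ J * rprod n (y + J.+1%:R)) / 2%:R.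
Proof.
move=> two0 k0 kz; elim: J kz => [|J IH] kz.
  by rewrite big_ord0 expr0; field.
rewrite big_ord_recr /= IH => [|k j kn /andP[j0 jJ]]; last by apply: kz => //; lia.
have [k kn||E1 E2] := @rprod_sprod n (y + J.+1%:R); [exact: k0|by move=> *; apply: kz; lia|].
have -> : y + J.+2%:R = y + J.+1%:R + 1 by rewrite -natr1 addrA.
rewrite E1 E2 exprS.
have := kz 0%N J.+1 erefl; rewrite leqnn mulr0n !add0r mulf_eq0 negb_or => /(_ isT)/andP[_ z0].
have S0 : sprod n (y + J.+1%:R) != 0.
  by apply: sprod_neq0 => // k /andP[_ kn]; apply: kz => //; lia.
by move: (y + J.+1%:R) z0 S0 => z z0 S0; field; rewrite two0 z0 S0.
Qed.

(** Telescoping uses the sum of the two values in [rprod_sprod]; their difference lets the ends of a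
    telescoped sum reproduce [1 / sprod n y] itself. *)
Lemma rprod_diff n y : 
  (forall k, (0 < k <= n)%N -> k%:R != 0 :> K) ->
  (forall k, (k <= n)%N -> (k%:R - y) * (k%:R + y) != 0) ->
  y * (rprod n y - rprod n (y + 1)) = n%:R *+ 2 / sprod n y.
Proof.
move=> k0 kz; have [||-> ->] := @rprod_sprod n y => //.
have := kz 0%N erefl; rewrite mulr0n !add0r mulf_eq0 negb_or => /andP[_ y0].
have S0 : sprod n y != 0 by apply: sprod_neq0 => // k /andP[_ kn]; apply: kz.
by field; rewrite S0 y0.
Qed.

(** The number [B] of coefficients is separate from [N]: coefficients with b >= N vanish, so one [B]
    can serve throughout a recursion on [N]. *)
Definition idx_poly a N y B : K :=
  \sum_(b < B) (-1) ^+ (a + b) * ns (nats K N) (idx a b) * y ^+ b.*2.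

Lemma idx_polyS a N y B : (N < B)%N ->
  idx_poly a N.+1 y B =
  (1 - y ^+ 2 / N.+1%:R ^+ 2) * idx_poly a N y B + (-1) ^+ a * e N a / N.+1%:R.
Proof.
case: B => // B NB; rewrite /idx_poly mulrBl mul1r.
rewrite [X in _ = _ - _ * X + _]big_ord_recr /=.
rewrite (@ns_oversize _ _ (idx a B)); last first.
  by rewrite size_nats size_cat /= !size_nseq; lia.
rewrite mulr0 mul0r addr0 !big_ord_recl /= ns_nats_idx0 big_distrr /=.
have -> : \sum_(i < B) (-1) ^+ (a + bump 0 i) * ns (nats K N.+1) (idx a (bump 0 i))
     * y ^+ (bump 0 i).*2 =
  \sum_(i < B) (-1) ^+ (a + bump 0 i) * ns (nats K N) (idx a (bump 0 i)) * y ^+ (bump 0 i).*2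
  - \sum_(i < B) y ^+ 2 / N.+1%:R ^+ 2 * ((-1) ^+ (a + i) * ns (nats K N) (idx a i) * y ^+ i.*2).
  rewrite -sumrB; apply: eq_bigr => i _.
  rewrite /bump add1n ns_nats_idxS (addnS a) (exprS (-1)) doubleS -[(i.*2.+2)%N]addn2 !exprD.
  by ring.
by rewrite addn0 double0; ring.
Qed.

(** Variation of constants: [idx_polyS] is a linear recurrence in [N] whose homogeneous solution is
    [sprod N y]. *)
Lemma idx_polyE a N y B : (N <= B)%N ->
  (forall k, (0 < k <= N)%N -> k%:R != 0 :> K) ->
  (forall k, (0 < k <= N)%N -> (k%:R - y) * (k%:R + y) != 0) ->
  idx_poly a N y B =
  sprod N y * \sum_(n < N) (-1) ^+ a * e n a / (n.+1%:R * sprod n.+1 y).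
Proof.
elim: N => [|N IH] NB k0 kz.
  rewrite big_ord0 mulr0 /idx_poly big1 // => b _.
  by rewrite ns_oversize ?mulr0 ?mul0r // size_cat addnS.
rewrite idx_polyS // IH ?(ltnW NB) //; first last.
- by move=> k /andP[k1 kN]; apply: kz; rewrite k1 (leq_trans kN).
- by move=> k /andP[k1 kN]; apply: k0; rewrite k1 (leq_trans kN).
rewrite [in RHS]big_ord_recr /= mulrDr; congr (_ + _).
  by rewrite sprodS; ring.
have S0 := sprod_neq0 k0 kz.
move: (N.+1%:R : K) (k0 N.+1) => c c0.
by field; rewrite S0 c0 // leqnn.
Qed.

End Telescoping.

(** * Values modulo a prime *)

Lemma ns_map (F K : fieldType) (f : {rmorphism F -> K}) (s : seq F) k :
  ns (map f s) k = f (ns s k).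
Proof.
elim: s k => [|x s IH] [|a k]; rewrite ?ns_nil ?rmorph1 //=.
  by rewrite !ns0 rmorph_nat.
by rewrite !ns_cons !IH rmorphD rmorphM fmorphV rmorphXn.
Qed.

Lemma nats_map (F K : fieldType) (f : {rmorphism F -> K}) n :
  nats K n = map f (nats F n).
Proof. by rewrite /nats -map_comp; apply: eq_map => i /=; rewrite rmorph_nat. Qed.

Section ModP.
Variables (p h : nat) (F : finFieldType).
Hypotheses (p_pr : prime p) (ph : p = h.*2.+1) (pcharF : p \in [pchar F]).
Hypothesis natF : forall x : F, exists2 v, (v < p)%N & x = v%:R.
Hypothesis cardF : #|F| = p.

Lemma natr_modp_neq0 (K : fieldType) (phi : {rmorphism F -> K}) k :
  (0 < k < p)%N -> k%:R != 0 :> K.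
Proof.
move=> /andP[k0 kp]; rewrite -(dvdn_pcharf (rmorph_pchar phi pcharF)).
by rewrite gtnNdvd.
Qed.

Let hprod : {poly F} := \prod_(k < h) (1 - (k.+1%:R ^- 2)%:P * 'X^2).

(** Both sides have size at most p and agree at all p elements of F: a nonzero x is, up to sign,
    some k <= h, and [x ^+ p.-1] is 1. *)
Lemma hprodE : hprod = 1 - 'X^(p.-1).
Proof.
apply/eqP; rewrite -subr_eq0; apply/negPn/negP => D0.
have szX : (size (1 - 'X^(p.-1) : {poly F})%R <= p)%N.
  rewrite (leq_trans (size_polyD _ _)) // geq_max size_poly1 size_polyN size_polyXn.
  by have := prime_gt0 p_pr; lia.
have szh : (size hprod <= p)%N.
  rewrite /hprod [X in (_ <= X)%N]ph.
  elim: (h) => [|n IH]; first by rewrite big_ord0 size_poly1.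
  rewrite big_ord_recr (leq_trans (size_polyMleq _ _)) //.
  have : (size (1 - (n.+1%:R ^- 2)%:P * 'X^2 : {poly F})%R <= 3)%N.
    rewrite (leq_trans (size_polyD _ _)) // geq_max size_poly1 size_polyN mul_polyC.
    by rewrite (leq_trans (size_scale_leq _ _)) // size_polyXn.
  move: IH => /=; set u := size _; set v := size _.
  by rewrite doubleS; lia.
suff /(max_poly_roots D0)/(_ (enum_uniq _)) : all (root (hprod - (1 - 'X^(p.-1)))) (enum F).
  rewrite -cardE cardF ltnNge (leq_trans (size_polyD _ _)) //.
  by rewrite geq_max szh size_polyN szX.
apply/allP => x _; rewrite /root !(hornerD, hornerN) hornerXn hornerC subr_eq0.
have [->|x0] := eqVneq x 0.
  have -> : (0 : F) ^+ p.-1 = 0 by rewrite -(prednK (_ : 0 < p.-1)%N) ?expr0 ?exprS ?mul0r //; have := prime_gt1 p_pr; lia.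
  rewrite subr0 /hprod horner_prod big1 // => k _.
  by rewrite hornerD hornerN hornerM hornerXn !hornerC expr0n mulr0 subr0.
have -> : x ^+ p.-1 = 1.
  apply: (mulfI x0); rewrite -exprS prednK ?prime_gt0 // mulr1.
  have [v _ ->] := natF x.
  by rewrite -(pFrobenius_autE pcharF) pFrobenius_aut_nat.
rewrite subrr.
have [k kh xk] : exists2 k : 'I_h, true & x ^+ 2 = k.+1%:R ^+ 2.
  have [v vp xE] : exists2 v, (0 < v < p)%N & x = v%:R.
    have [v vp xE] := natF x; exists v; rewrite // vp lt0n andbT.
    by apply: contra x0 => /eqP v0; rewrite xE v0.
  have [le|gt] := leqP v h.
    have lt : (v.-1 < h)%N by lia.
    by exists (Ordinal lt) => //=; rewrite prednK -?xE //; case/andP: vp.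
  have lt : ((p - v).-1 < h)%N by lia.
  exists (Ordinal lt) => //=; rewrite prednK; last by lia.
  by rewrite natrB ?(pcharf0 pcharF) ?sub0r ?sqrrN -?xE //; lia.
rewrite /hprod horner_prod (bigD1 k) //=
  hornerD hornerN hornerM hornerXn !hornerC xk mulVf ?subrr ?mul0r //.
by rewrite expf_neq0 // (natr_modp_neq0 idfun) //; have := ltn_ord k; lia.
Qed.

Lemma sprod_modp (K : fieldType) (phi : {rmorphism F -> K}) (z : K) :
  sprod h z = 1 - z ^+ p.-1.
Proof.
have := congr1 (fun q => (map_poly phi q).[z]) hprodE.
rewrite /hprod rmorph_prod horner_prod rmorphB rmorph1 /= map_polyXn.
rewrite [X in _ = X]hornerD hornerN hornerXn hornerC => <-.
apply: eq_bigr => k _.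
rewrite rmorphB rmorph1 rmorphM /= map_polyXn map_polyC.
rewrite hornerD hornerN hornerM hornerXn !hornerC /=.
by rewrite fmorphV rmorphXn rmorph_nat mulrC.
Qed.

Local Notation Ft := {fraction {poly F}}.
Let iota_t : {rmorphism F -> Ft} := @tofrac {poly F} \o polyC.
(** The summation identity divides by values of [sprod] at y + j, which can vanish for y in F. It is
    therefore used at the generic point [t] and read back as an equality of polynomials. *)
Let t : Ft := tofrac 'X.

Let iotaE c : iota_t c = tofrac c%:P.
Proof. by []. Qed.

Lemma tofrac_sum_poly (c : nat -> F) n :
  \sum_(i < n) iota_t (c i) * t ^+ i.*2 =
  tofrac (\sum_(i < n) (c i)%:P * 'X^(i.*2)).
Proof.
by rewrite rmorph_sum; apply: eq_bigr => i _; rewrite rmorphM rmorphXn.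
Qed.

Lemma coef_sum_polyXd (c : nat -> F) n i : (i < n)%N ->
  (\sum_(i < n) (c i)%:P * 'X^(i.*2))`_(i.*2) = c i.
Proof.
move=> ni; rewrite coef_sum (bigD1 (Ordinal ni)) //=.
rewrite mul_polyC coefZ coefXn eqxx mulr1 big1 ?addr0 // => j ji.
rewrite mul_polyC coefZ coefXn; case: eqP => [/double_inj E|]; last by rewrite mulr0.
by case/eqP: ji; apply: val_inj.
Qed.

Lemma e2_half i : (0 < i < h)%N -> e2 (nats F h) i = 0.
Proof.
move=> /andP[i0 ih]; have := @sprodE Ft h t h.+1 (leqnn _); rewrite (sprod_modp iota_t).
under eq_bigr => j _ do
  rewrite (nats_map iota_t) /e2 ns_map -[(-1) ^+ j](rmorph_sign iota_t) -rmorphM.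
rewrite (@tofrac_sum_poly (fun j => (-1) ^+ j * ns (nats F h) (nseq j 2%N))).
rewrite -[t ^+ _]rmorphXn -[1](rmorph1 (@tofrac {poly F})) -rmorphB => /eqP.
rewrite tofrac_eq => /eqP/(congr1 (fun q : {poly F} => q`_(i.*2))).
rewrite (coef_sum_polyXd (fun j => (-1) ^+ j * ns (nats F h) (nseq j 2%N))); last by lia.
rewrite coefB coef1 coefXn.
have -> : (i.*2 == 0)%N = false by lia.
have -> : (i.*2 == p.-1)%N = false by lia.
by rewrite subr0 => /eqP; rewrite eq_sym mulf_eq0 signr_eq0 => /eqP.
Qed.

Let t_neq0 c : t + iota_t c != 0.
Proof.
rewrite iotaE -rmorphD tofrac_eq0; apply/eqP => /(congr1 (fun q : {poly F} => q`_1)).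
by rewrite coefD coefX coefC coef0 addr0 => /eqP; rewrite oner_eq0.
Qed.

Let avoid_t k j : (k%:R - (t + j%:R)) * (k%:R + (t + j%:R)) != 0.
Proof.
have -> : k%:R + (t + j%:R) = t + iota_t (k%:R + j%:R).
  by rewrite rmorphD !rmorph_nat; ring.
have -> : k%:R - (t + j%:R) = - (t + iota_t (j%:R - k%:R)).
  by rewrite rmorphB !rmorph_nat; ring.
by rewrite mulf_neq0 ?oppr_eq0.
Qed.

Section Extension.
Variables (K : fieldType) (phi : {rmorphism F -> K}) (X : K).
Hypothesis avoid : forall k j, (k%:R - (X + j%:R)) * (k%:R + (X + j%:R)) != 0.

Let avoid0 k : (k%:R - X) * (k%:R + X) != 0.
Proof. by have := avoid k 0; rewrite mulr0n addr0. Qed.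

Let pK0 : p%:R = 0 :> K.
Proof. exact: pcharf0 (rmorph_pchar phi pcharF). Qed.

Let natK k : (0 < k <= h)%N -> k%:R != 0 :> K.
Proof. by move=> k0; apply: (natr_modp_neq0 phi); lia. Qed.

Lemma frobenius_X j : (X + j%:R) ^+ p = X ^+ p + j%:R.
Proof.
have pK := rmorph_pchar phi pcharF.
rewrite exprDn_pchar; last by rewrite pnatE.
by congr (_ + _); rewrite -(pFrobenius_autE pK) pFrobenius_aut_nat.
Qed.

Lemma tailsum_half a (z : K) : (a < h)%N -> tailsum a h z = z ^- a.*2.+2.
Proof.
move=> ah; rewrite /tailsum big_ord_recl big1 => [|i _].
  by rewrite e2_0 subn0 !mul1r addr0.
rewrite (nats_map phi) /e2 ns_map -/(e2 _ _) e2_half ?rmorph0 ?mulr0 ?mul0r //.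
by rewrite lift0 /=; have := ltn_ord i; lia.
Qed.

(** With p - 1 shifts the far end of the telescoping lies at X + p = X, so [rprod_diff] applies to
    the two ends. *)
Lemma sum_alt_sprodV_modp n : (n <= h)%N ->
  X * \sum_(j < p.-1) (-1) ^+ j.+1 / sprod n (X + j.+1%:R) = n%:R / sprod n X.
Proof.
move=> nh; have two0 : 2%:R != 0 :> K.
  by apply: (natr_modp_neq0 phi); have := prime_gt1 p_pr; lia.
have kn k : (0 < k <= n)%N -> k%:R != 0 :> K by move=> ?; apply: natK; lia.
rewrite (sum_alt_sprodV two0 kn (fun k j _ _ => avoid k j)).
rewrite (prednK (prime_gt0 p_pr)) pK0 addr0.
have -> : (-1) ^+ p.-1 = 1 :> K.
  by rewrite -signr_odd ph /= odd_double.
rewrite mul1r; apply: (mulIf two0); rewrite mulrA divfK // addrC.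
by rewrite (rprod_diff kn (fun k _ => avoid0 k)) mulrAC mulr_natr.
Qed.

Lemma idx_poly_modp a : (a < h)%N ->
  idx_poly a h X h = \sum_(j < p.-1) (-1) ^+ j.+1 * (X + j.+1%:R) ^+ (p - a.*2.+2).
Proof.
move=> ah.
rewrite (idx_polyE a (leqnn h) natK (fun k _ => avoid0 k)).
have S0 : sprod h X != 0 := sprod_neq0 natK (fun k _ => avoid0 k).
have -> : \sum_(n < h) (-1) ^+ a * e2 (nats K n) a / (n.+1%:R * sprod n.+1 X) =
  X * \sum_(j < p.-1) (-1) ^+ j.+1 *
     \sum_(n < h) (-1) ^+ a * e2 (nats K n) a
        / (n.+1%:R ^+ 2 * sprod n.+1 (X + j.+1%:R)).
  under [in RHS]eq_bigr => j _ do rewrite big_distrr.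
  rewrite exchange_big big_distrr; apply: eq_bigr => n _ /=.
  have n0 : n.+1%:R != 0 :> K by apply: natK; rewrite ltn_ord.
  have Sn : sprod n.+1 X != 0.
    apply: (sprod_neq0 _ (fun k _ => avoid0 k)) => k kn.
    by apply: natK; have := ltn_ord n; lia.
  transitivity ((-1) ^+ a * e2 (nats K n) a / n.+1%:R ^+ 2 * (n.+1%:R / sprod n.+1 X)).
    by move: (n.+1%:R : K) n0 => c c0; field; rewrite Sn c0.
  rewrite -(sum_alt_sprodV_modp (ltn_ord n)) mulrCA; congr (_ * _).
  by rewrite big_distrr; apply: eq_bigr => j _ /=; rewrite (invfM (n.+1%:R ^+ 2)); ring.
rewrite mulrA big_distrr; apply: eq_bigr => j _ /=.
set z := X + j.+1%:R; rewrite mulrCA; congr (_ * _).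
have Sz : sprod h z != 0 := sprod_neq0 natK (fun k _ => avoid k j.+1).
have z0 : z != 0 by have := avoid 0 j.+1; rewrite mulf_eq0 negb_or !add0r => /andP[].
rewrite (sum_wz a natK (fun k _ => avoid k j.+1)) -/z.
(* X - X^p is invariant under translation by j and equals z * sprod h z at each shift z. The
   prefactor of each term is thus exactly z, and the subtraction leaves z - (z - z^p) = z^p. *)
have Exp : sprod h X * X = X - X ^+ p.
  by rewrite (sprod_modp phi) mulrBl mul1r -exprSr prednK ?prime_gt0.
have Ezp : sprod h z * z = X - X ^+ p.
  rewrite (sprod_modp phi) mulrBl mul1r -exprSr prednK ?prime_gt0 //.
  by rewrite /z frobenius_X; ring.
rewrite Exp tailsum_half // mulrBr -{1}Ezp.
have -> : sprod h z * z * (z ^- a.*2.+2 / sprod h z) = z * z ^- a.*2.+2.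
  by field; rewrite Sz expf_neq0.
rewrite -mulrBl.
have -> : z - (X - X ^+ p) = z ^+ p by rewrite [in RHS]/z frobenius_X /z; ring.
by rewrite -expfB // ph; lia.
Qed.

End Extension.

Lemma idx_poly_half a : (a < h)%N ->
  \sum_(b < h) ((-1) ^+ (a + b) * ns (nats F h) (idx a b))%:P * 'X^(b.*2) =
  \sum_(j < p.-1) (-1) ^+ j.+1 * ('X + j.+1%:R) ^+ (p - a.*2.+2) :> {poly F}.
Proof.
move=> ah; apply/eqP; rewrite -tofrac_eq; apply/eqP.
rewrite -(@tofrac_sum_poly (fun b => (-1) ^+ (a + b) * ns (nats F h) (idx a b))).
have -> : \sum_(b < h) iota_t ((-1) ^+ (a + b) * ns (nats F h) (idx a b)) * t ^+ b.*2 =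
    idx_poly a h t h.
  apply: eq_bigr => b _; congr (_ * _).
  by rewrite (nats_map iota_t) ns_map rmorphM rmorph_sign.
rewrite (idx_poly_modp iota_t avoid_t ah) rmorph_sum; apply: eq_bigr => j _.
by rewrite rmorphM rmorph_sign rmorphXn rmorphD rmorph_nat.
Qed.

Lemma ns_idx_half a b : (a + b < h)%N ->
  ns (nats F h) (idx a b) =
  (-1) ^+ (a + b) * 'C(p - a.*2.+2, b.*2)%:R *
  \sum_(j < p.-1) (-1) ^+ j.+1 * j.+1%:R ^+ (p - (a + b).*2.+2).
Proof.
move=> abh; have ah : (a < h)%N by lia.
have bh : (b < h)%N by lia.
have := congr1 (fun q : {poly F} => q`_(b.*2)) (idx_poly_half ah).
rewrite (coef_sum_polyXd (fun b => (-1) ^+ (a + b) * ns (nats F h) (idx a b))) //.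
rewrite -[X in _ -> _ = X]mulrA => /(congr1 (fun u => (-1) ^+ (a + b) * u)).
rewrite signrMK => ->; congr (_ * _); rewrite coef_sum big_distrr.
apply: eq_bigr => j _ /=.
rewrite -[(-1) ^+ j.+1](rmorph_sign polyC) -[j.+1%:R](rmorph_nat polyC) coefCM mulrCA.
congr (_ * _); rewrite addrC exprDn coef_sum.
have bM : (b.*2 < (p - a.*2.+2).+1)%N by rewrite ph; lia.
rewrite (bigD1 (Ordinal bM)) //= big1 => [|i ib].
  rewrite addr0 coefMn -rmorphXn coefCM coefXn eqxx mulr1 mulr_natl.
  by congr (_ ^+ _ *+ _); rewrite ph; lia.
rewrite coefMn -rmorphXn coefCM coefXn; case: eqP => [E|_]; last by rewrite mulr0 mul0rn.
by case/eqP: ib; apply: val_inj.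
Qed.

End ModP.

(** * Reduction of rational numbers in a field *)

Section RatReduction.
Variable F : fieldType.
Implicit Types (q r : rat).

(** In positive characteristic [ratr] is no ring morphism; it respects sums and products of
    rationals whose denominators are invertible in F. *)
Definition integral_in q : bool := (denq q)%:~R != 0 :> F.

Lemma ratr_frac (n d : int) : d%:~R != 0 :> F ->
  integral_in (n%:Q / d%:Q) /\ ratr (n%:Q / d%:Q) = n%:~R / d%:~R :> F.
Proof.
move=> d0; set q := _ / _.
have dQ : d%:Q != 0.
  by apply: contra d0; rewrite intr_eq0 => /eqP ->.
have E : numq q * d = n * denq q.
  apply: (@intr_inj rat); rewrite !rmorphM /= numqE /q.
  by rewrite mulrAC divfK.
have [c dE] : exists c, d = c * denq q.
  apply/dvdzP; rewrite -(Gauss_dvdzr _ (_ : coprimez _ (numq q))).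
    by rewrite E dvdz_mull.
  by rewrite coprimezE coprime_sym coprime_num_den.
have D0 : integral_in q.
  by apply: contra d0 => /eqP z; rewrite dE rmorphM /= z mulr0.
split=> //; rewrite /ratr; apply: (mulIf d0); rewrite divfK //.
by apply: (mulIf D0); rewrite mulrAC divfK // -!rmorphM E.
Qed.

Lemma integral_inD q r : integral_in q -> integral_in r ->
  integral_in (q + r) /\ ratr (q + r) = ratr q + ratr r :> F.
Proof.
move=> q0 r0; have -> : q + r =
    (numq q * denq r + numq r * denq q)%:Q / (denq q * denq r)%:Q.
  rewrite -[in LHS](divq_num_den q) -[in LHS](divq_num_den r).
  have dq : (denq q)%:Q != 0 by rewrite intr_eq0 denq_neq0.
  have dr : (denq r)%:Q != 0 by rewrite intr_eq0 denq_neq0.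
  by rewrite rmorphD !rmorphM /=; field; rewrite dq dr.
have [|? ->] := @ratr_frac (numq q * denq r + numq r * denq q) (denq q * denq r).
  by rewrite rmorphM mulf_neq0.
split=> //; rewrite /ratr rmorphD !rmorphM /=; field.
by apply/andP.
Qed.

Lemma integral_inM q r : integral_in q -> integral_in r ->
  integral_in (q * r) /\ ratr (q * r) = ratr q * ratr r :> F.
Proof.
move=> q0 r0; have -> : q * r = (numq q * numq r)%:Q / (denq q * denq r)%:Q.
  rewrite -[in LHS](divq_num_den q) -[in LHS](divq_num_den r).
  by rewrite !rmorphM invfM /= mulrACA.
have [|? ->] := @ratr_frac (numq q * numq r) (denq q * denq r).
  by rewrite rmorphM mulf_neq0.
by split=> //; rewrite /ratr !rmorphM invfM /= mulrACA.
Qed.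

Lemma integral_in_nat n : integral_in n%:R /\ ratr n%:R = n%:R :> F.
Proof.
have [|] := @ratr_frac n 1; first by rewrite oner_neq0.
by rewrite !divr1.
Qed.

Lemma integral_in_natV n : n%:R != 0 :> F ->
  integral_in n%:R^-1 /\ ratr n%:R^-1 = n%:R^-1 :> F.
Proof. by move=> n0; have [//|] := @ratr_frac 1 n; rewrite !mul1r. Qed.

Lemma integral_inN q : integral_in q -> integral_in (- q) /\ ratr (- q) = - ratr q :> F.
Proof.
move=> q0; have [|] := @ratr_frac (-1) 1; first by rewrite oner_neq0.
rewrite !divr1 !rmorphN1 => m1 E; have [] := integral_inM m1 q0.
by rewrite !mulN1r E mulN1r.
Qed.

Lemma integral_inX q n : integral_in q -> integral_in (q ^+ n) /\ ratr (q ^+ n) = ratr q ^+ n :> F.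
Proof.
move=> q0; elim: n => [|n [IH1 IH2]]; first exact: (integral_in_nat 1).
by have [] := integral_inM q0 IH1; rewrite -!exprS IH2 -exprS.
Qed.

Lemma integral_in_sum n (f : nat -> rat) : (forall i, (i < n)%N -> integral_in (f i)) ->
  integral_in (\sum_(i < n) f i) /\
  ratr (\sum_(i < n) f i) = \sum_(i < n) ratr (f i) :> F.
Proof.
elim: n => [|n IH] H; first by rewrite !big_ord0; apply: (integral_in_nat 0).
have [|IH1 IH2] := IH; first by move=> i ni; apply: H; apply: ltnW.
by rewrite !big_ord_recr /=; have [] := integral_inD IH1 (H n (ltnSn n)); rewrite IH2.
Qed.

End RatReduction.

(** * Bernoulli numbers and polynomials by umbral calculus *)

Section Bernoulli.
Local Notation B := bernoulli_nb.

(** The linear functional sending the n-th power of the indeterminate to the n-th Bernoulli number;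
    on the n-th power of its translate by c it gives the Bernoulli polynomial at c. *)
Definition umbral (q : {poly rat}) : rat := \sum_(i < size q) q`_i * B i.

Lemma umbralE (q : {poly rat}) n : (size q <= n)%N ->
  umbral q = \sum_(i < n) q`_i * B i.
Proof.
move=> le; rewrite /umbral (big_ord_widen _ (fun i => q`_i * B i) le) big_mkcond.
apply: eq_bigr => i _; case: ltnP => // /(nth_default 0) ->.
by rewrite mul0r.
Qed.

Lemma umbralD q r : umbral (q + r) = umbral q + umbral r.
Proof.
pose n := maxn (size q) (size r).
rewrite (umbralE (leq_maxl _ _ : size q <= n)%N) (umbralE (leq_maxr _ _ : size r <= n)%N).
rewrite (umbralE (size_polyD q r)) -big_split.
by apply: eq_bigr => i _; rewrite /= coefD mulrDl.
Qed.

Lemma umbralZ c q : umbral (c *: q) = c * umbral q.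
Proof.
rewrite (umbralE (size_scale_leq c q)) big_distrr.
by apply: eq_bigr => i _; rewrite coefZ -mulrA.
Qed.

Lemma umbral_sum n (f : nat -> {poly rat}) :
  umbral (\sum_(i < n) f i) = \sum_(i < n) umbral (f i).
Proof.
elim: n => [|n IH]; first by rewrite !big_ord0 /umbral size_poly0 big_ord0.
by rewrite !big_ord_recr /= umbralD IH.
Qed.

Lemma umbralXn n : umbral 'X^n = B n.
Proof.
rewrite /umbral size_polyXn big_ord_recr /= coefXn eqxx mul1r big1 ?add0r // => i _.
by rewrite coefXn ltn_eqF ?mul0r.
Qed.

Lemma umbral_XD c n :
  umbral (('X + c%:P) ^+ n) = \sum_(i < n.+1) 'C(n, i)%:R * B i * c ^+ (n - i).
Proof.
rewrite addrC exprDn (umbral_sum n.+1 (fun i => _ ^+ (n - i) * 'X^i *+ 'C(n, i))).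
apply: eq_bigr => i _; rewrite -scaler_nat umbralZ -rmorphXn mul_polyC umbralZ umbralXn.
ring.
Qed.

(** By linearity it suffices to treat powers, where this is the defining recurrence of the Bernoulli
    numbers. *)
Lemma umbral_diff q : umbral (q \Po ('X + 1)) - umbral q = q`_1.
Proof.
suff H n : umbral (('X + 1) ^+ n) - B n = (n == 1%N)%:R.
  have -> : umbral (q \Po ('X + 1)) = \sum_(i < size q) q`_i * umbral (('X + 1) ^+ i).
    rewrite comp_polyE (umbral_sum _ (fun i => q`_i *: ('X + 1) ^+ i)).
    by apply: eq_bigr => i _; rewrite umbralZ.
  rewrite -sumrB; under eq_bigr => i _ do rewrite -mulrBr H.
  have [lt|le] := ltnP 1 (size q).
    rewrite (bigD1 (Ordinal lt)) //= mulr1 big1 ?addr0 // => i ni.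
    by case: eqP => [E|]; [case/eqP: ni; apply: val_inj | rewrite mulr0].
  rewrite nth_default // big1 // => i _; case: eqP => [E|]; last by rewrite mulr0.
  by have := leq_trans (ltn_ord i) le; rewrite E.
rewrite -[1]/(1%:P) umbral_XD big_ord_recr /= binn subnn mul1r mulr1 addrK.
case: n => [|n]; first by rewrite big_ord0.
rewrite -[(n.+1 == 1)%N]/(n == 0%N) -bernoulli_nbE.
by apply: eq_bigr => i _; rewrite expr1n mulr1.
Qed.

(** The Bernoulli polynomial at 1/2. [M n] is 2^(n-1) (B_n(0) + B_n(1/2)); two successive
    applications of the shift by 1 to 2X show that it obeys the recurrence determining [B], hence
    equals it. *)
Lemma umbral_half n : umbral (('X + (2%:R^-1)%:P) ^+ n) = (2%:R ^- n *+ 2 - 1) * B n.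
Proof.
pose M n : rat := (umbral ((2%:R *: 'X) ^+ n) + umbral ((2%:R *: 'X + 1) ^+ n)) / 2%:R.
have comp2 (q : {poly rat}) : (q \Po ('X + 1)) \Po (2%:R *: 'X) = q \Po (2%:R *: 'X + 1).
  by rewrite -comp_polyA comp_polyD comp_polyX -polyC1 comp_polyC.
have Mrec m : \sum_(j < m.+1) 'C(m.+1, j)%:R * M j = (m == 0%N)%:R.
  pose r : {poly rat} := (2%:R *: 'X) ^+ m.+1.
  have -> : \sum_(j < m.+1) 'C(m.+1, j)%:R * M j =
      (umbral (r \Po ('X + 1)) - umbral r) / 2%:R.
    have E1 : r \Po ('X + 1) = (2%:R *: 'X + 1 + 1) ^+ m.+1.
      rewrite /r rmorphXn /= comp_polyZ comp_polyX scalerDr -addrA; congr ((_ + _) ^+ _).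
      by rewrite -mul_polyC mulr1 -polyC1 -rmorphD.
    have E (t : {poly rat}) : umbral ((t + 1) ^+ m.+1) - umbral (t ^+ m.+1) =
        \sum_(j < m.+1) 'C(m.+1, j)%:R * umbral (t ^+ j).
      rewrite [t + 1]addrC exprDn (umbral_sum m.+2 (fun i => 1 ^+ (m.+1 - i) * t ^+ i *+ 'C(m.+1, i))).
      rewrite big_ord_recr /= binn expr1n mul1r mulr1n addrK.
      by apply: eq_bigr => i _; rewrite expr1n mul1r -scaler_nat umbralZ.
    rewrite E1 -[umbral _ - _](subrKA (umbral ((2%:R *: 'X + 1) ^+ m.+1))) !E.
    rewrite -big_split big_distrl; apply: eq_bigr => j _ /=.
    by rewrite /M; ring.
  rewrite umbral_diff /r exprZn coefZ coefXn; case: m {r} => [|m].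
    by rewrite expr1 /= mulr1 divff.
  by rewrite /= mulr0 mul0r.
have {Mrec} ME m : M m = B m.
  have [k] := ubnP m; elim: k m => // k IH m; rewrite ltnS => mk.
  have m0 : m.+1%:R != 0 :> rat by rewrite pnatr_eq0.
  apply: (mulfI m0); have := Mrec m; rewrite -(bernoulli_nbE m) !big_ord_recr /= !binSn.
  under eq_bigr => j _ do rewrite IH 1?(leq_trans (ltn_ord j)) //.
  by move/addrI.
have := ME n; rewrite /M.
have -> : (2%:R *: 'X + 1) ^+ n = 2%:R ^+ n *: ('X + (2%:R^-1)%:P) ^+ n :> {poly rat}.
  rewrite -exprZn scalerDr; congr ((_ + _) ^+ _).
  by rewrite -mul_polyC -rmorphM /= mulfV.
rewrite exprZn !umbralZ umbralXn => /(congr1 (fun u => u *+ 2 / 2%:R ^+ n)).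
have two_n : 2%:R ^+ n != 0 :> rat by rewrite expf_neq0.
rewrite -[_ / 2 *+ 2]mulr_natr divfK // -mulrDr mulrAC mulfV // mul1r.
move/(canRL (addKr _)) => ->; ring.
Qed.

Lemma faulhaber m k : (0 < k)%N ->
  k%:R * \sum_(i < m) i%:R ^+ k.-1 = umbral (('X + m%:R%:P) ^+ k) - B k.
Proof.
move=> k0; elim: m => [|m IH].
  by rewrite big_ord0 mulr0 polyC0 addr0 umbralXn subrr.
rewrite big_ord_recr mulrDr IH /= -natr1 rmorphD /= addrC addrA; congr (_ - _).
have := umbral_diff (('X + m%:R%:P) ^+ k); rewrite rmorphXn /= comp_polyD comp_polyX comp_polyC.
rewrite polyC1 -['X + 1 + _]addrA [1 + _]addrC => /(canRL (subrK _)) ->.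
congr (_ + _); rewrite addrC exprDn coef_sum.
case: k k0 {IH} => // k _; rewrite !big_ord_recl big1 => [|i _]; last first.
  by rewrite -rmorphXn coefMn coefCM coefXn /= mulr0 mul0rn.
rewrite addr0 !coefMn -!rmorphXn !coefCM !coefXn /= mulr0 mul0rn add0r mulr1.
by rewrite bin1 subSS subn0 mulr_natl rmorphXn.
Qed.

End Bernoulli.

(** * Sums over symmetric lists *)

Section SymmetricLists.
Variable F : fieldType.
Implicit Types s : seq F.

Definition symlist s : seq F := s ++ map -%R (rev s).

Lemma take_idx a b i : (i <= a)%N ->
  take i (idx a b) = nseq i 2%N /\ drop i (idx a b) = idx (a - i) b.
Proof.
move=> ia; have -> : idx a b = nseq i 2%N ++ idx (a - i) b.
  by rewrite /idx catA -nseqD subnKC.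
by rewrite take_size_cat ?drop_size_cat ?size_nseq.
Qed.

Lemma drop_idx a b i : (i <= b)%N ->
  take (a.+1 + i) (idx a b) = idx a i /\ drop (a.+1 + i) (idx a b) = nseq (b - i) 2%N.
Proof.
move=> ib; have -> : idx a b = idx a i ++ nseq (b - i) 2%N.
  by rewrite /idx -catA cat_cons -nseqD subnKC.
have <- : size (idx a i) = (a.+1 + i)%N by rewrite size_cat /= !size_nseq addnS.
by rewrite take_size_cat ?drop_size_cat.
Qed.

Lemma rev_idx a b : rev (idx a b) = idx b a.
Proof. by rewrite /idx rev_cat rev_cons !rev_nseq cat_rcons. Qed.

Lemma size_idx a b : size (idx a b) = (a + b).+1.
Proof. by rewrite size_cat /= !size_nseq addnS. Qed.

Lemma e2_opp_rev s i : e2 (map -%R (rev s)) i = e2 s i.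
Proof.
have odd2 : sumn (nseq i 2%N) = i.*2 by elim: i => //= i ->; rewrite doubleS.
rewrite /e2 ns_opp odd2 -signr_odd odd_double mul1r.
by rewrite -[nseq i 2%N in LHS]rev_nseq ns_rev.
Qed.

Lemma ns_opp_rev_idx s a b : ns (map -%R (rev s)) (idx a b) = - ns s (idx b a).
Proof.
rewrite ns_opp -[idx a b in X in _ * X]rev_idx ns_rev -signr_odd.
suff -> : odd (sumn (idx a b)) by rewrite mulN1r.
rewrite /idx sumn_cat /= oddD.
have e i : odd (sumn (nseq i 2%N)) = false by elim: i => //= i ->.
by rewrite !oddD !e.
Qed.

Lemma e2_symlist s i : e2 (symlist s) i = \sum_(j < i.+1) e2 s j * e2 s (i - j).
Proof. by rewrite e2_cat; apply: eq_bigr => j _; rewrite e2_opp_rev. Qed.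

(** The negative half is read backwards, with a sign given by the parity of the weight; that weight
    is odd exactly when the half receives the entry 1. *)
Lemma ns_symlist_idx s a b :
  ns (symlist s) (idx a b) =
  \sum_(i < b.+1) ns s (idx a i) * e2 s (b - i)
  - \sum_(i < a.+1) e2 s i * ns s (idx b (a - i)).
Proof.
rewrite ns_cat size_idx -addnS -addSn big_split_ord addrC -sumrN; congr (_ + _).
  apply: eq_bigr => i _ /=; have [-> ->] := @take_idx a b i (leq_ord i).
  by rewrite ns_opp_rev_idx mulrN.
apply: eq_bigr => i _ /=; have [-> ->] := @drop_idx a b i (leq_ord i).
by rewrite -/(e2 _ _) e2_opp_rev.
Qed.

Lemma ns_symlist_idx_e0 s a b n :
  (forall i, (0 < i <= n)%N -> e2 s i = 0) -> (a <= n)%N -> (b <= n)%N ->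
  ns (symlist s) (idx a b) = ns s (idx a b) - ns s (idx b a).
Proof.
move=> e0 an bn; rewrite ns_symlist_idx; congr (_ - _).
  rewrite big_ord_recr big1 /= => [|i _]; last first.
    by rewrite e0 ?mulr0 //; have /= := ltn_ord i; lia.
  by rewrite add0r subnn e2_0 mulr1.
rewrite big_ord_recl big1 /= => [|i _].
  by rewrite addr0 subn0 e2_0 mul1r.
by rewrite e0 ?mul0r //; have := ltn_ord i; rewrite /bump /=; lia.
Qed.

Lemma nst_symlist_idx_e0 s a b :
  (forall i, (0 < i <= a + b)%N -> e2 s i = 0) ->
  nst (symlist s) (idx a b) = (-1) ^+ (a + b) * ns (symlist s) (idx b a).
Proof.
move=> e0; have E0 i : (0 < i <= a + b)%N -> e2 (symlist s) i = 0.
  move=> ib; rewrite e2_symlist big1 // => j _.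
  have [j0|j0] := posnP j; last by rewrite e0 ?mul0r //; have := ltn_ord j; lia.
  by rewrite j0 subn0 (e0 i ib) mulr0.
rewrite -sum_nst_idx big_ord_recl [X in X + _]big_ord_recl !big1 /= => [|i _|i _].
- by rewrite !addr0 !subn0 !e2_0 !mul1r.
- by rewrite big1 // => j _; rewrite E0 ?mulr0 ?mul0r //; have := ltn_ord i; rewrite /bump /=; lia.
- by rewrite (E0 (bump 0 i)) ?mulr0 ?mul0r //; have := ltn_ord i; rewrite /bump /=; lia.
Qed.

End SymmetricLists.

Lemma nats_symlist (F : fieldType) h : h.*2.+1%:R = 0 :> F ->
  nats F h.*2 = symlist (nats F h).
Proof.
move=> p0; apply: (@eq_from_nth _ 0).
  by rewrite size_cat (size_map -%R) size_rev !size_nats addnn.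
move=> i; rewrite size_nats => ih.
rewrite (nth_map 0%N) ?size_iota // nth_iota // nth_cat size_nats.
case: ltnP => hi; first by rewrite (nth_map 0%N) ?size_iota // nth_iota.
rewrite (nth_map 0) ?size_rev ?size_nats; last by lia.
rewrite nth_rev ?size_nats; last by lia.
rewrite (nth_map 0%N) ?size_iota; last by lia.
rewrite nth_iota; last by lia.
apply/eqP; rewrite -subr_eq0 opprK -natrD; apply/eqP; rewrite -[RHS]p0; congr _%:R; lia.
Qed.

(** The coefficient of the theorem as a difference antisymmetric in [a] and [b]: a symmetric list
    produces the value at (a, b) minus the value at (b, a). *)
Definition coefq (a b : nat) : rat :=
  2%:R * (-1) ^+ (a + b) * (1 - 1 / 4%:R ^+ (a + b))
  * ('C(2 * a + 2 * b + 1, 2 * a)%:R - 'C(2 * a + 2 * b + 1, 2 * b)%:R).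

Lemma coefqE a b :
  4 * (-1) ^+ (a + b) * ((a%:R - b%:R) / (2 * a%:R + 1))
               * (1 - 1 / 4 ^+ (a + b)) * 'C(2 * a + 2 * b + 1, 2 * b + 1)%:R
  = coefq a b.
Proof.
have D0 : 2%:R * a%:R + 1 != 0 :> rat by rewrite -natrM natr1 pnatr_eq0.
rewrite /coefq; have -> : 'C(2 * a + 2 * b + 1, 2 * a) = 'C(2 * a + 2 * b + 1, 2 * b + 1).
  by rewrite -bin_sub; [congr 'C(_, _)|]; lia.
have E : ('C(2 * a + 2 * b + 1, 2 * b)%:R : rat) =
    (2 * b%:R + 1) / (2 * a%:R + 1) * 'C(2 * a + 2 * b + 1, 2 * b + 1)%:R.
  have := mul_bin_left (2 * a + 2 * b + 1) (2 * b).
  have -> : (2 * a + 2 * b + 1 - 2 * b = 2 * a + 1)%N by lia.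
  rewrite -[(2 * b).+1]addn1; move: 'C(_, _) 'C(_, _) => C1 C2.
  move=> /(congr1 (GRing.natmul (1 : rat))); rewrite !(natrM, natrD) => H.
  by rewrite mulrAC H mulrAC mulfV ?mul1r.
rewrite E; set C := 'C(_, _)%:R; set q := 1 - _.
by field; rewrite D0.
Qed.

Lemma coefq_starE a b :
  4 * (b%:R - a%:R) / (2 * a%:R + 1)
               * (1 - 1 / 4 ^+ (a + b)) * 'C(2 * a + 2 * b + 1, 2 * b + 1)%:R
  = (-1) ^+ (a + b) * coefq b a.
Proof.
have -> : coefq b a = - coefq a b.
  by rewrite /coefq [(b + a)%N]addnC [(2 * b + _)%N]addnC; ring.
rewrite -coefqE.
have s2 : (-1) ^+ (a + b) * (-1) ^+ (a + b) = 1 :> rat by rewrite -expr2 sqrr_sign.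
set s := (-1) ^+ _ in s2 *; set q := 1 - _; set C := 'C(_, _)%:R.
transitivity (s * s * (4 * ((b%:R - a%:R) / (2 * a%:R + 1)) * q * C)).
  by rewrite s2 mul1r mulrA.
by ring.
Qed.

Lemma sum_ord_double (V : nmodType) (f : nat -> V) m :
  \sum_(j < m.*2) f j = \sum_(i < m) (f i.*2 + f i.*2.+1).
Proof. by elim: m => [|m IH]; rewrite ?big_ord0 // doubleS !big_ord_recr /= IH addrA. Qed.

(** * Alternating power sums and Bernoulli numbers modulo p *)

Section ModPBernoulli.
Variables (p h : nat) (F : finFieldType).
Hypotheses (p_pr : prime p) (ph : p = h.*2.+1) (pcharF : p \in [pchar F]).
Hypothesis natF : forall x : F, exists2 v, (v < p)%N & x = v%:R.
Hypothesis cardF : #|F| = p.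
Local Notation B := bernoulli_nb.

Let nat_neq0 k : (0 < k < p)%N -> k%:R != 0 :> F.
Proof. exact: (natr_modp_neq0 pcharF idfun). Qed.

(** The recurrence for B_r divides only by r + 1, which is less than p. *)
Lemma integral_bernoulli r : (r.+1 < p)%N -> integral_in F (B r).
Proof.
have [k] := ubnP r; elim: k r => // k IH r; rewrite ltnS => rk rp.
have r0 : r.+1%:R != 0 :> rat by rewrite pnatr_eq0.
have -> : B r = ((r == 0%N)%:R - \sum_(j < r) 'C(r.+1, j)%:R * B j) * r.+1%:R^-1.
  by rewrite -bernoulli_nbE big_ord_recr /= binSn [_ + _ * B r]addrC addrK mulrC mulKf.
have [|iS _] := @integral_in_sum F r (fun j => 'C(r.+1, j)%:R * B j).
  move=> i ir; have [||//] := @integral_inM F 'C(r.+1, i)%:R (B i).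
    by case: (integral_in_nat F 'C(r.+1, i)).
  by apply: IH; lia.
have [iN _] := integral_inN iS.
have [iD _] := integral_inD (integral_in_nat F (r == 0%N)).1 iN.
have [|iV _] := @integral_in_natV F r.+1; first by apply: nat_neq0; lia.
by case: (integral_inM iD iV).
Qed.

(** The plain power sum vanishes because k - 1 is odd; adding it to the alternating one cancels the
    odd terms and doubles the even ones. *)
Lemma alt_power_sum k : (2 <= k)%N -> ~~ odd k ->
  \sum_(j < p.-1) (-1) ^+ j.+1 * j.+1%:R ^+ k.-1 =
  2%:R ^+ k * \sum_(i < h.+1) i%:R ^+ k.-1 :> F.
Proof.
move=> k2 ek; have two0 : 2%:R != 0 :> F.
  by apply: nat_neq0; have := prime_gt1 p_pr; lia.
have pred_k : k.-1 = k.-2.+1 by lia.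
have S0 : \sum_(j < h.*2) j.+1%:R ^+ k.-1 = 0 :> F.
  apply: (mulIf two0); rewrite mul0r mulr_natr mulr2n {1}(reindex_inj rev_ord_inj).
  rewrite -big_split big1 // => j _ /=.
  have -> : (h.*2 - j.+1).+1%:R = - j.+1%:R :> F.
    apply/eqP; rewrite -subr_eq0 opprK -natrD.
    have -> : ((h.*2 - j.+1).+1 + j.+1 = p)%N by have := ltn_ord j; lia.
    by rewrite (pcharf0 pcharF).
  have ok : odd k.-1 by lia.
  by rewrite exprNn -signr_odd ok mulN1r addNr.
rewrite ph /= (sum_ord_double (fun j => (-1) ^+ j.+1 * j.+1%:R ^+ k.-1)).
rewrite (sum_ord_double (fun j => j.+1%:R ^+ k.-1)) in S0.
rewrite big_ord_recl pred_k expr0n add0r -pred_k big_distrr /=.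
rewrite -[LHS]addr0 -[X in _ + X]S0 -big_split; apply: eq_bigr => i _ /=.
rewrite /bump add1n !exprS -signr_odd odd_double expr0.
have -> : (i.*2.+2)%:R = 2%:R * i.+1%:R :> F by rewrite -natrM; congr _%:R; lia.
rewrite exprMn -[X in 2%:R ^+ X * _](prednK (ltnW k2)) exprS; ring.
Qed.

(** Modulo p the bound h + 1 of the power sum is 1/2, so Faulhaber's formula meets the Bernoulli
    polynomial at 1/2. Moreover k = -(2n + 1), and 2^k = 4^-n because k + 2n = p - 1. *)
Lemma alt_power_sum_bernoulli n : (0 < n < h)%N ->
  \sum_(j < p.-1) (-1) ^+ j.+1 * j.+1%:R ^+ (p - n.*2.+2) =
  - 2%:R * (1 - 1 / 4%:R ^+ n) * ratr (B (p - n.*2.+1) / n.*2.+1%:R) :> F.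
Proof.
move=> /andP[n0 nh]; set k := (p - n.*2.+1)%N.
have -> : (p - n.*2.+2 = k.-1)%N by rewrite /k; lia.
have k2 : (2 <= k)%N by rewrite /k; lia.
have kp : (k.+1 < p)%N by rewrite /k; lia.
rewrite alt_power_sum //; last by rewrite /k; lia.
have two0 : 2%:R != 0 :> F by apply: nat_neq0; lia.
have k0 : k%:R != 0 :> F by apply: nat_neq0; lia.
have n20 : n.*2.+1%:R != 0 :> F by apply: nat_neq0; lia.
have iB r : (r <= k)%N -> integral_in F (B r) by move=> rk; apply: integral_bernoulli; lia.
have iN m := integral_in_nat F m.
have [i2 E2] := integral_in_natV two0.
have kE : k%:R = - n.*2.+1%:R :> F.
  apply/eqP; rewrite -subr_eq0 opprK -natrD.
  have -> : (k + n.*2.+1 = p)%N by rewrite /k; lia.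
  by rewrite (pcharf0 pcharF).
have hE : h.+1%:R = 2%:R^-1 :> F.
  apply: (mulIf two0); rewrite mulVf // -natrM.
  have -> : (h.+1 * 2 = p + 1)%N by lia.
  by rewrite natrD (pcharf0 pcharF) add0r.
have red_umbral (c : rat) : integral_in F c ->
    integral_in F (umbral (('X + c%:P) ^+ k)) /\
    ratr (umbral (('X + c%:P) ^+ k)) =
    \sum_(i < k.+1) 'C(k, i)%:R * ratr (B i) * ratr c ^+ (k - i) :> F.
  move=> ic; rewrite umbral_XD.
  have H i : (i < k.+1)%N -> integral_in F ('C(k, i)%:R * B i * c ^+ (k - i)) /\
     ratr ('C(k, i)%:R * B i * c ^+ (k - i)) = 'C(k, i)%:R * ratr (B i) * ratr c ^+ (k - i) :> F.
    move=> ik; have [i3 E3] := integral_inM (iN 'C(k, i)).1 (iB i ik).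
    have [i4 E4] := integral_inX (k - i) ic.
    by have [i5 ->] := integral_inM i3 i4; rewrite E3 E4 (iN _).2.
  have [|i6 ->] := @integral_in_sum F k.+1 (fun i => 'C(k, i)%:R * B i * c ^+ (k - i)).
    by move=> i /H[].
  by split=> //; apply: eq_bigr => i _; rewrite (H i (ltn_ord i)).2.
(* The reduced Bernoulli polynomial depends only on the class of its argument, so the rational 1/2
   may be replaced by the integer h + 1, where Faulhaber's formula holds over the rationals. *)
have Fh : k%:R * \sum_(i < h.+1) i%:R ^+ k.-1 =
    ratr (umbral (('X + (2%:R^-1)%:P) ^+ k)) - ratr (B k) :> F.
  have [_ ->] := red_umbral _ i2; rewrite E2 -hE -(iN h.+1).2.
  have [iu <-] := red_umbral _ (iN h.+1).1.
  have [iNB EN] := integral_inN (iB k (leqnn k)).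
  have [_] := integral_inD iu iNB; rewrite EN => <-.
  rewrite -faulhaber; last by rewrite /k; lia.
  have iX i : integral_in F (i%:R ^+ k.-1) /\ ratr (i%:R ^+ k.-1) = i%:R ^+ k.-1 :> F.
    by have [? ->] := integral_inX k.-1 (iN i).1; rewrite (iN i).2.
  have [|iS ES] := @integral_in_sum F h.+1 (fun i => i%:R ^+ k.-1).
    by move=> i _; case: (iX i).
  have [_ ->] := integral_inM (iN k).1 iS; rewrite ES (iN k).2; congr (_ * _).
  by apply: eq_bigr => i _; rewrite (iX i).2.
have Eh : ratr (umbral (('X + (2%:R^-1)%:P) ^+ k)) = (2%:R ^- k *+ 2 - 1) * ratr (B k) :> F.
  rewrite umbral_half.
  have [i3 E3] := integral_inX k i2; rewrite -!exprVn.
  have [i4 E4] := integral_inD i3 i3.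
  have [i5 E5] := integral_inN (iN 1%N).1.
  have [i6 E6] := integral_inD i4 i5.
  have [_] := integral_inM i6 (iB k (leqnn k)).
  by rewrite E6 E5 E4 E3 E2 (iN 1%N).2 => <-.
have [iV EV] := integral_in_natV n20.
have [_ ->] := integral_inM (iB k (leqnn k)) iV; rewrite EV.
have E4 : 1 / 4%:R ^+ n = 2%:R ^+ k :> F.
  rewrite div1r -[4%N]/(2 ^ 2)%N natrX -exprM.
  apply: (mulIf (expf_neq0 (2 * n) two0)); rewrite mulVf ?expf_neq0 // -exprD.
  have -> : (k + 2 * n = p.-1)%N by rewrite /k; lia.
  apply: (mulIf two0); rewrite mul1r -exprSr prednK ?prime_gt0 //.
  by rewrite -(pFrobenius_autE pcharF) pFrobenius_aut_nat.
rewrite E4; apply: (mulfI k0); rewrite mulrCA Fh Eh kE.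
have two_k : 2%:R ^+ k != 0 :> F by rewrite expf_neq0.
move: (ratr _) (2%:R ^+ k) two_k n20 => b t t0.
move: (n.*2.+1%:R) => m m0.
by field; rewrite t0 m0.
Qed.

Lemma fact_modp_neq0 m : (m < p)%N -> m`!%:R != 0 :> F.
Proof.
elim: m => [|m IH] mp; first by rewrite fact0 oner_neq0.
by rewrite factS natrM mulf_neq0 ?IH ?(ltnW mp) // nat_neq0.
Qed.

(** Modulo p the upper entry is -s, and a binomial coefficient with negative upper entry is a signed
    ordinary one. *)
Lemma bin_modp s m : (0 < s)%N -> (s + m <= p)%N ->
  'C(p - s, m)%:R = (-1) ^+ m * 'C(s + m - 1, m)%:R :> F.
Proof.
move=> s0 smp; apply: (mulIf (@fact_modp_neq0 m _)); first by lia.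
rewrite -mulrA -!natrM !bin_ffact.
elim: m smp => [|m IH] smp; first by rewrite !ffactn0 expr0 mulr1.
have -> : (s + m.+1 - 1 = (s + m - 1).+1)%N by lia.
rewrite ffactnSr ffactSS natrM IH; last by lia.
have -> : (p - s - m = p - (s + m))%N by lia.
rewrite natrB ?(pcharf0 pcharF); last by lia.
have -> : ((s + m - 1).+1 = s + m)%N by lia.
by rewrite sub0r natrM exprS; ring.
Qed.

Lemma ns_symlist_modp a b : (a + b < h)%N ->
  ns (symlist (nats F h)) (idx a b) =
  ratr (coefq a b) * ratr (B (p - (2 * a + 2 * b + 1)) / (2 * a + 2 * b + 1)%:R) :> F.
Proof.
move=> abh; have e0 i : (0 < i <= a + b)%N -> e2 (nats F h) i = 0.
  by move=> ib; apply: (e2_half p_pr ph pcharF natF cardF); lia.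
rewrite (ns_symlist_idx_e0 e0) ?leq_addr ?leq_addl //.
have bE x y : (x + y < h)%N -> 'C(p - x.*2.+2, y.*2)%:R = 'C(2 * x + 2 * y + 1, 2 * y)%:R :> F.
  move=> xy; rewrite bin_modp //; last by lia.
  rewrite -signr_odd odd_double mul1r; congr ('C(_, _)%:R); lia.
rewrite !(ns_idx_half p_pr ph pcharF natF cardF) //; last by rewrite addnC.
rewrite [(b + a)%N]addnC !bE //; last by rewrite addnC.
rewrite [(2 * b + 2 * a)%N]addnC.
(* For a = b = 0 the Bernoulli number is B_(p-1), which is not p-integral; there the two sides
   vanish separately. *)
have [ab0|ab0] := posnP (a + b).
  have [-> ->] : a = 0%N /\ b = 0%N by lia.
  rewrite /coefq subrr mulr0.
  by have [_ ->] := integral_in_nat F 0; rewrite mul0r.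
rewrite alt_power_sum_bernoulli ?ab0 //.
have -> : (2 * a + 2 * b + 1 = (a + b).*2.+1)%N by lia.
move: (ratr (_ / _)) => beta; set n := (a + b)%N.
have iN m := integral_in_nat F m.
have four0 : 4%:R != 0 :> F.
  have two0 : 2%:R != 0 :> F by apply: nat_neq0; have := prime_gt1 p_pr; lia.
  by rewrite -[4%N]/(2 * 2)%N natrM mulf_neq0.
rewrite /coefq -/n !div1r -!natrX.
have -> : (2 * a + 2 * b + 1 = n.*2.+1)%N by rewrite /n; lia.
have [i1 E1] : integral_in F (1 - (4 ^ n)%:R^-1) /\
    ratr (1 - (4 ^ n)%:R^-1) = 1 - (4 ^ n)%:R^-1 :> F.
  have [|i2 E2] := @integral_in_natV F (4 ^ n); first by rewrite natrX expf_neq0.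
  have [i3 E3] := integral_inN i2.
  have [i4 ->] := integral_inD (iN 1%N).1 i3.
  by split=> //; rewrite E3 E2 (iN 1%N).2.
have [i5 E5] := integral_inN (iN 'C(n.*2.+1, 2 * b)).1.
have [i6 E6] := integral_inD (iN 'C(n.*2.+1, 2 * a)).1 i5.
have [i7 E7] := integral_inN (iN 1%N).1.
have [i8 E8] := integral_inX n i7.
have [i9 E9] := integral_inM (iN 2%N).1 i8.
have [i10 E10] := integral_inM i9 i1.
have [_ ->] := integral_inM i10 i6.
rewrite E10 E9 E8 E7 E6 E5 E1 !(iN _).2; ring.
Qed.

End ModPBernoulli.

Lemma eq_A1_of N (f g : prime_prod) :
  (forall q : prime_number, (N < sval q)%N -> f q = g q) -> A1_of f = A1_of g.
Proof.
move=> fg; apply/qclassP; rewrite /= /finitely_supported.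
apply: (@sub_finite_set _ _ (sval @^-1` `I_N.+1)%classic).
  move=> q /= nz; rewrite ltnNge; apply/negP => lt; apply: nz.
  by rewrite -[LHS]/(f q - g q) fg ?subrr.
apply: finite_preimage; last exact: finite_II.
by move=> x y _ _; apply: val_inj.
Qed.

Lemma prime_Fp_nat p : prime p -> forall x : 'F_p, exists2 v, (v < p)%N & x = v%:R.
Proof.
move=> p_pr x; exists (val x); last by rewrite natr_Zp.
by have := ltn_ord x; rewrite [X in (_ < X)%N](Fp_cast p_pr).
Qed.

(** A sign only changes the numerator, so this holds for every rational in every field. *)
Lemma ratr_signM (F : fieldType) n (q : rat) :
  ratr ((-1) ^+ n * q) = (-1) ^+ n * ratr q :> F.
Proof.
rewrite -[in LHS]signr_odd -[in RHS]signr_odd; case: odd; rewrite ?mul1r //.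
by rewrite !mulN1r /ratr numqN denqN rmorphN mulNr.
Qed.

Lemma zetaA_idx a b :
  zetaA (idx a b) = ratA (coefq a b) * ZfrakA (2 * a + 2 * b + 1) /\
  zetaA_star (idx a b) = ratA ((-1) ^+ (a + b) * coefq b a) * ZfrakA (2 * a + 2 * b + 1).
Proof.
(* Beyond this bound p is odd and a + b < h; the finitely many smaller primes disappear in A_1. *)
have modp (q : prime_number) : ((a + b).*2.+3 < sval q)%N ->
    exists2 h, sval q = h.*2.+1 & (a + b < h)%N.
  move=> lt; exists (sval q)./2; last by lia.
  have := svalP q => /even_prime[|oq]; lia.
rewrite /zetaA /zetaA_star /ratA /ZfrakA -!rmorphM.
split; apply: (@eq_A1_of (a + b).*2.+3) => -[p p_pr] lt.
all: have [h /= ph abh] := modp _ lt.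
all: have pF := pchar_Fp p_pr; have nF := prime_Fp_nat p_pr; have cF := card_Fp p_pr.
all: have p0 : h.*2.+1%:R = 0 :> 'F_p by rewrite -ph (pcharf0 pF).
all: have nE : nats 'F_p p.-1 = symlist (nats 'F_p h) by rewrite -nats_symlist // ph.
  rewrite nested_sum_ltn nE.
  exact: (ns_symlist_modp p_pr ph pF nF cF abh).
rewrite nested_sum_leq nE nst_symlist_idx_e0; last first.
  by move=> i ib; apply: (e2_half p_pr ph pF nF cF); lia.
rewrite (ns_symlist_modp p_pr ph pF nF cF) 1?addnC // [(2 * b + _)%N]addnC mulrA.
by rewrite -ratr_signM.
Qed.

(** * Convergence and regularization *)

Section Convergence.
Local Open Scope classical_set_scope.
Variable R : realType.
Implicit Types (k l : mindex) (N : nat).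

Definition zn k N : R := ns (nats R N) k.
Definition harm N : R := psum (nats R N) 1.

Lemma zn_nil N : zn [::] N = 1.
Proof. exact: ns_nil. Qed.

Lemma zn_rconsS k a N :
  zn (rcons k a) N.+1 = zn (rcons k a) N + N.+1%:R ^- a * zn k N.
Proof. by rewrite /zn nats_rcons ns_rcons. Qed.

Lemma zn_rcons0 k a : zn (rcons k a) 0 = 0.
Proof. by rewrite /zn ns_oversize // size_rcons. Qed.

Lemma harmE N : harm N = zn [:: 1%N] N.
Proof.
elim: N => [|N IH]; first by rewrite /harm /psum big_nil (@zn_rcons0 [::]).
by rewrite -[[:: _]]/(rcons [::] 1%N) zn_rconsS zn_nil mulr1 -IH /harm psum_natsS.
Qed.

Lemma harmS N : harm N.+1 = harm N + N.+1%:R^-1.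
Proof. exact: psum_natsS. Qed.

Lemma zn_ge0 k N : 0 <= zn k N.
Proof.
elim/last_ind: k N => [|k a IHk] N; first by rewrite zn_nil.
elim: N => [|N IHN]; first by rewrite zn_rcons0.
by rewrite zn_rconsS addr_ge0 // mulr_ge0 // invr_ge0 exprn_ge0.
Qed.

Lemma zn_nondecreasing k : nondecreasing_seq (zn k).
Proof.
apply/nondecreasing_seqP => N; case/lastP: k => [|k a]; first by rewrite !zn_nil.
by rewrite zn_rconsS lerDl mulr_ge0 ?zn_ge0 // invr_ge0 exprn_ge0.
Qed.

Lemma sqrt_step N : (Num.sqrt N.+1%:R : R)^-1 <= 2 * (Num.sqrt N.+1%:R - Num.sqrt N%:R).
Proof.
set s := Num.sqrt N.+1%:R; set t := Num.sqrt N%:R.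
have s0 : 0 < s by rewrite sqrtr_gt0 ltr0n.
have t0 : 0 <= t by rewrite sqrtr_ge0.
have ts : t <= s by rewrite ler_wsqrtr // ler_nat.
have E : s ^+ 2 - t ^+ 2 = 1 by rewrite !sqr_sqrtr ?ler0n // -natr1; ring.
by rewrite -[s^-1]mul1r ler_pdivrMr //; have := sqr_ge0 (s - t); lra.
Qed.

Lemma sqrt_stepV N : (N.+2%:R * Num.sqrt N.+2%:R : R)^-1 <=
  2 * ((Num.sqrt N.+1%:R)^-1 - (Num.sqrt N.+2%:R)^-1).
Proof.
set s := Num.sqrt N.+2%:R; set t := Num.sqrt N.+1%:R.
have s0 : 0 < s by rewrite sqrtr_gt0 ltr0n.
have t0 : 0 < t by rewrite sqrtr_gt0 ltr0n.
have ts : t <= s by rewrite ler_wsqrtr // ler_nat.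
have E : s ^+ 2 - t ^+ 2 = 1 by rewrite !sqr_sqrtr ?ler0n // -natr1; ring.
have -> : N.+2%:R = s ^+ 2 by rewrite sqr_sqrtr ?ler0n.
have -> : 2 * (t^-1 - s^-1) = 2 * (s - t) / (s * t).
  by field; rewrite !gt_eqF.
rewrite -[leLHS]mul1r -[X in X * _ <= _]E ler_pdivrMr ?mulr_gt0 // mulrAC ler_pdivlMr ?mulr_gt0 //.
have -> : s ^+ 2 - t ^+ 2 = (s - t) * (s + t) by ring.
rewrite -!mulrA [2 * _]mulrCA ler_wpM2l ?subr_ge0 //.
rewrite [leRHS](_ : _ = 2 * s * (s * s)); last by ring.
rewrite [leLHS](_ : _ = (s + t) * (s * t)); last by ring.
by apply: ler_pM; [rewrite addr_ge0 // ltW | rewrite mulr_ge0 // ltW | lra | rewrite ler_pM2l].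
Qed.

(** Square roots replace powers of logarithms: the sum of 1 / sqrt(n) telescopes against 2 sqrt(n),
    so the bound reproduces itself when an entry is appended, and sqrt(n) / n^2 remains summable. *)
Lemma zn_sqrt_bound k : is_index k ->
  exists2 C : R, 0 <= C & forall N, zn k N <= C * Num.sqrt N.+1%:R.
Proof.
elim/last_ind: k => [|k a IH]; rewrite /is_index.
  move=> _; exists 1 => // N; rewrite zn_nil mul1r -[leLHS]sqrtr1 ler_wsqrtr //.
  by rewrite ler1n.
rewrite all_rcons => /andP[a1 /IH [C C0 HC]]; exists (2 * C); first by rewrite mulr_ge0.
suff H N : zn (rcons k a) N <= 2 * C * Num.sqrt N%:R.
  move=> N; apply: (le_trans (H N)); rewrite ler_wpM2l ?mulr_ge0 //.
  by rewrite ler_wsqrtr // ler_nat.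
elim: N => [|N IHN]; first by rewrite zn_rcons0 sqrtr0 mulr0.
rewrite zn_rconsS.
have s0 : 0 < Num.sqrt N.+1%:R :> R by rewrite sqrtr_gt0 ltr0n.
have le1 : N.+1%:R ^- a * zn k N <= C * (Num.sqrt N.+1%:R)^-1.
  apply: (@le_trans _ _ (N.+1%:R^-1 * (C * Num.sqrt N.+1%:R))).
    apply: ler_pM; rewrite ?zn_ge0 ?invr_ge0 ?exprn_ge0 // lef_pV2 ?posrE ?exprn_gt0 ?ltr0n //.
    by rewrite -[leLHS]expr1 ler_weXn2l // ler1n.
  have -> : N.+1%:R^-1 = Num.sqrt N.+1%:R ^- 2 :> R by rewrite sqr_sqrtr ?ler0n.
  by move: (Num.sqrt N.+1%:R) s0 => s s0; rewrite le_eqVlt; apply/orP; left; apply/eqP; field; rewrite gt_eqF.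
apply: (le_trans (lerD IHN le1)).
have := ler_wpM2l C0 (sqrt_step N); lra.
Qed.

Lemma zn_bound k : admissible k -> exists2 C : R, 0 <= C & forall N, zn k N <= C.
Proof.
case/lastP: k => [|k a] /andP[ik]; first by exists 1 => // N; rewrite zn_nil.
rewrite last_rcons => a2; move: ik; rewrite /is_index all_rcons => /andP[_ ik].
have [C C0 HC] := zn_sqrt_bound ik; exists (3 * C); first by rewrite mulr_ge0.
have step N : N.+1%:R ^- a * zn k N <= C * (N.+1%:R * Num.sqrt N.+1%:R)^-1.
  have s0 : 0 < Num.sqrt N.+1%:R :> R by rewrite sqrtr_gt0 ltr0n.
  apply: (@le_trans _ _ (N.+1%:R ^- 2 * (C * Num.sqrt N.+1%:R))).
    apply: ler_pM; rewrite ?zn_ge0 ?invr_ge0 ?exprn_ge0 // lef_pV2 ?posrE ?exprn_gt0 ?ltr0n //.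
    by rewrite ler_weXn2l // ler1n.
  have -> : N.+1%:R = Num.sqrt N.+1%:R ^+ 2 :> R by rewrite sqr_sqrtr ?ler0n.
  move: (Num.sqrt N.+1%:R) s0 => s s0; rewrite sqrtr_sqr gtr0_norm // le_eqVlt.
  by apply/orP; left; apply/eqP; field; rewrite gt_eqF.
(* Chosen to equal C at the first term and to grow by the telescoping differences of
   [sqrt_stepV]. *)
suff H N : zn (rcons k a) N.+1 <= 3 * C - 2 * C * (Num.sqrt N.+1%:R)^-1.
  case=> [|N]; first by rewrite zn_rcons0 mulr_ge0.
  apply: (le_trans (H N)); by rewrite gerBl !mulr_ge0 ?invr_ge0 ?sqrtr_ge0.
elim: N => [|N IHN].
  rewrite zn_rconsS zn_rcons0 add0r; apply: (le_trans (step 0%N)).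
  by rewrite sqrtr1 mulr1 invr1; lra.
rewrite zn_rconsS; apply: (le_trans (lerD IHN (step _))).
have := ler_wpM2l C0 (sqrt_stepV N).
move: ((N.+2%:R * _)^-1) ((Num.sqrt N.+1%:R)^-1) ((Num.sqrt N.+2%:R)^-1) => u v w.
by lra.
Qed.

Lemma zn_cvg k : admissible k -> zn k n @[n --> \oo] --> mzv R k.
Proof.
move=> ak; have [C _ HC] := zn_bound ak.
have cv : cvgn (zn k).
  apply: nondecreasing_is_cvgn; first exact: zn_nondecreasing.
  by exists C => _ [n _ <-].
have -> : mzv R k = limn (zn k); last by [].
(* [nested_sum] at n.+1 runs over indices up to n, hence the shift. *)
rewrite /mzv; apply/cvg_lim => //; rewrite -cvg_shiftS /=.
suff -> : (fun n => nested_sum R ltn k n.+1) = zn k by exact: cv.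
by apply/funext => n; rewrite nested_sum_ltn.
Qed.

Lemma harm_sublinear : harm n / n.+1%:R @[n --> \oo] --> (0 : R).
Proof.
have [C C0 HC] := @zn_sqrt_bound [:: 1%N] erefl.
have H0 n : 0 <= harm n by rewrite harmE zn_ge0.
apply: (@squeeze_cvgr _ _ _ _ (fun=> 0) (fun n => C * (Num.sqrt n.+1%:R)^-1)).
- apply: nearW => n; rewrite divr_ge0 //= ler_pdivrMr ?ltr0n //.
  rewrite -[X in _ <= _ * X](@sqr_sqrtr R) ?ler0n //.
  have s0 : 0 < Num.sqrt n.+1%:R :> R by rewrite sqrtr_gt0 ltr0n.
  rewrite harmE (le_trans (HC n)) // expr2 mulrA -[C / _ * _]mulrA mulVf ?gt_eqF //.
  by rewrite mulr1.
- exact: cvg_cst.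
rewrite -[X in _ --> X](mulr0 C); apply: cvgMr.
apply/cvgrPdist_lt => e e0; near=> n.
rewrite sub0r normrN ger0_norm ?invr_ge0 ?sqrtr_ge0 //.
have s0 : 0 < Num.sqrt n.+1%:R :> R by rewrite sqrtr_gt0 ltr0n.
rewrite -[e]invrK ltf_pV2 ?posrE ?invr_gt0 // -[ltLHS]gtr0_norm ?invr_gt0 //.
rewrite -sqrtr_sqr ltr_sqrt ?ltr0n //.
have : e^-1 ^+ 2 < n%:R by near: n; apply: nbhs_infty_gtr.
by move=> /lt_trans; apply; rewrite ltr_nat.
Unshelve. all: by end_near. Qed.

End Convergence.

Lemma stuffle_nil k : stuffle k [::] = [:: k].
Proof. by case: k. Qed.

Lemma stuffle_cons1 a k :
  stuffle (a :: k) [:: 1%N] =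
  map (cons a) (stuffle k [:: 1%N]) ++ [:: [:: 1, a & k]; (a + 1)%N :: k].
Proof. by rewrite /= stuffle_nil. Qed.

(** [stuffle] recurses on first entries, whereas regularization looks at the last one. *)
Lemma stuffle_rcons k a :
  perm_eq (stuffle (rcons k a) [:: 1%N])
    (map (rcons^~ a) (stuffle k [:: 1%N])
       ++ [:: rcons (rcons k a) 1%N; rcons k (a + 1)%N]).
Proof.
elim: k => [|b k IH]; first by rewrite stuffle_cons1; apply/permP => P /=; rewrite !addn0 addnCA.
rewrite rcons_cons !stuffle_cons1 map_cat -catA -map_comp.
have /perm_map H := IH; apply: perm_trans (perm_cat (H _ (cons b)) (perm_refl _)) _.
rewrite map_cat -map_comp -catA perm_cat2l.
by apply/permP => P /=; rewrite !addn0; lia.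
Qed.

Lemma word_shuffle_cons1 a u :
  word_shuffle (a :: u) [:: true] =
  map (cons a) (word_shuffle u [:: true]) ++ [:: [:: true, a & u]].
Proof. by []. Qed.

Lemma word_shuffle_rcons u a :
  perm_eq (word_shuffle (rcons u a) [:: true])
    (map (rcons^~ a) (word_shuffle u [:: true]) ++ [:: rcons (rcons u a) true]).
Proof.
elim: u => [|b u IH]; first by apply/permP => P /=; rewrite !addn0 addnC.
rewrite rcons_cons !word_shuffle_cons1 map_cat -catA -map_comp.
have /perm_map H := IH; apply: perm_trans (perm_cat (H _ (cons b)) (perm_refl _)) _.
rewrite map_cat -map_comp -catA perm_cat2l.
by apply/permP => P /=; rewrite !addn0; lia.
Qed.

Lemma count_stuffle_rcons k : last 2%N k != 1%N ->
  count_mem (rcons k 1%N) (stuffle k [:: 1%N]) = 1%N.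
Proof.
case/lastP: k => [|k a]; first by [].
rewrite last_rcons => a1; have /permP -> := stuffle_rcons k a.
rewrite count_cat count_map /= eqxx.
rewrite (@eq_count _ _ pred0) ?count_pred0 => [|l /=]; last first.
  by rewrite eqseq_rcons (negbTE a1) andbF.
rewrite -[rcons k _ == _]/(rcons k (a + 1)%N == rcons (rcons k a) 1%N).
rewrite (_ : (_ == _) = false) //; apply/eqP => /(congr1 size).
by rewrite !size_rcons; lia.
Qed.

Lemma count_word_shuffle_rcons u : last false u = false ->
  count_mem (rcons u true) (word_shuffle u [:: true]) = 1%N.
Proof.
case/lastP: u => [|u a]; first by [].
rewrite last_rcons => ->; have /permP -> := word_shuffle_rcons u false.
rewrite count_cat count_map /= eqxx.
rewrite (@eq_count _ _ pred0) ?count_pred0 => [//|w /=].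
by rewrite eqseq_rcons andbF.
Qed.

Lemma parse_wordK w :
  nseq (parse_word w).1 false ++ word_of_index (parse_word w).2 = w.
Proof.
by elim: w => // -[] w IH /=; rewrite ?IH // -[in RHS]IH.
Qed.

Lemma index_of_wordK w : head true w -> word_of_index (index_of_word w) = w.
Proof. by case: w => [|[] w] // _; rewrite /index_of_word -[RHS]parse_wordK. Qed.

Lemma head_word_of_index k : head true (word_of_index k).
Proof. by case: k. Qed.

Lemma head_word_shuffle u w : head true u -> w \in word_shuffle u [:: true] -> head true w.
Proof.
case: u => [|[] u] // _ /=; first by rewrite inE => /eqP ->.
by rewrite mem_cat inE => /orP[/mapP[v _ ->]|/eqP ->].
Qed.

Lemma last_word_of_index k : admissible k -> last false (word_of_index k) = false.
Proof.
case/lastP: k => [|k a] //; rewrite /admissible last_rcons => /andP[_ a2].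
rewrite /word_of_index map_rcons flatten_rcons last_cat /=.
by case: a a2 => [|[|a]] // _ /=; elim: a.
Qed.

(** For an admissible index followed by 1, the division in [zreg_rec] is thus by 1. *)
Lemma count_index_prod_one bul k : admissible k ->
  count_mem (rcons k 1%N) (index_prod bul k [:: 1%N]) = 1%N.
Proof.
move=> ak; have ik : is_index k by case/andP: ak.
case: bul => /=.
  apply: count_stuffle_rcons; case/andP: ak => _; case: (last _ _) => [|[|]] //.
rewrite /shuffle count_map -[RHS](count_word_shuffle_rcons (last_word_of_index ak)).
apply: eq_in_count => w /(head_word_shuffle (head_word_of_index k)) hw /=.
apply/eqP/eqP => [E|->].
  by rewrite -(index_of_wordK hw) E word_of_index_rcons1.
by rewrite -word_of_index_rcons1 word_of_indexK // /is_index all_rcons.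
Qed.

(** * Truncated shuffle relation through polylogarithm coefficients *)

Section Shuffle.
Local Open Scope classical_set_scope.
Variable R : realType.

(* The coefficient of t^n in the multiple polylogarithm of a word, read from
   its last letter. *)
Fixpoint rpolylog (u : seq bool) (n : nat) : R :=
  match u with
  | [::] => (n == 0%N)%:R
  | false :: v => rpolylog v n / n%:R
  | true :: v => (\sum_(m < n) rpolylog v m) / n%:R
  end.

Definition polylog u := rpolylog (rev u).

Lemma polylog_rcons u a n :
  polylog (rcons u a) n = (if a then \sum_(m < n) polylog u m else polylog u n) / n%:R.
Proof. by rewrite /polylog rev_rcons; case: a. Qed.

Lemma polylog_nil n : polylog [::] n = (n == 0%N)%:R.
Proof. by []. Qed.

Lemma polylog_rcons0 u a : polylog (rcons u a) 0 = 0.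
Proof. by rewrite polylog_rcons mulr0n invr0 mulr0. Qed.

Lemma sum_recip (n m : nat) : (0 < m < n)%N ->
  m%:R^-1 * (n - m)%:R^-1 = n%:R^-1 * (m%:R^-1 + (n - m)%:R^-1) :> R.
Proof.
move=> mn; rewrite natrB; last by lia.
have m0 : m%:R != 0 :> R by rewrite pnatr_eq0; lia.
have n0 : n%:R != 0 :> R by rewrite pnatr_eq0; lia.
have nm : n%:R - m%:R != 0 :> R by rewrite -natrB ?pnatr_eq0; lia.
by field; rewrite m0 n0 nm.
Qed.

(** Coefficients of the product of the polylogarithm of [u] with -log(1 - t). The induction is the
    product rule for t d/dt, which appears here as the partial fractions of 1 / (m (n - m)). *)
Lemma polylog_shuffle u n : head true u ->
  \sum_(w <- word_shuffle u [:: true]) polylog w n =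
  \sum_(m < n) polylog u m / (n - m)%:R.
Proof.
elim/last_ind: u n => [|u a IH] n hu.
  rewrite big_seq1 -[[:: true]]/(rcons [::] true) polylog_rcons.
  case: n => [|n]; first by rewrite !big_ord0 mul0r.
  by rewrite !big_ord_recl !big1 ?addr0 ?subn0 // => i _; rewrite /= mul0r.
rewrite (perm_big _ (word_shuffle_rcons u a)) big_cat big_map big_seq1 /=.
(* The coefficients of t d/dt applied to the polylogarithm of [rcons u a]. *)
pose d m := if a then \sum_(i < m) polylog u i else polylog u m.
have d0 : d 0%N = 0.
  rewrite /d; move: hu; case: (a) => [_|] /=; first by rewrite big_ord0.
  by case/lastP: (u) => [//|v b] _; rewrite polylog_rcons0.
have -> : \sum_(m < n) polylog (rcons u a) m / (n - m)%:R =
    n%:R^-1 * (\sum_(m < n) polylog (rcons u a) m + \sum_(m < n) d m / (n - m)%:R).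
  rewrite -big_split big_distrr; apply: eq_bigr => m _; rewrite polylog_rcons -/(d m).
  have [->|m0] := posnP m; first by rewrite d0 !mul0r /= addr0 mulr0.
  by rewrite /= -mulrA sum_recip ?m0 //=; ring.
rewrite polylog_rcons /= mulrDr addrC [X in X + _]mulrC; congr (_ + _).
under eq_bigr => w _ do rewrite polylog_rcons.
rewrite -big_distrl mulrC; congr (_ * _); rewrite /d; clear d d0.
have hu' : head true u by case: (u) hu.
case: a hu => hu /=; last exact: IH.
rewrite exchange_big /=; under eq_bigr => m _ do rewrite IH //.
elim: n => [|n IHn]; first by rewrite !big_ord0.
rewrite big_ord_recr /= IHn [in RHS]big_ord_recl big_ord0 mul0r add0r -big_split.
by apply: eq_bigr => m _; rewrite lift0 subSS big_ord_recr /= mulrDl.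
Qed.

Lemma sum_polylog k a N : 
  \sum_(n < N.+1) polylog (word_of_index (rcons k a.+1)) n =
  \sum_(n < N) (\sum_(m < n.+1) polylog (word_of_index k) m) / n.+1%:R ^+ a.+1.
Proof.
have wE n : polylog (word_of_index (rcons k a.+1)) n =
    (\sum_(m < n) polylog (word_of_index k) m) / n%:R ^+ a.+1.
  rewrite /word_of_index map_rcons flatten_rcons /=.
  elim: a => [|a IH]; first by rewrite cats1 polylog_rcons.
  have -> : true :: nseq a.+1 false = rcons (true :: nseq a false) false.
    by rewrite /= -cats1 -[[:: false]]/(nseq 1 false) -nseqD addn1.
  by rewrite -rcons_cat polylog_rcons IH -mulrA -invfM -exprSr.
rewrite big_ord_recl wE big_ord0 mul0r add0r.
by apply: eq_bigr => n _; rewrite wE.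
Qed.

Lemma zn_polylog k N : is_index k ->
  zn R k N = \sum_(n < N.+1) polylog (word_of_index k) n.
Proof.
elim/last_ind: k N => [|k a IH] N.
  by rewrite zn_nil big_ord_recl big1 ?addr0.
rewrite /is_index all_rcons => /andP[]; case: a => // a _ ik.
rewrite sum_polylog; elim: N => [|N IHN]; first by rewrite zn_rcons0 big_ord0.
by rewrite zn_rconsS big_ord_recr /= -IHN IH // mulrC.
Qed.

(** The truncated shuffle relation is not exact: [harm R (N - m)] stands where a product of
    truncated sums would have [harm R N]. *)
Lemma zn_shuffle k N : is_index k ->
  \sum_(l <- shuffle k [:: 1%N]) zn R l N =
  \sum_(m < N.+1) polylog (word_of_index k) m * harm R (N - m).
Proof.
move=> ik; rewrite big_map; set u := word_of_index k.
have hu : head true u := head_word_of_index k.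
transitivity (\sum_(n < N.+1) \sum_(m < n) polylog u m / (n - m)%:R).
  under [in RHS]eq_bigr => n _ do rewrite -polylog_shuffle //.
  rewrite exchange_big /= big_seq [in RHS]big_seq; apply: eq_bigr => w /(head_word_shuffle hu) hw.
  by rewrite zn_polylog ?index_of_wordP // index_of_wordK.
have h0 : harm R 0 = 0 by rewrite /harm /psum big_nil.
elim: N => [|N IH].
  by rewrite !big_ord1 big_ord0 subnn /harm /psum big_nil mulr0.
rewrite big_ord_recr IH [in RHS]big_ord_recr /= subnn h0 mulr0 addr0.
rewrite -big_split; apply: eq_bigr => m _ /=.
by rewrite subSn -1?ltnS // harmS mulrDr.
Qed.

Lemma harm_diff N m : (m <= N)%N -> 0 <= harm R N - harm R (N - m) <= m%:R / (N - m).+1%:R.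
Proof.
elim: m => [|m IH] mN; first by rewrite subn0 subrr mul0r lexx.
have /andP[h1 h2] := IH (ltnW mN).
have E : (N - m = (N - m.+1).+1)%N by lia.
have eqh : harm R N - harm R (N - m.+1) = harm R N - harm R (N - m) + (N - m)%:R^-1.
  by rewrite E harmS; ring.
rewrite eqh addr_ge0 ?invr_ge0 //= -natr1 mulrDl mul1r lerD //.
  apply: (le_trans h2); rewrite ler_wpM2l // lef_pV2 ?posrE ?ltr0n // ler_nat; lia.
by rewrite lef_pV2 ?posrE ?ltr0n // ?ler_nat; lia.
Qed.

Lemma sum_recip_pair N : \sum_(m < N) m.+1%:R^-1 * (N - m)%:R^-1 =
  2 * harm R N / N.+1%:R :> R.
Proof.
have H1 : \sum_(m < N) m.+1%:R^-1 = harm R N.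
  by elim: (N) => [|n IH]; [rewrite big_ord0 /harm /psum big_nil | rewrite big_ord_recr /= IH harmS].
have H2 : \sum_(m < N) (N - m)%:R^-1 = harm R N.
  rewrite -H1 (reindex_inj rev_ord_inj); apply: eq_bigr => m _ /=.
  by congr (_%:R^-1); have := ltn_ord m; lia.
transitivity ((N.+1%:R^-1 : R) * \sum_(m < N) (m.+1%:R^-1 + (N - m)%:R^-1)).
  rewrite big_distrr; apply: eq_bigr => m _ /=.
  by have := @sum_recip N.+1 m.+1; rewrite subSS => -> //; have := ltn_ord m; lia.
rewrite big_split /= H1 H2; ring.
Qed.

End Shuffle.

(** * Regularized values as limits *)

Section Regularization.
Local Open Scope classical_set_scope.
Variable R : realType.
Implicit Types (k l : mindex) (N : nat) (bul : regularization).

Lemma cvgn_sum (T : eqType) (s : seq T) (P : pred T) (f : T -> nat -> R) (l : T -> R) :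
  (forall t, t \in s -> P t -> f t n @[n --> \oo] --> l t) ->
  (\sum_(t <- s | P t) f t n) @[n --> \oo] --> \sum_(t <- s | P t) l t.
Proof.
elim: s => [|t s IH] H.
  rewrite big_nil; under eq_fun => n do rewrite big_nil; exact: cvg_cst.
rewrite big_cons; under eq_fun => n do rewrite big_cons.
have {}IH : (\sum_(t <- s | P t) f t n) @[n --> \oo] --> \sum_(t <- s | P t) l t.
  by apply: IH => x xs; apply: H; rewrite inE xs orbT.
case: ifP => // Pt; apply: cvgD => //; apply: H => //; exact: mem_head.
Qed.

Lemma admissible_all2 k : all (leq 2) k -> admissible k.
Proof.
move=> k2; rewrite /admissible /is_index (sub_all _ k2) /=; last by case.
by case/lastP: k k2 => // k a; rewrite all_rcons last_rcons => /andP[].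
Qed.

Lemma polylog_ge0 u n : 0 <= polylog R u n.
Proof.
elim/last_ind: u n => [|u a IH] n; first by rewrite polylog_nil.
by rewrite polylog_rcons; apply: divr_ge0 => //; case: a => //; apply: sumr_ge0.
Qed.

Lemma polylog_bound k : all (leq 2) k ->
  exists2 C : R, 0 <= C & forall m, polylog R (word_of_index k) m.+1 <= C / m.+1%:R ^+ 2.
Proof.
case/lastP: k => [|k a]; first by exists 0 => // m; rewrite polylog_nil mul0r.
rewrite all_rcons => /andP[a2 k2]; have ak := admissible_all2 k2.
have [C C0 HC] := zn_bound R ak; exists C => // m.
have ik : is_index k by case/andP: ak.
have ika : is_index (rcons k a) by rewrite /is_index all_rcons ltnW.
have -> : polylog R (word_of_index (rcons k a)) m.+1 = m.+1%:R ^- a * zn R k m.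
  apply: (addrI (zn R (rcons k a) m)); rewrite -zn_rconsS !zn_polylog //.
  by rewrite [in RHS]big_ord_recr.
rewrite mulrC; apply: ler_pM; rewrite ?zn_ge0 ?invr_ge0 ?exprn_ge0 //.
by rewrite lef_pV2 ?posrE ?exprn_gt0 ?ltr0n // ler_weXn2l ?ler1n.
Qed.

(** For the stuffle product the difference is 0 for each n. For the shuffle product it is O(H_n /
    n): the coefficients are O(1 / m^2), the harmonic differences at most m / (n - m + 1), and
    [sum_recip_pair] sums the products. *)
Lemma index_prod_defect bul k : all (leq 2) k ->
  (\sum_(l <- index_prod bul k [:: 1%N]) zn R l n - harm R n * zn R k n)
    @[n --> \oo] --> (0 : R).
Proof.
move=> k2; have ak := admissible_all2 k2.
have ik : is_index k by case/andP: ak.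
case: bul => /=.
  under eq_fun => n do rewrite /zn ns_stuffle -/(zn _ _ _) -/(zn _ _ _) -harmE mulrC subrr.
  exact: cvg_cst.
have [C C0 HC] := polylog_bound k2.
rewrite -[X in _ --> X]oppr0; under eq_fun => n do rewrite -opprB.
apply: cvgN; apply: (@squeeze_cvgr _ _ _ _ (fun=> 0) (fun n => 2 * C * (harm R n / n.+1%:R))).
- apply: nearW => n; rewrite zn_shuffle // zn_polylog // big_distrr -sumrB /=.
  have E (m : 'I_n.+1) : harm R n * polylog R (word_of_index k) m -
      polylog R (word_of_index k) m * harm R (n - m) =
      polylog R (word_of_index k) m * (harm R n - harm R (n - m)) by ring.
  under eq_bigr => m _ do rewrite E.
  apply/andP; split.
    apply: sumr_ge0 => m _; rewrite mulr_ge0 ?polylog_ge0 //.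
    by have /andP[] := @harm_diff R n m (leq_ord m).
  rewrite big_ord_recl subn0 subrr mulr0 add0r.
  rewrite [leRHS](_ : _ = C * (2 * harm R n / n.+1%:R)); last by ring.
  rewrite -sum_recip_pair big_distrr; apply: ler_sum => m _ /=.
  rewrite /bump add1n.
  have /andP[d0 d1] := @harm_diff R n m.+1 (ltn_ord m).
  apply: (le_trans (ler_pM (polylog_ge0 _ _) d0 (HC m) d1)).
  have -> : (n - m.+1).+1 = (n - m)%N by have := ltn_ord m; lia.
  rewrite le_eqVlt; apply/orP; left; apply/eqP; have := ltn_ord m => mn.
  have nm : (n - m)%:R != 0 :> R by rewrite pnatr_eq0; lia.
  have m0 : m.+1%:R != 0 :> R by rewrite pnatr_eq0.
  by move: ((n - m)%:R : R) (m.+1%:R : R) nm m0 => x y x0 y0; field; rewrite x0 y0.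
- exact: cvg_cst.
- rewrite -[X in _ --> X](mulr0 (2 * C)); apply: cvgMr; exact: harm_sublinear.
Qed.

Lemma zreg_admissible bul k : admissible k -> zreg R bul k = mzv R k.
Proof. by move=> ak; rewrite /zreg; case: (size k) => [|n] /=; rewrite ak. Qed.

(** As [k] has no entry 1, every other index in its product with (1) is admissible. The recursion of
    [zreg_rec] then unfolds only once, and both regularizations are the same limit. *)
Lemma zreg_cvg bul k : all (leq 2) k ->
  (zn R (rcons k 1%N) n - harm R n * zn R k n) @[n --> \oo] --> zreg R bul (rcons k 1%N).
Proof.
move=> k2; have ak := admissible_all2 k2; have ik : is_index k by case/andP: ak.
have nad : admissible (rcons k 1%N) = false by rewrite /admissible last_rcons andbF.
rewrite /zreg /= !size_rcons /= nad size_rcons -cats1 take_size_cat // cats1.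
rewrite count_index_prod_one // divr1.
set s := index_prod bul k [:: 1%N].
have adm l : l \in s -> l != rcons k 1%N -> admissible l.
  move=> ls nl; have [il [E|tl]] := index_prod_one ik ls; first by rewrite E eqxx in nl.
  apply: trail0_admissible => //; apply/eqP; rewrite -leqn0 (leq_trans tl) //.
  case/lastP: k k2 {ak ik nad s ls nl tl} => // k a; rewrite all_rcons => /andP[a2 _].
  have a1 : (a == 1)%N = false by case: a a2 => [|[]].
  by elim: k => [|b k IH] /=; rewrite ?all_rcons /= ?a1 ?andbF ?addn0.
have -> : \sum_(l <- s | l != rcons k 1%N) zreg_rec R bul (size k) l =
    \sum_(l <- s | l != rcons k 1%N) mzv R l.
  rewrite big_seq_cond [RHS]big_seq_cond; apply: eq_bigr => l /andP[ls nl].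
  by case: (size k) => [|n] /=; rewrite (adm l).
have -> : (fun n => zn R (rcons k 1%N) n - harm R n * zn R k n) =
    (fun n => (\sum_(l <- s) zn R l n - harm R n * zn R k n)
       - \sum_(l <- s | l != rcons k 1%N) zn R l n).
  apply/funext => n; rewrite [X in X - _ - _](bigID (pred1 (rcons k 1%N))) /=.
  rewrite (eq_bigr (fun=> zn R (rcons k 1%N) n)); last by move=> l /eqP ->.
  by rewrite big_const_seq iter_addr_0 count_index_prod_one // mulr1n; ring.
rewrite -[X in _ --> X]add0r; apply: cvgB; first exact: index_prod_defect.
by apply: cvgn_sum => l ls nl; apply: zn_cvg; apply: adm.
Qed.

(* Finite counterpart of [zreg] for an index with at most one entry 1. *)
Definition zn_reg k N : R :=
  zn R k N - (if last 0%N k == 1%N then harm R N * zn R (take (size k).-1 k) N else 0).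

Lemma zn_reg_cvg bul k : is_index k -> (count_mem 1%N k <= 1)%N ->
  zn_reg k n @[n --> \oo] --> zreg R bul k.
Proof.
move=> ik c1; rewrite /zn_reg; have [ak|nak] := boolP (admissible k).
  have -> : (last 0%N k == 1%N) = false.
    case/lastP: k ak {ik c1} => // k a /andP[_]; rewrite !last_rcons.
    by case: a => [|[]].
  under eq_fun => n do rewrite subr0.
  by rewrite zreg_admissible //; apply: zn_cvg.
case/lastP: k nak ik c1 => // k a; rewrite /admissible => /negP nak ik c1.
have a1 : a = 1%N.
  move: nak ik; rewrite last_rcons /is_index all_rcons; case: a {c1} => [|[|a]] //=.
  by move=> H h; case: H; rewrite h.
rewrite {}a1 in ik c1 *; rewrite last_rcons eqxx size_rcons.
under eq_fun => n do rewrite -cats1 take_size_cat // cats1.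
apply: zreg_cvg; apply/allP => b bk; move: ik; rewrite /is_index all_rcons /= => /allP/(_ b bk).
case: b bk => [|[|b]] // bk _; move: c1; rewrite -cats1 count_cat /= addn0 addn1 ltnS leqn0.
by move/eqP => c0; have := bk; rewrite -has_pred1 has_count c0.
Qed.

Definition lift_zetaS bul l : R :=
  \sum_(i < (size l).+1)
    (-1) ^+ sumn (drop i l) * zreg R bul (take i l) * zreg R bul (rev (drop i l)).

Lemma ns_symlist_zn s l :
  ns (symlist s) l =
  \sum_(i < (size l).+1) (-1) ^+ sumn (drop i l) * ns s (take i l) * ns s (rev (drop i l)) :> R.
Proof.
rewrite ns_cat; apply: eq_bigr => i _.
by rewrite ns_opp -[X in ns (rev s) X]revK ns_rev; ring.
Qed.

(* The harmonic numbers subtracted in [zn_reg] on the two sides of an entry 1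
   cancel. *)
Lemma ns_symlist_reg l N : (count_mem 1%N l <= 1)%N ->
  ns (symlist (nats R N)) l =
  \sum_(i < (size l).+1) (-1) ^+ sumn (drop i l) * zn_reg (take i l) N * zn_reg (rev (drop i l)) N.
Proof.
move=> c1; rewrite ns_symlist_zn.
pose H := harm R N; pose A i := zn R (take i l) N; pose B i := zn R (rev (drop i l)) N.
pose al i := nth 0%N l i == 1%N.
have regA i : (i < size l)%N -> zn_reg (take i.+1 l) N = A i.+1 - (al i)%:R * H * A i.
  move=> il; rewrite /zn_reg (take_nth 0%N) // last_rcons size_rcons -/(al i).
  rewrite -cats1 take_size_cat // cats1 -take_nth //.
  by case: (al i); rewrite ?mul1r ?mul0r.
have regB i : (i < size l)%N -> zn_reg (rev (drop i l)) N = B i - (al i)%:R * H * B i.+1.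
  move=> il; rewrite /zn_reg /B (drop_nth 0%N) // rev_cons last_rcons size_rcons -/(al i).
  rewrite -cats1 take_size_cat //.
  by case: (al i); rewrite ?mul1r ?mul0r.
have A0 : zn_reg (take 0 l) N = A 0%N by rewrite /zn_reg take0 /= subr0 /A take0.
have Bn : zn_reg (rev (drop (size l) l)) N = B (size l).
  by rewrite /zn_reg drop_size /= subr0 /B drop_size.
pose s i : R := (-1) ^+ sumn (drop i l).
pose al' i := if i is j.+1 then (al j)%:R else 0 : R.
pose be i := if (i < size l)%N then (al i)%:R else 0 : R.
have -> : \sum_(i < (size l).+1)
     (-1) ^+ sumn (drop i l) * zn_reg (take i l) N * zn_reg (rev (drop i l)) N =
  \sum_(i < (size l).+1) s i * (A i - al' i * H * A i.-1) * (B i - be i * H * B i.+1).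
  apply: eq_bigr => i _; congr (_ * _ * _).
    case: i => -[|i] il /=; first by rewrite A0 !mul0r subr0.
    by rewrite regA.
  rewrite /be; case: ltnP => il; first by rewrite regB.
  have -> : val i = size l by apply/eqP; rewrite eqn_leq il -ltnS ltn_ord.
  by rewrite Bn !mul0r subr0.
(* With at most one entry 1, two neighbours are never both 1, so the terms in H^2 vanish. *)
have ab0 (i : 'I_(size l).+1) : al' i * be i = 0.
  case: i => -[|i] il /=; first by rewrite mul0r.
  rewrite /be; case: ltnP => il2; last by rewrite mulr0.
  rewrite -natrM mulnb; case: andP => // -[/eqP a1 /eqP a2].
  move: c1; rewrite -(cat_take_drop i l) (drop_nth 0%N) // count_cat /= a1 (drop_nth 0%N) // /= a2 /=.
  by rewrite !add1n !addnS.
have -> : \sum_(i < (size l).+1) s i * (A i - al' i * H * A i.-1) * (B i - be i * H * B i.+1) =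
  \sum_(i < (size l).+1) s i * A i * B i
  - H * (\sum_(i < (size l).+1) s i * al' i * A i.-1 * B i
       + \sum_(i < (size l).+1) s i * be i * A i * B i.+1).
  rewrite mulrDr !big_distrr opprD -!sumrN -!big_split; apply: eq_bigr => i _ /=.
  transitivity (s i * A i * B i - H * (s i * al' i * A i.-1 * B i) - H * (s i * be i * A i * B i.+1)
     + al' i * be i * (s i * H ^+ 2 * A i.-1 * B i.+1)); first by ring.
  by rewrite ab0; ring.
(* After this shift of index the two sums agree term by term up to sign: moving the cut across an
   entry 1 flips the parity of the weight behind it. *)
rewrite [X in _ * (X + _)]big_ord_recl [X in _ * (_ + X)]big_ord_recr /=.
rewrite [X in _ = _ - _ * X](_ : _ = 0); first by rewrite mulr0 subr0.
rewrite /be ltnn !mulr0 !mul0r add0r addr0 -big_split big1 // => i _ /=.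
rewrite /bump add1n add0n ltn_ord.
have -> : s i * (al i)%:R = - (s i.+1 * (al i)%:R).
  rewrite /s (drop_nth 0%N (ltn_ord i)) /= exprD /al.
  by case: eqP => [->|_]; rewrite ?mulr0 ?oppr0 // expr1; ring.
ring.
Qed.

Lemma lift_zetaS_cvg bul l : is_index l -> (count_mem 1%N l <= 1)%N ->
  ns (symlist (nats R n)) l @[n --> \oo] --> lift_zetaS bul l.
Proof.
move=> il c1; under eq_fun => n do rewrite ns_symlist_reg //.
apply: cvgn_sum => i _ _.
have cs := cat_take_drop i l.
have it : is_index (take i l) by move: il; rewrite -{1}cs /is_index all_cat => /andP[].
have id : is_index (rev (drop i l)).
  by move: il; rewrite -{1}cs /is_index all_cat all_rev => /andP[].
have [ct cd] : (count_mem 1%N (take i l) <= 1)%N /\ (count_mem 1%N (rev (drop i l)) <= 1)%N.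
  by move: c1; rewrite -{1}cs count_cat count_rev; lia.
apply: cvgM; last exact: zn_reg_cvg.
apply: cvgMr; exact: zn_reg_cvg.
Qed.

End Regularization.

(** * Even zeta values *)

Section EvenZeta.
Local Open Scope classical_set_scope.
Variable R : realType.
Local Notation H := (harm R).

Lemma psum_zn N s : psum (nats R N) s = zn R [:: s] N.
Proof.
elim: N => [|N IH]; first by rewrite /psum big_nil (@zn_rcons0 _ [::]).
by rewrite -[[:: _]]/(rcons [::] s) zn_rconsS zn_nil mulr1 -IH psum_natsS.
Qed.

Lemma psum_cvg s : (2 <= s)%N -> psum (nats R n) s @[n --> \oo] --> mzv R [:: s].
Proof.
move=> s2; under eq_fun => n do rewrite psum_zn; apply: zn_cvg.
by rewrite /admissible /= s2 andbT ltnW.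
Qed.

Lemma psum_ord N s : psum (nats R N) s = \sum_(i < N) i.+1%:R ^- s.
Proof.
elim: N => [|N IH]; first by rewrite /psum big_nil big_ord0.
by rewrite psum_natsS big_ord_recr IH.
Qed.

Lemma nat_neq0 n : n.+1%:R != 0 :> R. Proof. by rewrite pnatr_eq0. Qed.

Lemma split_recip (x m : nat) : (m != x)%N ->
  (m.+1%:R ^+ 2 - x.+1%:R ^+ 2)^-1 =
  (2 * x.+1%:R)^-1 * ((m.+1%:R - x.+1%:R)^-1 - (m.+1%:R + x.+1%:R)^-1) :> R.
Proof.
move=> mx; have d0 : m.+1%:R - x.+1%:R != 0 :> R.
  by rewrite subr_eq0 eqr_nat eqSS.
have s0 : m.+1%:R + x.+1%:R != 0 :> R by rewrite -natrD pnatr_eq0.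
have := nat_neq0 x; move: (m.+1%:R : R) (x.+1%:R : R) d0 s0 => a b d0 s0 b0.
by rewrite subr_sqr; field; rewrite d0 s0 b0.
Qed.

Lemma sum_recip_sqr_diff (x N : nat) : (x < N)%N ->
  \sum_(m < N | (m != x :> nat)) (m.+1%:R ^+ 2 - x.+1%:R ^+ 2)^-1 =
  3 / (4 * x.+1%:R ^+ 2) - (2 * x.+1%:R)^-1 * (H (N + x.+1) - H (N - x.+1)) :> R.
Proof.
(* Before the excluded index, m - x is negative and the telescoping produces [H (x - M)]; the form
   in the statement takes over once M has passed x. *)
have low M : (M <= x)%N ->
    \sum_(m < M | (m != x :> nat)) (m.+1%:R ^+ 2 - x.+1%:R ^+ 2)^-1 =
    (2 * x.+1%:R)^-1 * (H (x - M) - H x - H (x.+1 + M) + H x.+1) :> R.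
  elim: M => [|M IH] Mx; first by rewrite big_ord0 subn0 addn0 (_ : _ + _ = 0) ?mulr0 //; ring.
  rewrite big_mkcond big_ord_recr -big_mkcond /= IH; last exact: ltnW.
  have Mx' : (M != x)%N by lia.
  rewrite Mx' split_recip // -mulrDr; congr (_ * _).
  have -> : (x - M = (x - M.+1).+1)%N by lia.
  rewrite addnS !harmS.
  have -> : (x - M.+1).+1%:R = - (M.+1%:R - x.+1%:R) :> R.
    by rewrite opprB -natrB ?ltnS ?(ltnW Mx) //; congr _%:R; lia.
  have -> : (x.+1 + M).+1%:R = M.+1%:R + x.+1%:R :> R by rewrite -natrD; congr _%:R; lia.
  by rewrite invrN; ring.
elim: N => // N IH; rewrite ltnS leq_eqVlt => /orP[/eqP xN|xN].
  rewrite big_mkcond big_ord_recr -big_mkcond /= -xN eqxx addr0 low // subnn.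
  rewrite !addSn addnS subnn (harmS R (x + x).+1) (harmS R x).
  have -> : (x + x).+2%:R = 2 * x.+1%:R :> R by rewrite -natrM; congr _%:R; lia.
  have -> : H 0 = 0 by rewrite /harm /psum big_nil.
  by have := nat_neq0 x; move: (x.+1%:R : R) => a a0; field.
rewrite big_mkcond big_ord_recr -big_mkcond /= IH //.
have Nx : (N != x)%N by lia.
rewrite Nx split_recip // addSn subSn // !harmS.
have -> : (N + x.+1).+1%:R = N.+1%:R + x.+1%:R :> R by rewrite -natrD; congr _%:R; lia.
have -> : (N - x.+1).+1%:R = N.+1%:R - x.+1%:R :> R by rewrite -natrB; [congr _%:R|]; lia.
ring.
Qed.

Lemma geometric_pair (r m n : nat) : (0 < r)%N -> (m != n)%N ->
  \sum_(k < r.-1) m.+1%:R ^- k.*2.+2 * n.+1%:R ^- (r - k.+1).*2 =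
  (n.+1%:R ^- r.-1.*2 - m.+1%:R ^- r.-1.*2) * (m.+1%:R ^+ 2 - n.+1%:R ^+ 2)^-1 :> R.
Proof.
move=> r0 mn; case: r r0 => // r _ /=.
have d0 : m.+1%:R ^+ 2 - n.+1%:R ^+ 2 != 0 :> R.
  by rewrite subr_eq0 eqrXn2 // eqr_nat eqSS.
have m0 := nat_neq0 m; have n0 := nat_neq0 n.
apply: (mulIf d0); rewrite divfK //.
move: (m.+1%:R : R) (n.+1%:R : R) m0 n0 {d0} => a b a0 b0.
elim: r => [|r IH]; first by rewrite big_ord0 mul0r double0 !expr0 subrr.
rewrite big_ord_recl /= subSS subn0.
have -> : \sum_(i < r) a ^- (bump 0 i).*2.+2 * b ^- (r.+2 - (bump 0 i).+1).*2 =
    a ^- 2 * \sum_(k < r) a ^- k.*2.+2 * b ^- (r.+1 - k.+1).*2.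
  rewrite big_distrr; apply: eq_bigr => i _ /=.
  by rewrite /bump add1n !subSS doubleS -[(i.*2.+4)%N]add2n exprD invfM; ring.
move: IH; set S := \sum_(k < r) _ => IH.
transitivity (a ^- 2 * b ^- r.+1.*2 * (a ^+ 2 - b ^+ 2) + a ^- 2 * (S * (a ^+ 2 - b ^+ 2))).
  by rewrite double0; ring.
rewrite IH doubleS -[r.*2.+2]add2n !exprD !invfM.
by move: (a ^+ r.*2)^-1 (b ^+ r.*2)^-1 => u v; field; rewrite a0 b0.
Qed.

(* Partial fractions in the double sum; its limit is Euler's quadratic relation
   between even zeta values. *)
Lemma euler_finite (r N : nat) : (0 < r)%N ->
  \sum_(k < r.-1) psum (nats R N) k.*2.+2 * psum (nats R N) (r - k.+1).*2 =
  (r%:R + 2^-1) * psum (nats R N) r.*2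
  - \sum_(n < N) n.+1%:R ^- r.*2.-1 * (H (N + n.+1) - H (N - n.+1)).
Proof.
move=> r0.
pose D (m n : nat) : R := (m.+1%:R ^+ 2 - n.+1%:R ^+ 2)^-1.
have DN m n : D m n = - D n m by rewrite /D -invrN opprB.
transitivity (\sum_(m < N) \sum_(n < N)
    \sum_(k < r.-1) m.+1%:R ^- k.*2.+2 * n.+1%:R ^- (r - k.+1).*2 : R).
  under [in RHS]eq_bigr => m _ do rewrite exchange_big.
  rewrite exchange_big; apply: eq_bigr => k _ /=.
  by rewrite !psum_ord big_distrlr.
transitivity (\sum_(m < N) \sum_(n < N) (
   (if m == n :> nat then r.-1%:R * m.+1%:R ^- r.*2 else 0) +
   (if m != n :> nat then n.+1%:R ^- r.-1.*2 * D m n else 0) -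
   (if m != n :> nat then m.+1%:R ^- r.-1.*2 * D m n else 0)) : R).
  apply: eq_bigr => m _; apply: eq_bigr => n _.
  case: eqP => [->|/eqP mn] /=; last by rewrite geometric_pair // -/(D m n); ring.
  rewrite addr0 subr0; transitivity (\sum_(k < r.-1) n.+1%:R ^- r.*2 : R).
    apply: eq_bigr => k _; rewrite -invfM -exprD; congr (_ ^+ _)^-1.
    by have := ltn_ord k; lia.
  by rewrite sumr_const card_ord mulr_natl.
have S1 : \sum_(m < N) \sum_(n < N)
   (if m == n :> nat then r.-1%:R * m.+1%:R ^- r.*2 else 0 : R) = r.-1%:R * psum (nats R N) r.*2.
  rewrite psum_ord big_distrr; apply: eq_bigr => m _ /=.
  rewrite (bigD1 m) //= eqxx big1 ?addr0 // => n nm.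
  by case: eqP => // E; case/eqP: nm; apply: val_inj.
have S2 : \sum_(m < N) \sum_(n < N)
   (if m != n :> nat then n.+1%:R ^- r.-1.*2 * D m n else 0 : R) =
   \sum_(n < N) n.+1%:R ^- r.-1.*2 * (3 / (4 * n.+1%:R ^+ 2)
     - (2 * n.+1%:R)^-1 * (H (N + n.+1) - H (N - n.+1))).
  rewrite exchange_big; apply: eq_bigr => n _.
  rewrite -sum_recip_sqr_diff // [in RHS]big_distrr [RHS]big_mkcond.
  by apply: eq_bigr => m _.
have S3 : \sum_(m < N) \sum_(n < N)
   (if m != n :> nat then m.+1%:R ^- r.-1.*2 * D m n else 0 : R) =
   - \sum_(m < N) \sum_(n < N)
   (if m != n :> nat then n.+1%:R ^- r.-1.*2 * D m n else 0 : R).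
  rewrite exchange_big -sumrN; apply: eq_bigr => m _; rewrite -sumrN.
  apply: eq_bigr => n _; rewrite eq_sym; case: eqP => //=; rewrite ?oppr0 // => _.
  by rewrite DN mulrN.
under eq_bigr => m _ do rewrite !big_split sumrN.
rewrite !big_split sumrN /= S3 S1 S2 opprK -addrA.
have -> : r%:R + 2^-1 = r.-1%:R + (1 + 2^-1) :> R by rewrite -{1}(prednK r0) -natr1 addrA.
rewrite mulrDl -addrA; congr (_ + _).
rewrite -big_split psum_ord big_distrr -sumrB; apply: eq_bigr => n _ /=.
have -> : (r.*2 = r.-1.*2 + 2)%N by lia.
have -> : ((r.-1.*2 + 2).-1 = r.-1.*2 + 1)%N by lia.
rewrite !exprD expr1 !invfM; have := nat_neq0 n.
move: (n.+1%:R : R) (_ ^+ _)^-1 (H _ - H _) => a u v a0; field.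
by [].
Qed.

(** The error in [euler_finite] is O(H_N / N), because H(N + n) - H(N - n) is at most 2n / (N - n +
    1) and is weighted by at most 1 / n^2. *)
Lemma euler_rec r : (2 <= r)%N ->
  \sum_(k < r.-1) mzv R [:: k.*2.+2] * mzv R [:: (r - k.+1).*2] =
  (r%:R + 2^-1) * mzv R [:: r.*2].
Proof.
move=> r2; have r0 : (0 < r)%N by lia.
pose err N := \sum_(n < N) n.+1%:R ^- r.*2.-1 * (H (N + n.+1) - H (N - n.+1)).
have err0 : err n @[n --> \oo] --> (0 : R).
  apply: (@squeeze_cvgr _ _ _ _ (fun=> 0) (fun n => 4 * (H n / n.+1%:R))).
  - apply: nearW => N.
    have hd (n : 'I_N) : 0 <= H (N + n.+1) - H (N - n.+1) <= 2 * n.+1%:R / (N - n)%:R.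
      have := @harm_diff R (N + n.+1) (n.+1 + n.+1); rewrite leq_add2r => /(_ (ltn_ord n)).
      have -> : (N + n.+1 - (n.+1 + n.+1) = N - n.+1)%N by lia.
      have -> : (N - n.+1).+1 = (N - n)%N by have := ltn_ord n; lia.
      by rewrite natrD mulr_natl mulr2n.
    apply/andP; split.
      apply: sumr_ge0 => n _; have /andP[? _] := hd n.
      by rewrite mulr_ge0 // invr_ge0 exprn_ge0.
    rewrite [leRHS](_ : _ = 2 * (2 * H N / N.+1%:R)); last by ring.
    rewrite -sum_recip_pair big_distrr; apply: ler_sum => n _ /=.
    have /andP[h0 h1] := hd n.
    apply: (@le_trans _ _ (n.+1%:R ^- 2 * (2 * n.+1%:R / (N - n)%:R))).
      apply: ler_pM => //.
      by rewrite lef_pV2 ?posrE ?exprn_gt0 ?ltr0n // ler_weXn2l ?ler1n //; lia.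
    have n0 := nat_neq0 n; rewrite le_eqVlt; apply/orP; left; apply/eqP.
    by move: (n.+1%:R : R) ((N - n)%:R^-1) n0 => a u a0; field.
  - exact: cvg_cst.
  - by rewrite -[X in _ --> X](mulr0 4); apply: cvgMr; apply: harm_sublinear.
have L : (\sum_(k < r.-1) psum (nats R N) k.*2.+2 * psum (nats R N) (r - k.+1).*2)
    @[N --> \oo] --> \sum_(k < r.-1) mzv R [:: k.*2.+2] * mzv R [:: (r - k.+1).*2].
  apply: cvgn_sum => k _ _; apply: cvgM; apply: psum_cvg => //.
  by have := ltn_ord k; lia.
have L' : ((r%:R + 2^-1) * psum (nats R N) r.*2 - err N) @[N --> \oo] -->
    (r%:R + 2^-1) * mzv R [:: r.*2] - 0.
  by apply: cvgB => //; apply: cvgMr; apply: psum_cvg; lia.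
rewrite subr0 in L'; apply: cvg_unique L'; first exact: norm_hausdorff.
by move: L; under eq_fun => N do rewrite euler_finite //.
Qed.

(** The ideal stated for real numbers, so that it applies directly to limits; [Zbar_eq] carries it
    to the quotient. *)
Definition in_zeta2 (x : R) : Prop := exists2 y, y \in @mzv_poly R & x = mzv R [:: 2%N] * y.

Lemma in_zeta2_0 : in_zeta2 0.
Proof. by exists 0; rewrite ?rpred0 ?mulr0. Qed.

Lemma in_zeta2D x y : in_zeta2 x -> in_zeta2 y -> in_zeta2 (x + y).
Proof. by move=> [u uP ->] [v vP ->]; exists (u + v); rewrite ?rpredD // mulrDr. Qed.

Lemma in_zeta2N x : in_zeta2 x -> in_zeta2 (- x).
Proof. by move=> [u uP ->]; exists (- u); rewrite ?rpredN // mulrN. Qed.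

Lemma in_zeta2B x y : in_zeta2 x -> in_zeta2 y -> in_zeta2 (x - y).
Proof. by move=> hx hy; apply: in_zeta2D => //; apply: in_zeta2N. Qed.

Lemma in_zeta2M a x : a \in @mzv_poly R -> in_zeta2 x -> in_zeta2 (a * x).
Proof. by move=> aP [u uP ->]; exists (a * u); rewrite ?rpredM // mulrCA. Qed.

Lemma in_zeta2_sum (T : eqType) (s : seq T) (P : pred T) (f : T -> R) :
  (forall t, t \in s -> P t -> in_zeta2 (f t)) -> in_zeta2 (\sum_(t <- s | P t) f t).
Proof.
move=> h; rewrite big_seq_cond; apply: (big_ind in_zeta2).
- exact: in_zeta2_0.
- exact: in_zeta2D.
- by move=> t /andP[]; apply: h.
Qed.

Lemma mzv_poly_ratr q : ratr q \in @mzv_poly R.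
Proof. exact: ratr_in. Qed.

Lemma mzv_poly_nat n : n%:R \in @mzv_poly R.
Proof. by rewrite rpred_nat. Qed.

Lemma mzv_poly_natV n : n%:R^-1 \in @mzv_poly R.
Proof. by have := mzv_poly_ratr n%:R^-1; rewrite fmorphV /= ratr_nat. Qed.

(** Every product in Euler's relation has an even zeta value of smaller argument as a factor, so the
    induction keeps the cofactor of zeta(2) inside the ring of multiple zeta values. *)
Lemma zeta_even_in_zeta2 r : (0 < r)%N -> in_zeta2 (mzv R [:: r.*2]).
Proof.
have [m] := ubnP r; elim: m r => // m IH r; rewrite ltnS => rm r0.
have [r2|r1] := leqP 2 r; last first.
  have -> : r = 1%N by lia.
  by exists 1; rewrite ?rpred1 ?mulr1.
have c0 : r%:R + 2^-1 != 0 :> R by rewrite gt_eqF // ltr_wpDl.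
have -> : mzv R [:: r.*2] = (r.*2.+1%:R^-1 * 2%:R) *
    \sum_(k < r.-1) mzv R [:: k.*2.+2] * mzv R [:: (r - k.+1).*2].
  rewrite euler_rec // mulrA -[LHS]mul1r; congr (_ * _).
  have -> : r%:R + 2^-1 = r.*2.+1%:R / 2%:R :> R.
    by rewrite -[r.*2.+1%:R]natr1 -muln2 natrM; field.
  by have := nat_neq0 r.*2; move: (_.+1%:R : R) => a a0; field.
apply: in_zeta2M; first by rewrite rpredM ?mzv_poly_natV ?mzv_poly_nat.
apply: in_zeta2_sum => k _ _; rewrite mulrC; apply: in_zeta2M.
  apply: mzv_in; rewrite /admissible /=; have := ltn_ord k; lia.
by rewrite -doubleS; apply: IH => //; have := ltn_ord k; lia.
Qed.

Definition e2_lim i : R := mzv R (nseq i 2%N).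

Lemma admissible_nseq2 i : admissible (nseq i 2%N).
Proof. by apply: admissible_all2; apply/allP => x /nseqP[->]. Qed.

Lemma e2_cvg i : e2 (nats R n) i @[n --> \oo] --> e2_lim i.
Proof. by apply: zn_cvg; apply: admissible_nseq2. Qed.

Lemma e2_lim_poly i : e2_lim i \in @mzv_poly R.
Proof. by apply: mzv_in; apply: admissible_nseq2. Qed.

Lemma e2_lim0 : e2_lim 0 = 1.
Proof.
have := @e2_cvg 0; under eq_fun => n do rewrite e2_0.
by move=> h; apply: cvg_unique h (cvg_cst _); apply: norm_hausdorff.
Qed.

(** Limit of Newton's identities, whose power sums all tend to even zeta values. *)
Lemma e2_lim_in_zeta2 i : (0 < i)%N -> in_zeta2 (e2_lim i).
Proof.
case: i => // i _.
have E : i.+1%:R * e2_lim i.+1 =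
    \sum_(j < i.+1) (-1) ^+ j * e2_lim (i - j) * mzv R [:: (2 + j.*2)%N].
  have h1 : (i.+1%:R * e2 (nats R n) i.+1) @[n --> \oo] --> i.+1%:R * e2_lim i.+1.
    by apply: cvgMr; apply: e2_cvg.
  have h2 : (\sum_(j < i.+1) (-1) ^+ j * e2 (nats R n) (i - j) * psum (nats R n) (2 + j.*2))
      @[n --> \oo] --> \sum_(j < i.+1) (-1) ^+ j * e2_lim (i - j) * mzv R [:: (2 + j.*2)%N].
    apply: cvgn_sum => j _ _; apply: cvgM; last exact: psum_cvg.
    by apply: cvgMr; apply: e2_cvg.
  move: h1; under eq_fun => n do rewrite newton.
  by move=> h1; apply: cvg_unique h1 h2; apply: norm_hausdorff.
have -> : e2_lim i.+1 = i.+1%:R^-1 * (i.+1%:R * e2_lim i.+1).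
  by rewrite mulKf // nat_neq0.
apply: in_zeta2M; first exact: mzv_poly_natV.
rewrite E; apply: in_zeta2_sum => j _ _; apply: in_zeta2M.
  by rewrite rpredM ?e2_lim_poly // rpredX ?rpredN ?rpred1.
by rewrite -[(2 + j.*2)%N]/(j.+1.*2); apply: zeta_even_in_zeta2.
Qed.

End EvenZeta.

(** * The limit of the summation identity *)

Section FiniteIdentity.
Local Open Scope classical_set_scope.
Variable R : realType.
Implicit Types (n N J a : nat) (y z : R).
Local Notation e := (fun n i => e2 (nats R n) i).

(** The radius 1/4 serves all later estimates: for y nonzero no y + j is an integer, for j > 0 it is
    at least j / 2, and geometric series with ratio 2 y^2 converge. *)
Lemma avoid_nat y (k j : nat) : y != 0 -> `|y| <= 4^-1 ->
  (k%:R - (y + j%:R)) * (k%:R + (y + j%:R)) != 0.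
Proof.
rewrite ler_norml => y0 /andP[y1 y2]; apply: mulf_neq0.
  have [kj|kj|->] := ltngtP k j.
  - have : k%:R + 1 <= j%:R :> R by rewrite natr1 ler_nat.
    by move=> H; apply/eqP; lra.
  - have : j%:R + 1 <= k%:R :> R by rewrite natr1 ler_nat.
    by move=> H; apply/eqP; lra.
  - by rewrite opprD addrCA subrr addr0 oppr_eq0.
have : (k + j = 0 \/ 0 < k + j)%N by lia.
case=> [|kj].
  by case: k j => [|k] [|j] // _; rewrite add0r addr0.
have : 1 <= k%:R + j%:R :> R by rewrite -natrD ler1n.
by move=> H; apply/eqP; lra.
Qed.

(* [tau N j y] tends to 1 and is at most 1 in absolute value, so it disappears
   from the identity [idx_poly_trunc] in the limit. *)
Definition tau N j y : R :=
  \prod_(i < j) ((N%:R - i%:R - y) / (N%:R + i.+1%:R + y)).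

(** Up to a constant, y * sprod N y is the product of y + k over -N <= k <= N, so a shift by 1 only
    exchanges one end factor for another. In the limit this is the antiperiodicity of the sine. *)
Lemma tauE N j y : y != 0 -> `|y| <= 4^-1 ->
  (-1) ^+ j * (y * sprod N y) / sprod N (y + j%:R) = tau N j y * (y + j%:R).
Proof.
move=> y0 y4.
have S0 i : sprod N (y + i%:R) != 0.
  apply: sprod_neq0 => k /andP[k1 kN]; first by rewrite pnatr_eq0 -lt0n.
  exact: avoid_nat.
have z0 i : y + i%:R != 0.
  by have := avoid_nat 0 i y0 y4; rewrite !add0r mulf_eq0 negb_or => /andP[].
elim: j => [|j IH].
  by have := S0 0%N; rewrite /tau big_ord0 expr0 !mul1r addr0 => S; rewrite mulfK.
rewrite /tau big_ord_recr /= -/(tau N j y).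
have [||_ E] := @rprod_sprod R N (y + j%:R).
- by move=> k /andP[k0 _]; rewrite pnatr_eq0 -lt0n.
- by move=> k _; apply: avoid_nat.
have [||E' _] := @rprod_sprod R N (y + j.+1%:R).
- by move=> k /andP[k0 _]; rewrite pnatr_eq0 -lt0n.
- by move=> k _; apply: avoid_nat.
rewrite -addrA natr1 E' in E.
have f0 : N%:R + j.+1%:R + y != 0.
  move: y4; rewrite ler_norml => /andP[y1 y2]; apply/eqP.
  by have := ler0n R N; have := ler0n R j; rewrite -natr1; lra.
have E2 : (y + j.+1%:R) * sprod N (y + j.+1%:R) * (y + j%:R - N%:R) =
   (y + j.+1%:R + N%:R) * ((y + j%:R) * sprod N (y + j%:R)).
  have := z0 j; have := z0 j.+1; have := S0 j; have := S0 j.+1; move: E.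
  move: (y + j.+1%:R) (y + j%:R) (sprod _ (y + j.+1%:R)) (sprod _ (y + j%:R)) => u v s s' E s0 s'0 u0 v0.
  have -> : v - N%:R = v * s' * ((v - N%:R) / (v * s')).
    by field; rewrite s'0 v0.
  by rewrite -E; field; rewrite u0 s0.
have -> : tau N j y * ((N%:R - j%:R - y) / (N%:R + j.+1%:R + y)) * (y + j.+1%:R) =
   (tau N j y * (y + j%:R)) * ((N%:R - j%:R - y) / (N%:R + j.+1%:R + y) * (y + j.+1%:R) / (y + j%:R)).
  by move: (z0 j) (N%:R + _ + _) f0 => v0 f f0; field; rewrite v0 f0.
rewrite -IH exprS; move: f0; rewrite -addrA (addrC N%:R) [_ + y]addrC => f0.
have := z0 j; have := z0 j.+1; have := S0 j; have := S0 j.+1; move: E2.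
move: (y + j.+1%:R) f0 (sprod _ (y + j.+1%:R)) (sprod _ (y + j%:R)) => u f0 s s' E2 s0 s'0 u0 v0.
have -> : N%:R - j%:R - y = - (y + j%:R - N%:R) by ring.
move: (y + j%:R) v0 E2 => v v0 E2.
have -> : v - N%:R = (u + N%:R) * (v * s') / (u * s).
  by rewrite -E2; field; rewrite u0 s0.
by field; rewrite u0 s0 v0 f0 s'0.
Qed.

Lemma tau_le1 N j y : `|y| <= 4^-1 -> `|tau N j y| <= 1.
Proof.
rewrite ler_norml => /andP[y1 y2]; rewrite /tau normr_prod; apply: prodr_ile1 => i _.
rewrite normr_ge0 /= normf_div ler_pdivrMr; last first.
  by rewrite normr_gt0; apply/eqP; have := ler0n R N; have := ler0n R i; rewrite -natr1; lra.
have h0 := ler0n R N; have h1 := ler0n R i.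
rewrite mul1r [leRHS]ger0_norm -natr1; last by lra.
by rewrite ler_norml; apply/andP; split; lra.
Qed.

Lemma tau_sub1 N j y : (0 < N)%N -> `|y| <= 4^-1 ->
  `|tau N j y - 1| <= j%:R * j.+1%:R / N%:R.
Proof.
move=> N0 y4; elim: j => [|j IH]; first by rewrite /tau big_ord0 subrr normr0 !mul0r.
have N1 : 1 <= N%:R :> R by rewrite ler1n.
rewrite /tau big_ord_recr /= -/(tau N j y).
set f := (X in _ * X).
have -> : tau N j y * f - 1 = tau N j y * (f - 1) + (tau N j y - 1) by ring.
apply: le_trans (ler_normD _ _) _; rewrite normrM.
have hf : `|f - 1| <= 2 * j.+1%:R / N%:R.
  move: (y4); rewrite ler_norml => /andP[y1 y2]; have h1 := ler0n R j.
  have d0 : 0 < N%:R + j.+1%:R + y by rewrite -natr1; lra.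
  have -> : f - 1 = - ((2 * j%:R + 1 + 2 * y) / (N%:R + j.+1%:R + y)).
    by rewrite /f -natr1; field; rewrite natr1 gt_eqF.
  rewrite normrN ger0_norm; last by rewrite divr_ge0 ?ltW //; lra.
  apply: ler_pM; rewrite ?invr_ge0 ?(ltW d0) -?natr1 //; try lra.
  by rewrite lef_pV2 ?posrE -?natr1 //; lra.
have h2 := @tau_le1 N j y y4.
have := ler_pM (normr_ge0 _) (normr_ge0 _) h2 hf; rewrite mul1r => h3.
apply: le_trans (lerD h3 IH) _.
rewrite -mulrDl ler_pM2r ?invr_gt0 ?ltr0n //.
by rewrite -!natr1; have := ler0n R j; move: (j%:R : R) => x x0; nra.
Qed.

Definition alt_diff J s y : R :=
  \sum_(j < J) (-1) ^+ j.+1 * ((y + j.+1%:R) ^- s - (- y + j.+1%:R) ^- s).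

Definition trunc_err a N J y : R :=
  \sum_(n < N) (-1) ^+ a * e n a / n.+1%:R ^+ 2 *
    (y / 2%:R * (-1) ^+ J * (rprod n.+1 (y + J.+1%:R) - rprod n.+1 (- y + J.+1%:R))).

(** The near end of the sum started at -y is [rprod n.+1 (1 - y)], equal to [rprod n.+1 y]. The two
    near ends thus form the difference in [rprod_diff], and the far ends form the correction. *)
Lemma recip_sprod n J y : y != 0 -> `|y| <= 4^-1 ->
  (n.+1%:R * sprod n.+1 y)^-1 = n.+1%:R ^- 2 * (y *
     (\sum_(j < J) (-1) ^+ j.+1 * ((sprod n.+1 (y + j.+1%:R))^-1 - (sprod n.+1 (- y + j.+1%:R))^-1))
   - y / 2%:R * (-1) ^+ J * (rprod n.+1 (y + J.+1%:R) - rprod n.+1 (- y + J.+1%:R))).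
Proof.
move=> y0 y4; have y0' : - y != 0 by rewrite oppr_eq0.
have y4' : `|- y| <= 4^-1 by rewrite normrN.
have two0 : 2%:R != 0 :> R by rewrite pnatr_eq0.
have k0 k : (0 < k <= n.+1)%N -> k%:R != 0 :> R by case/andP; rewrite pnatr_eq0 -lt0n.
have Ep := @sum_alt_sprodV R n.+1 J y two0 k0 (fun k j _ _ => avoid_nat k j y0 y4).
have En := @sum_alt_sprodV R n.+1 J (- y) two0 k0 (fun k j _ _ => avoid_nat k j y0' y4').
have := @rprod_diff R n.+1 y k0; have := @avoid_nat y _ 0 y0 y4; rewrite addr0.
move=> h /(_ (fun k _ => h k)); rewrite -(rprod1B n.+1 y) addrC [1 - y]addrC => E.
have S0 : sprod n.+1 y != 0 by apply: sprod_neq0.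
have -> : (n.+1%:R * sprod n.+1 y)^-1 = n.+1%:R ^- 2 * 2^-1 * (n.+1%:R *+ 2 / sprod n.+1 y).
  by have := k0 n.+1; rewrite leqnn => /(_ isT); move: (n.+1%:R : R) => c c0; field; rewrite S0 c0.
rewrite -E; under eq_bigr => j _ do rewrite mulrBr.
by rewrite sumrB Ep En; field.
Qed.

(** The quotients of [sprod] at y and y + j become [tau] by [tauE]; the boundary terms of [sum_wz]
    make up [alt_diff], and the far ends make up [trunc_err]. *)
Lemma idx_poly_trunc a N J y : y != 0 -> `|y| <= 4^-1 ->
  idx_poly a N y N =
  \sum_(j < J) (tau N j.+1 y * (y + j.+1%:R) * tailsum a N (y + j.+1%:R)
     + tau N j.+1 (- y) * (- y + j.+1%:R) * tailsum a N (- y + j.+1%:R))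
  - y * sprod N y * alt_diff J a.*2.+2 y - sprod N y * trunc_err a N J y.
Proof.
move=> y0 y4; have y0' : - y != 0 by rewrite oppr_eq0.
have y4' : `|- y| <= 4^-1 by rewrite normrN.
have k0 k : (0 < k <= N)%N -> k%:R != 0 :> R by case/andP; rewrite pnatr_eq0 -lt0n.
rewrite idx_polyE //; last first.
  by move=> k _; have := @avoid_nat y k 0 y0 y4; rewrite addr0.
have -> : \sum_(n < N) (-1) ^+ a * e n a / (n.+1%:R * sprod n.+1 y) =
   y * (\sum_(j < J) (-1) ^+ j.+1 * (
     \sum_(n < N) (-1) ^+ a * e n a / (n.+1%:R ^+ 2 * sprod n.+1 (y + j.+1%:R))
     - \sum_(n < N) (-1) ^+ a * e n a / (n.+1%:R ^+ 2 * sprod n.+1 (- y + j.+1%:R))))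
   - trunc_err a N J y.
  rewrite /trunc_err; under [in RHS]eq_bigr => j _ do rewrite -sumrB mulr_sumr.
  rewrite exchange_big mulr_sumr -sumrB; apply: eq_bigr => n _ /=.
  rewrite (recip_sprod n J) // mulrBr mulrBr; congr (_ - _); last by rewrite mulrA.
  rewrite [X in _ * X = _]mulrCA [LHS]mulrCA; congr (y * _); rewrite !mulr_sumr.
  by apply: eq_bigr => j _; rewrite !invfM; ring.
rewrite mulrBr; congr (_ - _); rewrite mulrCA mulrA.
rewrite !mulr_sumr -sumrB; apply: eq_bigr => j _.
rewrite !sum_wz //; try by move=> k _; apply: avoid_nat.
rewrite -!tauE // sprodN.
move: (sprod N _)^-1 (sprod N _)^-1 (_ ^- _) (_ ^- _) => u v w x; ring.
Qed.

End FiniteIdentity.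

(** * Error estimates uniform in N and y *)

Section Estimates.
Local Open Scope classical_set_scope.
Variable R : realType.
Implicit Types (n N J a : nat) (y z : R).
Local Notation e := (fun n i => e2 (nats R n) i).

Lemma psum2_le2 N : psum (nats R N) 2 <= 2.
Proof.
suff H : psum (nats R N.+1) 2 <= 2 - N.+1%:R^-1.
  apply: le_trans (_ : psum (nats R N.+1) 2 <= 2); last by apply: le_trans H _; rewrite gerBl.
  by rewrite psum_natsS lerDl invr_ge0 exprn_ge0.
elim: N => [|N IH]; first by rewrite psum_natsS /psum big_nil add0r expr1n invr1; lra.
rewrite psum_natsS; apply: le_trans (lerD IH (lexx _)) _.
rewrite -addrA lerD2l -subr_ge0.
have -> : - N.+2%:R^-1 - (- N.+1%:R^-1 + N.+2%:R ^- 2) = (N.+1%:R * N.+2%:R ^+ 2)^-1 :> R.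
  rewrite -(@natr1 R N.+1); have := nat_neq0 R N; have := nat_neq0 R N.+1; rewrite -(@natr1 R N.+1).
  by move: (N.+1%:R : R) => x x0 x1; field; rewrite x0 x1.
by rewrite invr_ge0 mulr_ge0 // exprn_ge0.
Qed.

Lemma zn_cat k l N : zn R (k ++ l) N <= zn R k N * zn R l N.
Proof.
elim/last_ind: l N => [|l b IHl] N; first by rewrite cats0 zn_nil mulr1.
elim: N => [|N IHN]; first by rewrite -rcons_cat !zn_rcons0 mulr0.
rewrite -rcons_cat !zn_rconsS rcons_cat mulrDr.
have w0 : 0 <= N.+1%:R ^- b :> R by rewrite invr_ge0 exprn_ge0.
have mono := @zn_nondecreasing R k N N.+1 (leqnSn N).
apply: lerD; first by apply: le_trans IHN _; rewrite ler_wpM2r // zn_ge0.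
rewrite [leRHS]mulrCA ler_wpM2l //; apply: le_trans (IHl N) _.
by rewrite ler_wpM2r // zn_ge0.
Qed.

Lemma e2_ge0 N i : 0 <= e N i. Proof. exact: zn_ge0. Qed.

Lemma e2_le N i : e N i <= 2 ^+ i.
Proof.
elim: i => [|i IH]; first by rewrite e2_0.
apply: le_trans (@zn_cat [:: 2%N] (nseq i 2%N) N) _; rewrite exprS.
by apply: ler_pM => //; rewrite ?zn_ge0 // -psum_zn psum2_le2.
Qed.

(** The last entry 2 is grouped with the 1 into an admissible index; each remaining entry 2 costs a
    factor 2, a growth that |y| <= 1/4 absorbs. *)
Lemma idx_le a : exists2 C : R, 0 <= C & forall N b, ns (nats R N) (idx a b.+1) <= C * 2 ^+ b.
Proof.
have [|C C0 HC] := @zn_bound R (rcons (idx a 0) 2%N).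
  by rewrite /admissible /is_index last_rcons all_rcons /= all_cat all_nseq /= orbT.
exists C => // N b; have -> : idx a b.+1 = rcons (idx a 0) 2%N ++ nseq b 2%N.
  by rewrite /idx cat_rcons -catA.
apply: le_trans (zn_cat _ _ _) _; apply: ler_pM; rewrite ?zn_ge0 //.
exact: e2_le.
Qed.

Lemma shift_ge y j : `|y| <= 4^-1 -> j.+1%:R / 2 <= y + j.+1%:R.
Proof. by rewrite ler_norml -(@natr1 R j) => /andP[y1 y2]; have := ler0n R j; lra. Qed.

Lemma shift_expV_le y j s : `|y| <= 4^-1 -> 0 <= (y + j.+1%:R) ^- s <= 2 ^+ s / j.+1%:R ^+ s.
Proof.
move=> y4; have h := shift_ge j y4.
have p : 0 < j.+1%:R / 2 :> R by rewrite divr_gt0 ?ltr0n.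
have p' : 0 < y + j.+1%:R by apply: lt_le_trans h.
rewrite invr_ge0 exprn_ge0 ?(ltW p') //=.
rewrite -[leRHS]invrK invf_div -expr_div_n lef_pV2 ?posrE ?exprn_gt0 //.
by apply: lerXn2r => //; rewrite nnegrE ltW.
Qed.

(** The reason for 2N shifts: near z = 2N + 1 every k <= N satisfies |k - z| >= k, so each factor of
    [rprod] is at most 1 and the first is at most 1/N. *)
Lemma rprod_le n N y : (0 < n <= N)%N -> `|y| <= 4^-1 -> `|rprod n (y + N.*2.+1%:R)| <= N%:R^-1.
Proof.
case: n => // n /= nN; rewrite ler_norml => /andP[y1 y2].
have N1 : 1 <= N%:R :> R by rewrite ler1n; lia.
have EN : N.*2.+1%:R = 2 * N%:R + 1 :> R by rewrite -natr1 -muln2 natrM mulrC.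
rewrite /rprod big_ord_recl -[nat_of_ord ord0]/0%N mulr0n add0r normrM normf_div; apply: le_trans (_ : N%:R^-1 * 1 <= _); last by rewrite mulr1.
apply: ler_pM => //.
  rewrite expr1n normr1 div1r lef_pV2 ?posrE; last 2 first.
  - by rewrite normr_gt0 EN mulf_neq0 //; apply/eqP; lra.
  - by rewrite ltr0n; lia.
  rewrite EN normrM ler0_norm ?ger0_norm; [|lra|lra].
  by nra.
rewrite normr_prod; apply: prodr_ile1 => i _; rewrite normr_ge0 /=.
have iN : (bump 0 i).+1%:R <= N%:R :> R by rewrite ler_nat /bump; have := ltn_ord i; lia.
have i0 := ler0n R (bump 0 i); rewrite -natr1 in iN *; move: (_%:R : R) iN i0 => x iN i0.
rewrite normf_div EN ler_pdivrMr.
  rewrite mul1r normrX expr2 normrM (@ler0_norm _ (_ - _)); last by lra.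
  by rewrite !ger0_norm; [apply: ler_pM; lra|lra|lra].
by rewrite normrM mulr_gt0 // normr_gt0; apply/eqP; lra.
Qed.

Lemma trunc_err_le a : exists2 C : R, 0 <= C &
  forall N y, (0 < N)%N -> `|y| <= 4^-1 -> `|trunc_err a N N.*2 y| <= C / N%:R.
Proof.
exists (2 * 2 ^+ a) => [|N y N0 y4]; first by rewrite mulr_ge0 // exprn_ge0.
rewrite /trunc_err; apply: le_trans (ler_norm_sum _ _ _) _.
apply: (@le_trans _ _ (\sum_(n < N) 2 ^+ a / N%:R * n.+1%:R ^- 2)); last first.
  rewrite -mulr_sumr -psum_ord [leRHS](_ : _ = 2 ^+ a / N%:R * 2); last by ring.
  by rewrite ler_wpM2l ?psum2_le2 // divr_ge0 ?exprn_ge0.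
apply: ler_sum => n _.
rewrite !normrM !normrX normrN1 !expr1n normfV normrX !mul1r !mulr1.
rewrite [`|n.+1%:R|]ger0_norm // [`|e n a|]ger0_norm ?e2_ge0 //.
rewrite [leRHS]mulrAC -mulrA -[leRHS]mulrA; apply: ler_pM; rewrite ?e2_ge0 ?e2_le //.
rewrite ler_wpM2l ?invr_ge0 ?exprn_ge0 //.
have r1 : `|rprod n.+1 (y + N.*2.+1%:R)| <= N%:R^-1 by apply: rprod_le; rewrite ?ltn_ord.
have r2 : `|rprod n.+1 (- y + N.*2.+1%:R)| <= N%:R^-1 by apply: rprod_le; rewrite ?normrN ?ltn_ord.
have r3 := ler_normB (rprod n.+1 (y + N.*2.+1%:R)) (rprod n.+1 (- y + N.*2.+1%:R)).
have -> : `|2^-1| = 2^-1 :> R by rewrite ger0_norm.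
have N0' : 0 <= N%:R^-1 :> R by rewrite invr_ge0.
move: y4; have := normr_ge0 y; have := normr_ge0 (rprod n.+1 (y + N.*2.+1%:R) - rprod n.+1 (- y + N.*2.+1%:R)).
move: r1 r2 r3; set q := `|_ - _|; move: `|y| `|rprod _ _| `|rprod _ _| => x u v r1 r2 r3 q0 x0 x4.
have q1 : q <= 2 * N%:R^-1 by lra.
by apply: le_trans (_ : 4^-1 * 2^-1 * (2 * N%:R^-1) <= _); [apply: ler_pM => //; [rewrite divr_ge0|lra]|lra].
Qed.

Lemma sprod_01 N y : `|y| <= 4^-1 -> 0 <= sprod N y <= 1.
Proof.
rewrite ler_norml => /andP[y1 y2].
have h k : 0 <= 1 - y ^+ 2 / k.+1%:R ^+ 2 <= 1.
  have q0 : 0 <= y ^+ 2 / k.+1%:R ^+ 2 by rewrite divr_ge0 ?sqr_ge0.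
  have q1 : y ^+ 2 / k.+1%:R ^+ 2 <= 1.
    rewrite ler_pdivrMr ?exprn_gt0 // mul1r; apply: (@le_trans _ _ 1); first by nra.
    by rewrite exprn_ege1 // ler1n.
  by rewrite subr_ge0 q1 gerBl q0.
rewrite /sprod prodr_ge0 => [|k _]; last by have /andP[] := h k.
by apply: prodr_ile1 => k _; apply: h.
Qed.

Definition recip_sum J s z : R := \sum_(j < J) (z + j.+1%:R) ^- s.

Definition tau_sum N J s z : R := \sum_(j < J) tau N j.+1 z * (z + j.+1%:R) ^- s.

(** [tau] differs from 1 by at most j (j + 1) / N, so for s >= 3 a summand contributes an error of
    order 1 / (j N). For s = 1 this bound would not tend to 0. *)
Lemma tau_sum_sub N s z : (0 < N)%N -> (2 < s)%N -> `|z| <= 4^-1 ->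
  `|tau_sum N N.*2 s z - recip_sum N.*2 s z| <= 2 ^+ s.+1 * (harm R N.*2 / N%:R).
Proof.
move=> N0 s3 z4; rewrite /tau_sum /recip_sum -sumrB /harm psum_ord.
apply: le_trans (ler_norm_sum _ _ _) _; rewrite mulr_suml mulr_sumr; apply: ler_sum => j _.
rewrite -{2}[_ ^- s]mul1r -mulrBl normrM.
have /andP[w0 w1] := shift_expV_le j s z4.
rewrite [`|_ ^- s|]ger0_norm //.
have t := @tau_sub1 R N j.+1 z N0 z4.
apply: le_trans (ler_pM (normr_ge0 _) w0 t w1) _.
have j0 : 0 < j.+1%:R :> R by rewrite ltr0n.
have j1 : 1 <= j.+1%:R :> R by rewrite ler1n.
rewrite -(@natr1 R j.+1); move: (j.+1%:R : R) j0 j1 => x x0 x1.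
rewrite expr1 exprS [leLHS](_ : _ = 2 ^+ s / N%:R * (x * (x + 1) / x ^+ s)); last by ring.
rewrite [leRHS](_ : _ = 2 ^+ s / N%:R * (2 / x)); last by ring.
rewrite ler_wpM2l ?divr_ge0 ?exprn_ge0 //.
have -> : (s = 3 + (s - 3))%N by lia.
rewrite exprD ler_pdivrMr ?mulr_gt0 ?exprn_gt0 //.
have q1 : 1 <= x ^+ (s - 3) by rewrite exprn_ege1.
move: (x ^+ (s - 3)) q1 => q q1.
have -> : 2 / x * (x ^+ 3 * q) = 2 * x ^+ 2 * q by field; rewrite gt_eqF.
nra.
Qed.

End Estimates.

Section Approximation.
Local Open Scope classical_set_scope.
Variable R : realType.
Implicit Types (n N J a : nat) (y z : R).
Local Notation e := (fun n i => e2 (nats R n) i).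

(** The subtracted part is the term i = a of [tailsum], the only one left with exponent 1 after
    multiplication by z + j; the others have exponent at least 3. *)
Lemma tau_tailsum a N J z : z != 0 -> `|z| <= 4^-1 ->
  \sum_(j < J) tau N j.+1 z * (z + j.+1%:R) * tailsum a N (z + j.+1%:R)
  - (-1) ^+ a * e N a * \sum_(j < J) tau N j.+1 z * (z + j.+1%:R) * tailsum 0 N (z + j.+1%:R) =
  \sum_(i < a) (-1) ^+ i * e N i * tau_sum N J (a - i).*2.+1 z.
Proof.
move=> z0 z4; under [RHS]eq_bigr => i _ do rewrite mulr_sumr.
rewrite exchange_big mulr_sumr -sumrB; apply: eq_bigr => j _ /=.
have : z + j.+1%:R != 0.
  by have := avoid_nat 0 j.+1 z0 z4; rewrite !add0r mulf_eq0 negb_or => /andP[].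
move: (z + j.+1%:R) (tau N j.+1 z) => u t u0.
rewrite /tailsum big_ord_recr big_ord_recl big_ord0 /= !subnn double0 e2_0 mulr1 expr0 mul1r addr0.
transitivity (t * u * \sum_(i < a) (-1) ^+ i * e N i * u ^- (a - i).*2.+2); first by ring.
rewrite mulr_sumr; apply: eq_bigr => i _.
by rewrite [u ^+ (_.+2)]exprS invfM; move: (_ ^- _.+1) => v; field.
Qed.

(* Subtracting the multiple of [idx_poly 0] removes the terms of
   [idx_poly a] that diverge as [N] grows. *)
Definition idx_defect a N y : R := idx_poly a N y N - (-1) ^+ a * e N a * idx_poly 0 N y N.

Definition defect_main a N y : R :=
  \sum_(i < a) (-1) ^+ i * e N i *
    (recip_sum N.*2 (a - i).*2.+1 y + recip_sum N.*2 (a - i).*2.+1 (- y))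
  - y * sprod N y * (alt_diff N.*2 a.*2.+2 y - (-1) ^+ a * e N a * alt_diff N.*2 2 y).

Lemma idx_defectE a N y : y != 0 -> `|y| <= 4^-1 ->
  idx_defect a N y - defect_main a N y =
  \sum_(i < a) (-1) ^+ i * e N i *
     ((tau_sum N N.*2 (a - i).*2.+1 y - recip_sum N.*2 (a - i).*2.+1 y)
      + (tau_sum N N.*2 (a - i).*2.+1 (- y) - recip_sum N.*2 (a - i).*2.+1 (- y)))
  - sprod N y * (trunc_err a N N.*2 y - (-1) ^+ a * e N a * trunc_err 0 N N.*2 y).
Proof.
move=> y0 y4; have y0' : - y != 0 by rewrite oppr_eq0.
have y4' : `|- y| <= 4^-1 by rewrite normrN.
rewrite /idx_defect !(@idx_poly_trunc R _ N N.*2) // !big_split /=.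
have E1 := tau_tailsum a N N.*2 y0 y4; have E2 := tau_tailsum a N N.*2 y0' y4'.
rewrite /defect_main.
have -> : \sum_(i < a) (-1) ^+ i * e N i *
     ((tau_sum N N.*2 (a - i).*2.+1 y - recip_sum N.*2 (a - i).*2.+1 y)
      + (tau_sum N N.*2 (a - i).*2.+1 (- y) - recip_sum N.*2 (a - i).*2.+1 (- y))) =
   \sum_(i < a) (-1) ^+ i * e N i * tau_sum N N.*2 (a - i).*2.+1 y
   + \sum_(i < a) (-1) ^+ i * e N i * tau_sum N N.*2 (a - i).*2.+1 (- y)
   - \sum_(i < a) (-1) ^+ i * e N i *
    (recip_sum N.*2 (a - i).*2.+1 y + recip_sum N.*2 (a - i).*2.+1 (- y)).
  by rewrite -big_split -sumrB; apply: eq_bigr => i _ /=; ring.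
by rewrite -E1 -E2 double0; ring.
Qed.

Lemma defect_approx a : exists2 C : R, 0 <= C & forall N y, (0 < N)%N -> y != 0 -> `|y| <= 4^-1 ->
  `|idx_defect a N y - defect_main a N y| <= C * ((harm R N.*2 + 1) / N%:R).
Proof.
have [C1 C10 H1] := trunc_err_le R a; have [C2 C20 H2] := trunc_err_le R 0.
exists (\sum_(i < a) 2 ^+ i * (2 * 2 ^+ (a - i).*2.+2) + (C1 + 2 ^+ a * C2)).
  apply: addr_ge0; last by rewrite addr_ge0 // mulr_ge0 ?exprn_ge0.
  by apply: sumr_ge0 => i _; do ?[exact: exprn_ge0 | apply: mulr_ge0].
move=> N y N0 y0 y4; have y4' : `|- y| <= 4^-1 by rewrite normrN.
have h0 : 0 <= harm R N.*2 by rewrite harmE zn_ge0.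
have w0 : 0 <= N%:R^-1 :> R by rewrite invr_ge0.
have ne i : `|(-1) ^+ i * e N i| <= 2 ^+ i.
  by rewrite normrM normrX normrN1 expr1n mul1r ger0_norm ?e2_ge0 ?e2_le.
rewrite idx_defectE // mulrDl; apply: le_trans (ler_normB _ _) _; apply: lerD.
  rewrite mulr_suml; apply: le_trans (ler_norm_sum _ _ _) _; apply: ler_sum => i _.
  rewrite normrM -mulrA; apply: ler_pM => //.
  apply: le_trans (ler_normD _ _) _.
  have s3 : (2 < (a - i).*2.+1)%N by have := ltn_ord i; lia.
  apply: le_trans (lerD (tau_sum_sub N0 s3 y4) (tau_sum_sub N0 s3 y4')) _.
  rewrite [leLHS](_ : _ = 2 * 2 ^+ (a - i).*2.+2 * (harm R N.*2 / N%:R)); last by ring.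
  apply: ler_wpM2l; first by apply: mulr_ge0; last exact: exprn_ge0.
  by rewrite ler_wpM2r // lerDl.
rewrite normrM; have /andP[s0 s1] := sprod_01 N y4.
rewrite (ger0_norm s0); apply: le_trans (_ : 1 * (C1 / N%:R + 2 ^+ a * (C2 / N%:R)) <= _).
  apply: ler_pM => //; apply: le_trans (ler_normB _ _) _; apply: lerD; first exact: H1.
  by rewrite normrM; apply: ler_pM => //; apply: H2.
rewrite mul1r [leLHS](_ : _ = (C1 + 2 ^+ a * C2) * (1 / N%:R)); last by ring.
rewrite ler_wpM2l ?addr_ge0 ?mulr_ge0 ?exprn_ge0 //.
by rewrite ler_wpM2r // lerDr.
Qed.

Lemma harm_double_sublinear : (harm R n.*2 + 1) / n%:R @[n --> \oo] --> (0 : R).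
Proof.
have H0 N : 0 <= harm R N by rewrite harmE zn_ge0.
apply: (@squeeze_cvgr _ _ _ _ (fun=> 0) (fun n => 2 * (harm R n / n.+1%:R) + 4 * n.+1%:R^-1)).
- near=> N.
  have N0 : (0 < N)%N by near: N; exists 1%N.
  have N1 : 0 < N%:R :> R by rewrite ltr0n.
  rewrite divr_ge0 ?addr_ge0 //=.
  have := @harm_diff R N.*2 N; have -> : (N <= N.*2)%N by lia.
  have -> : (N.*2 - N = N)%N by lia.
  move=> /(_ isT)/andP[_ h].
  have h1 : N%:R / N.+1%:R <= 1 :> R by rewrite ler_pdivrMr ?ltr0n // mul1r ler_nat.
  have h2 : harm R N.*2 <= harm R N + 1 by rewrite addrC -lerBlDr; apply: le_trans h h1.
  rewrite ler_pdivrMr //.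
  apply: le_trans (lerD h2 (lexx 1)) _.
  have := H0 N; have : 1 <= N%:R :> R by rewrite ler1n.
  rewrite -(@natr1 R N); move: (N%:R : R) (harm R N) => x u x1 u0.
  have x2 : 0 < x + 1 by lra.
  have -> : (2 * (u / (x + 1)) + 4 * (x + 1)^-1) * x = (2 * u + 4) * x / (x + 1).
    by field; rewrite gt_eqF.
  by rewrite ler_pdivlMr //; nra.
- exact: cvg_cst.
- rewrite -[X in _ --> X](_ : 2 * 0 + 4 * 0 = 0 :> R); last by rewrite !mulr0 addr0.
  apply: cvgD; first by apply: cvgMr; apply: harm_sublinear.
  by apply: cvgMr; apply: cvg_harmonic.
Unshelve. all: by end_near.
Qed.

End Approximation.

(** * Expansions in y with constants independent of N *)

Section Expansions.
Local Open Scope classical_set_scope.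
Variable R : realType.
Implicit Types (D N b s : nat) (x y : R) (f g : nat -> R -> R) (c d : nat -> nat -> R).

(** Stands in for a family of power series with a common radius: since [C] is the same for all [N],
    coefficients can be compared after [N] tends to infinity. *)
Definition apx D f c : Prop := exists C : R,
  [/\ 0 <= C, (forall N b, (b < D)%N -> `|c N b| <= C) &
      (forall N y, `|y| <= 4^-1 -> `|f N y - \sum_(b < D) c N b * y ^+ b| <= C * `|y| ^+ D)].

Lemma apx_ext D f c c' : (forall N b, (b < D)%N -> c N b = c' N b) -> apx D f c -> apx D f c'.
Proof.
move=> E [C [C0 hc hf]]; exists C; split=> // [N b bD|N y y4]; first by rewrite -E // hc.
by under eq_bigr => b _ do rewrite -E //; apply: hf.
Qed.

Lemma apx_ext_fun D f f' c : (forall N y, `|y| <= 4^-1 -> f N y = f' N y) -> apx D f c -> apx D f' c.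
Proof. by move=> E [C [C0 hc hf]]; exists C; split=> // N y y4; rewrite -E // hf. Qed.

Lemma apx0 D : apx D (fun _ _ => 0) (fun _ _ => 0).
Proof.
exists 0; split=> // [N b _|N y _]; first by rewrite normr0.
by rewrite big1 ?subrr ?normr0 ?mul0r // => b _; rewrite mul0r.
Qed.

Lemma apxD D f g c d : apx D f c -> apx D g d ->
  apx D (fun N y => f N y + g N y) (fun N b => c N b + d N b).
Proof.
move=> [C [C0 hc hf]] [C' [C'0 hd hg]]; exists (C + C'); split=> [|N b bD|N y y4].
- exact: addr_ge0.
- by apply: le_trans (ler_normD _ _) _; rewrite lerD ?hc ?hd.
under eq_bigr => b _ do rewrite mulrDl.
rewrite big_split mulrDl /= opprD addrACA; apply: le_trans (ler_normD _ _) _.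
by rewrite lerD ?hf ?hg.
Qed.

Lemma apxZ D f c (k : nat -> R) (K : R) : (forall N, `|k N| <= K) -> apx D f c ->
  apx D (fun N y => k N * f N y) (fun N b => k N * c N b).
Proof.
move=> hk [C [C0 hc hf]]; exists (K * C); split=> [|N b bD|N y y4].
- by rewrite mulr_ge0 // (le_trans (normr_ge0 _) (hk 0%N)).
- by rewrite normrM ler_pM ?hc.
under eq_bigr => b _ do rewrite -mulrA.
by rewrite -mulr_sumr -mulrBr normrM -mulrA ler_pM ?hf.
Qed.

Lemma apxB D f g c d : apx D f c -> apx D g d ->
  apx D (fun N y => f N y - g N y) (fun N b => c N b - d N b).
Proof.
move=> hf hg; have h := @apxZ D g d (fun=> -1) 1 _ hg.
apply: apx_ext (apx_ext_fun _ (apxD hf (h _))) => /= [N b _|N y _|N].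
- by rewrite mulN1r.
- by rewrite mulN1r.
- by rewrite normrN1.
Qed.

Lemma apx_sum D n (f : 'I_n -> nat -> R -> R) (c : 'I_n -> nat -> nat -> R) : (forall i, apx D (f i) (c i)) ->
  apx D (fun N y => \sum_(i < n) f i N y) (fun N b => \sum_(i < n) c i N b).
Proof.
elim: n f c => [|n IH] f c h.
  by apply: apx_ext (apx_ext_fun _ (apx0 D)) => [N b _|N y _]; rewrite big_ord0.
have h1 := IH (fun i => f (lift ord0 i)) (fun i => c (lift ord0 i)) (fun i => h _).
by apply: apx_ext (apx_ext_fun _ (apxD (h ord0) h1)) => [N b _|N y _]; rewrite big_ord_recl.
Qed.

Lemma apx_opp D f c : apx D f c -> apx D (fun N y => f N (- y)) (fun N b => (-1) ^+ b * c N b).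
Proof.
move=> [C [C0 hc hf]]; exists C; split=> // [N b bD|N y y4].
  by rewrite normrM normrX normrN1 expr1n mul1r hc.
have := hf N (- y); rewrite !normrN => /(_ y4); congr (`|_ - _| <= _).
by apply: eq_bigr => b _; rewrite (exprNn y); ring.
Qed.

Lemma apx_shift1 D f c : apx D f c ->
  apx D (fun N y => y * f N y) (fun N b => if b is b'.+1 then c N b' else 0).
Proof.
move=> [C [C0 hc hf]]; exists (2 * C); split=> [|N [|b] bD|N y y4].
- exact: mulr_ge0.
- by rewrite normr0 mulr_ge0.
- by apply: le_trans (hc N b _) _; [exact: ltnW | lra].
have y0 := normr_ge0 y.
case: D hc hf => [|D] hc hf.
  have := hf N y y4; rewrite !big_ord0 !subr0 !expr0 !mulr1 normrM => h.
  by have := normr_ge0 (f N y); move: `|f N y| `|y| h y4 y0 => u v *; nra.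
rewrite big_ord_recl /= mul0r add0r.
have -> : y * f N y - \sum_(i < D) c N i * y ^+ bump 0 i =
   y * (f N y - \sum_(b < D.+1) c N b * y ^+ b) + c N D * y ^+ D.+1.
  rewrite big_ord_recr mulrBr mulrDr mulr_sumr /= exprS.
  have -> : \sum_(i < D) y * (c N i * y ^+ i) = \sum_(i < D) c N i * y ^+ bump 0 i.
    by apply: eq_bigr => i _; rewrite /bump add1n exprS; ring.
  by ring.
apply: le_trans (ler_normD _ _) _; rewrite !normrM normrX.
have p0 : 0 <= `|y| ^+ D.+1 by rewrite exprn_ge0.
have -> : 2 * C * `|y| ^+ D.+1 = C * `|y| ^+ D.+1 + C * `|y| ^+ D.+1 by ring.
apply: lerD; last by rewrite ler_wpM2r // hc.
have h := hf N y y4; apply: le_trans (_ : 1 * (C * `|y| ^+ D.+1) <= _); last by rewrite mul1r.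
by apply: ler_pM => //; lra.
Qed.

Lemma apx_shift D f c k : apx D f c ->
  apx D (fun N y => y ^+ k * f N y) (fun N b => if (k <= b)%N then c N (b - k)%N else 0).
Proof.
move=> h; elim: k => [|k IH].
  by apply: apx_ext (apx_ext_fun _ h) => [N b _|N y _]; rewrite ?subn0 ?mul1r.
apply: apx_ext (apx_ext_fun _ (apx_shift1 IH)) => [N [|b] _|N y _] //.
by rewrite exprS mulrA.
Qed.

Lemma apx_le D f c : apx D f c -> exists2 C : R, 0 <= C & forall N y, `|y| <= 4^-1 -> `|f N y| <= C.
Proof.
move=> [C [C0 hc hf]]; exists (C + D%:R * C); first by rewrite addr_ge0 // mulr_ge0.
move=> N y y4; have y1 k : `|y| ^+ k <= 1 by rewrite exprn_ile1 //; lra.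
rewrite -(subrK (\sum_(b < D) c N b * y ^+ b) (f N y)).
apply: le_trans (ler_normD _ _) _; apply: lerD.
  by apply: le_trans (hf N y y4) _; rewrite ler_piMr.
apply: le_trans (ler_norm_sum _ _ _) _.
apply: le_trans (_ : \sum_(b < D) C <= _); last by rewrite sumr_const card_ord mulr_natl.
by apply: ler_sum => b _; rewrite normrM normrX -[leRHS]mulr1 ler_pM ?hc.
Qed.

Lemma apx_small D f (C : R) : 0 <= C -> (forall N y, `|y| <= 4^-1 -> `|f N y| <= C * `|y| ^+ D) ->
  apx D f (fun _ _ => 0).
Proof.
move=> C0 h; exists C; split=> // [N b _|N y y4]; first by rewrite normr0.
by rewrite big1 ?subr0 ?h // => b _; rewrite mul0r.
Qed.

(** Letting y tend to 0 kills the constant term; then divide by y and repeat. *)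
Lemma poly_small D (h : nat -> R) (C : R) :
  (forall y, 0 < y <= 4^-1 -> `|\sum_(b < D) h b * y ^+ b| <= C * y ^+ D) ->
  forall b, (b < D)%N -> h b = 0.
Proof.
elim: D h => // D IH h hs; have C0 : 0 <= C.
  have := hs 4^-1; rewrite lexx andbT => /(_ ltac:(lra)) H.
  by have := le_trans (normr_ge0 _) H; rewrite pmulr_lge0 // exprn_gt0 //; lra.
have h0 : h 0%N = 0.
  pose K := C + \sum_(b < D) `|h b.+1|.
  have K0 : 0 <= K by rewrite addr_ge0 // sumr_ge0.
  have hK y : 0 < y <= 4^-1 -> `|h 0%N| <= K * y.
    move=> /andP[y0 y4]; have y1 k : 0 <= y ^+ k <= 1 by rewrite exprn_ge0 ?exprn_ile1 //; lra.
    have := hs y; rewrite y0 y4 => /(_ isT); rewrite big_ord_recl expr0 mulr1.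
    set S := \sum_(i < D) _ => H.
    have -> : h 0%N = (h 0%N + S) - S by ring.
    apply: le_trans (ler_normB _ _) _; rewrite mulrDl; apply: lerD.
      apply: le_trans H _; rewrite exprS ler_wpM2l // ler_piMr ?(ltW y0) //.
      by have /andP[] := y1 D.
    apply: le_trans (ler_norm_sum _ _ _) _; rewrite mulr_suml; apply: ler_sum => b _.
    rewrite /= /bump add1n normrM ler_wpM2l // normrX (ger0_norm (ltW y0)) exprS.
    by rewrite ler_piMr ?(ltW y0) //; have /andP[] := y1 b.
  apply/eqP; rewrite -normr_le0; apply/ler_addgt0Pr => eps e0; rewrite add0r.
  pose y := Num.min 4^-1 (eps / (K + 1)).
  have K1 : 0 < K + 1 by lra.
  have ep : 0 < eps / (K + 1) by rewrite divr_gt0.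
  have y0 : 0 < y <= 4^-1 by rewrite /y lt_min ep ge_min lexx andbT /=; lra.
  apply: le_trans (hK y y0) _.
  apply: le_trans (_ : (K + 1) * (eps / (K + 1)) <= _); last by rewrite mulrC divfK // gt_eqF.
  by have /andP[/ltW ? _] := y0; apply: ler_pM => //; [lra | rewrite /y ge_min lexx orbT].
case=> // b; rewrite ltnS => bD; apply: (IH (fun b => h b.+1)) => // y /andP[y0 y4].
have := hs y; rewrite y0 y4 => /(_ isT); rewrite big_ord_recl h0 mul0r add0r.
have -> : \sum_(i < D) h (bump 0 i) * y ^+ bump 0 i = y * \sum_(i < D) h i.+1 * y ^+ i.
  by rewrite mulr_sumr; apply: eq_bigr => i _; rewrite /bump add1n exprS mulrCA.
by rewrite normrM (ger0_norm (ltW y0)) exprS mulrCA ler_pM2l.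
Qed.

(** Pointwise convergence of f - g to 0 suffices: the uniform errors bound the difference of the
    limit polynomials by a multiple of y^D, and [poly_small] applies. *)
Lemma apx_unique D f g c d (l m : nat -> R) :
  apx D f c -> apx D g d ->
  (forall y, 0 < y <= 4^-1 -> (f n y - g n y) @[n --> \oo] --> (0 : R)) ->
  (forall b, (b < D)%N -> c n b @[n --> \oo] --> l b) ->
  (forall b, (b < D)%N -> d n b @[n --> \oo] --> m b) ->
  forall b, (b < D)%N -> l b = m b.
Proof.
move=> [C [C0 hc hf]] [C' [C'0 hd hg]] hfg hl hm.
suff H b : (b < D)%N -> l b - m b = 0 by move=> b /H /eqP; rewrite subr_eq0 => /eqP.
apply: (@poly_small D (fun b => l b - m b) (C + C')) => y /andP[y0 y4].
have L1 : `|\sum_(b < D) (c n b - d n b) * y ^+ b| @[n --> \oo] -->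
   `|\sum_(b < D) (l b - m b) * y ^+ b|.
  apply: cvg_norm; apply: cvgn_sum => i _ _; apply: cvgMl.
  by apply: cvgB; [apply: hl | apply: hm].
have L2 : ((C + C') * y ^+ D + `|f n y - g n y|) @[n --> \oo] --> (C + C') * y ^+ D + `|0 : R|.
  by apply: cvgD; [exact: cvg_cst | apply: cvg_norm; apply: hfg; rewrite y0 y4].
rewrite normr0 addr0 in L2; apply: ler_cvg_to L1 L2 _; apply: nearW => n.
have yn : `|y| <= 4^-1 by rewrite ger0_norm ?(ltW y0).
have := hf n y yn; have := hg n y yn; rewrite (ger0_norm (ltW y0)) => h1 h2.
under eq_bigr => i _ do rewrite mulrBl.
rewrite sumrB; set S := \sum_(b < D) _ in h2 *; set S' := \sum_(b < D) _ in h1 *.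
have -> : S - S' = (g n y - S') - (f n y - S) + (f n y - g n y) by ring.
apply: le_trans (ler_normD _ _) _; rewrite lerD2r mulrDl.
by apply: le_trans (ler_normB _ _) _; rewrite addrC lerD.
Qed.

End Expansions.

Section Coefficients.
Local Open Scope classical_set_scope.
Variable R : realType.
Implicit Types (D M N J a b s : nat) (x y : R) (f g : nat -> R -> R) (c d : nat -> nat -> R).
Local Notation e := (fun n i => e2 (nats R n) i).

(** The binomial coefficient of -s over b; at s = b = 0 the truncated predecessor still gives 1. *)
Definition bincoef s b : R := (-1) ^+ b * 'C((s + b).-1, b)%:R.

Lemma bincoef0 s : bincoef s 0 = 1.
Proof. by rewrite /bincoef bin0 mulr1. Qed.

Lemma bincoefS s b : bincoef s.+1 b.+1 + bincoef s.+1 b = bincoef s b.+1.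
Proof.
rewrite /bincoef !addSn !addnS /= exprS addnC binS natrD; ring.
Qed.

(** Induction on s: by [bincoefS], dividing by 1 + x turns the coefficients for s into those for s +
    1 and leaves one term of degree D. *)
Lemma binom_expand s D : exists2 C : R, 0 <= C & forall x, `|x| <= 2^-1 ->
  `|(1 + x) ^- s - \sum_(b < D) bincoef s b * x ^+ b| <= C * `|x| ^+ D.
Proof.
elim: s => [|s [C C0 IH]].
  exists 1 => // x _; case: D => [|D].
    by rewrite big_ord0 subr0 !expr0 invr1 normr1 mulr1.
  rewrite big_ord_recl bincoef0 big1 => [|b _]; last first.
    by rewrite lift0 /bincoef add0n bin_small // mulr0 mul0r.
  by rewrite !expr0 invr1 mulr1 addr0 subrr normr0 mulr_ge0 ?exprn_ge0.
exists (2 * (C + `|bincoef s.+1 D.-1|)); first by rewrite mulr_ge0 // addr_ge0.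
move=> x x2; have := IH x x2; move: (x2); rewrite ler_norml => /andP[x3 x4].
have x0 : 0 < 1 + x by lra.
have v2 : `|(1 + x)^-1| <= 2.
  rewrite ger0_norm ?invr_ge0 ?(ltW x0) // -[leRHS]invrK lef_pV2 ?posrE ?invr_gt0 //; lra.
case: D {IH} => [|D].
  rewrite !big_ord0 !subr0 !expr0 !mulr1 bincoef0 normr1 => h.
  rewrite exprS invfM normrM; apply: ler_pM => //.
  by apply: le_trans h _; rewrite lerDl.
set r := bincoef _ _ => h; rewrite /= in r h *.
have E : (1 + x) ^- s.+1 - \sum_(b < D.+1) bincoef s.+1 b * x ^+ b =
   (1 + x)^-1 * ((1 + x) ^- s - \sum_(b < D.+1) bincoef s b * x ^+ b - r * x ^+ D.+1).
  have -> : \sum_(b < D.+1) bincoef s b * x ^+ b =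
      (1 + x) * \sum_(b < D.+1) bincoef s.+1 b * x ^+ b - r * x ^+ D.+1.
    rewrite mulrDl mul1r big_ord_recl [X in _ = X + _ + _]big_ord_recl !bincoef0.
    rewrite big_ord_recr mulrDr /= mulr_sumr.
    have -> : \sum_(i < D) bincoef s (bump 0 i) * x ^+ bump 0 i =
       \sum_(i < D) bincoef s.+1 (bump 0 i) * x ^+ bump 0 i +
       \sum_(i < D) x * (bincoef s.+1 i * x ^+ i).
      rewrite -big_split; apply: eq_bigr => i _.
      by rewrite /bump add1n -bincoefS /= exprS; ring.
    by rewrite /r exprS; ring.
  by rewrite exprS invfM; move: (_ ^- s) => v; field; rewrite gt_eqF.
rewrite E normrM -mulrA; apply: ler_pM => //.
by apply: le_trans (ler_normB _ _) _; rewrite mulrDl lerD // normrM normrX.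
Qed.

Definition wsum (w : nat -> R) J s y : R := \sum_(j < J) w j * (y + j.+1%:R) ^- s.

Lemma psum_le2 J s : (2 <= s)%N -> psum (nats R J) s <= 2.
Proof.
move=> s2; apply: le_trans (psum2_le2 R J); rewrite !psum_ord; apply: ler_sum => j _.
rewrite lef_pV2 ?posrE ?exprn_gt0 //.
by apply: ler_weXn2l => //; rewrite ler1n.
Qed.

(** Each summand is expanded in y / (j + 1); the condition s >= 2 makes the errors summable
    uniformly in [N]. *)
Lemma apx_wsum (w : nat -> R) D s : (2 <= s)%N -> (forall j, `|w j| <= 1) ->
  apx D (fun N => wsum w N.*2 s)
        (fun N b => bincoef s b * \sum_(j < N.*2) w j * j.+1%:R ^- (s + b)).
Proof.
move=> s2 hw; have [C C0 HC] := binom_expand s D.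
exists (2 * C + \sum_(b < D) 2 * `|bincoef s b|); split=> [|N b bD|N y y4].
- by rewrite addr_ge0 ?mulr_ge0 // sumr_ge0.
- apply: le_trans (_ : 2 * `|bincoef s b| <= _); last first.
    rewrite ler_wpDl ?mulr_ge0 // (bigD1 (Ordinal bD)) //= lerDl.
    by apply: sumr_ge0 => i _; rewrite mulr_ge0.
  rewrite normrM mulrC ler_wpM2r //; apply: le_trans (ler_norm_sum _ _ _) _.
  apply: le_trans (@psum_le2 N.*2 (s + b) _); last by lia.
  rewrite psum_ord; apply: ler_sum => j _; rewrite normrM -[leRHS]mul1r.
  by rewrite ler_pM // ger0_norm // invr_ge0 exprn_ge0.
have -> : wsum w N.*2 s y -
    \sum_(b < D) bincoef s b * (\sum_(j < N.*2) w j * j.+1%:R ^- (s + b)) * y ^+ b =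
  \sum_(j < N.*2) w j * j.+1%:R ^- s *
     ((1 + y / j.+1%:R) ^- s - \sum_(b < D) bincoef s b * (y / j.+1%:R) ^+ b).
  under [X in _ - X]eq_bigr => b _ do rewrite mulr_sumr mulr_suml.
  rewrite exchange_big -sumrB; apply: eq_bigr => j _ /=.
  rewrite mulrBr; congr (_ - _).
    have j0 := nat_neq0 R j.
    rewrite -mulrA -invfM -exprMn; congr (_ * (_ ^+ _)^-1).
    by field.
  rewrite mulr_sumr; apply: eq_bigr => b _.
  by rewrite exprD expr_div_n invfM; ring.
rewrite mulrDl ler_wpDr ?mulr_ge0 ?exprn_ge0 ?sumr_ge0 //.
apply: le_trans (ler_norm_sum _ _ _) _.
apply: le_trans (_ : \sum_(j < N.*2) C * `|y| ^+ D * j.+1%:R ^- s <= _); last first.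
  rewrite -mulr_sumr -psum_ord [leRHS](_ : _ = C * `|y| ^+ D * 2); last by ring.
  by rewrite ler_wpM2l ?psum_le2 // mulr_ge0 ?exprn_ge0.
apply: ler_sum => j _.
have j1 : 1 <= j.+1%:R :> R by rewrite ler1n.
have j0 : 0 < j.+1%:R :> R by rewrite ltr0n.
have yj : `|y / j.+1%:R| <= `|y|.
  by rewrite normrM normfV (ger0_norm (ltW j0)) ler_pdivrMr // ler_peMr.
rewrite !normrM [`|_ ^- s|]ger0_norm ?invr_ge0 ?exprn_ge0 // [leRHS]mulrC.
rewrite -mulrA -[leRHS]mul1r; apply: ler_pM => //.
rewrite ler_wpM2l ?invr_ge0 ?exprn_ge0 //.
apply: le_trans (HC _ _) _; first by apply: le_trans yj _; lra.
by rewrite ler_wpM2l // lerXn2r // nnegrE.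
Qed.

Lemma sum_geometric_half n : \sum_(k < n) 2^-1 ^+ k <= 2 :> R.
Proof.
suff -> : \sum_(k < n) 2^-1 ^+ k = 2 - 2 * 2^-1 ^+ n :> R.
  by rewrite gerBl mulr_ge0 // exprn_ge0.
elim: n => [|n IH]; first by rewrite big_ord0; ring.
by rewrite big_ord_recr /= IH exprS; field.
Qed.

(** Since 2 y^2 <= 1/2, the tail is dominated by a geometric series of ratio 1/2. *)
Lemma even_tail M B (h : nat -> R) (K : R) y : (M <= B)%N -> `|y| <= 4^-1 ->
  (forall i, `|h i| <= K * 2 ^+ i) ->
  `|\sum_(i < B) h i * y ^+ i.*2 - \sum_(i < M) h i * y ^+ i.*2| <=
  (2 * 2 ^+ M * K) * `|y| ^+ M.*2.
Proof.
move=> MB y4 hK; have K0 : 0 <= K by have := le_trans (normr_ge0 _) (hK 0%N); rewrite mulr1.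
rewrite -(subnKC MB); move: (B - M)%N => n {MB B}.
rewrite big_split_ord /= addrAC subrr add0r.
apply: le_trans (ler_norm_sum _ _ _) _.
apply: le_trans (_ : \sum_(k < n) 2 ^+ M * K * `|y| ^+ M.*2 * 2^-1 ^+ k <= _); last first.
  rewrite -mulr_sumr [leRHS](_ : _ = 2 ^+ M * K * `|y| ^+ M.*2 * 2); last by ring.
  by rewrite ler_wpM2l ?sum_geometric_half // !mulr_ge0 ?exprn_ge0.
apply: ler_sum => k _; rewrite normrM normrX doubleD exprD.
have h1 := hK (M + k)%N; rewrite exprD in h1.
apply: le_trans (ler_wpM2r _ h1) _; first by rewrite mulr_ge0 ?exprn_ge0.
have p : `|y| ^+ k.*2 <= 4^-1 ^+ k.
  rewrite -mul2n exprM; apply: lerXn2r; rewrite ?nnegrE ?exprn_ge0 //.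
  by rewrite expr2; have := normr_ge0 y; nra.
rewrite [leLHS](_ : _ = 2 ^+ M * K * `|y| ^+ M.*2 * (2 ^+ k * `|y| ^+ k.*2)); last by ring.
rewrite ler_wpM2l ?mulr_ge0 ?exprn_ge0 //.
have -> : 2^-1 ^+ k = 2 ^+ k * 4^-1 ^+ k :> R by rewrite -exprMn; congr (_ ^+ _); field.
by rewrite ler_wpM2l ?exprn_ge0.
Qed.

Lemma apx_even M f (d : nat -> nat -> R) (B : nat -> nat) (K : R) :
  (forall N i, `|d N i| <= K * 2 ^+ i) -> (forall N, (M <= B N)%N) ->
  (forall N y, `|y| <= 4^-1 -> f N y = \sum_(i < B N) d N i * y ^+ i.*2) ->
  apx M.*2 f (fun N b => if odd b then 0 else d N b./2).
Proof.
move=> hK hB hf; have K0 : 0 <= K by have := le_trans (normr_ge0 _) (hK 0%N 0%N); rewrite mulr1.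
exists (2 * 2 ^+ M * K); split=> [|N b bM|N y y4].
- by rewrite !mulr_ge0 // exprn_ge0.
- case: ifP => _; first by rewrite normr0 !mulr_ge0 ?exprn_ge0.
  apply: le_trans (hK _ _) _; rewrite mulrC ler_wpM2r //.
  apply: le_trans (_ : 2 ^+ M <= _); first by rewrite ler_weXn2l ?ler1n //; lia.
  by rewrite ler_peMl ?exprn_ge0 // ler1n.
rewrite hf // (sum_ord_double (fun b => (if odd b then 0 else d N b./2) * y ^+ b)).
under [X in _ - X]eq_bigr => i _ do rewrite /= odd_double /= mul0r addr0 doubleK.
exact: even_tail.
Qed.

(** Cauchy product with the coefficients of [sprod], which has only even powers; M of them suffice
    for degrees below 2M. *)
Definition even_coef c N M b : R :=
  \sum_(i < M) ((-1) ^+ i * e N i) * (if (i.*2 <= b)%N then c N (b - i.*2)%N else 0).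

Lemma apx_sprod M f c : apx M.*2 f c ->
  apx M.*2 (fun N y => sprod N y * f N y) (fun N b => even_coef c N M b).
Proof.
move=> hf; have [C C0 hC] := apx_le hf.
have ne N i : `|(-1) ^+ i * e N i| <= 1 * 2 ^+ i.
  by rewrite normrM normrX normrN1 expr1n !mul1r ger0_norm ?e2_ge0 ?e2_le.
pose P N y := \sum_(i < M) (-1) ^+ i * e N i * y ^+ i.*2.
have h1 : apx M.*2 (fun N y => P N y * f N y) (fun N b => even_coef c N M b).
  have h i := @apxZ R M.*2 _ _ (fun N => (-1) ^+ i * e N i) _ (ne^~ i) (apx_shift i.*2 hf).
  apply: apx_ext_fun (apx_sum (fun i : 'I_M => h i)) => N y _ /=.
  by rewrite /P mulr_suml; apply: eq_bigr => i _; rewrite mulrA.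
have h2 : apx M.*2 (fun N y => (sprod N y - P N y) * f N y) (fun _ _ => 0).
  apply: (@apx_small R _ _ (2 * 2 ^+ M * 1 * C)) => [|N y y4].
    by rewrite !mulr_ge0 // exprn_ge0.
  rewrite normrM mulrAC ler_pM ?hC // (@sprodE R N y (maxn N.+1 M)); last by rewrite leq_max ltnSn.
  by apply: (@even_tail M _ (fun i => (-1) ^+ i * e N i)) => //; rewrite leq_maxr.
apply: apx_ext (apx_ext_fun _ (apxD h1 h2)) => [N b _|N y _] /=; first by rewrite addr0.
ring.
Qed.

End Coefficients.

Section MainCoefficients.
Local Open Scope classical_set_scope.
Variable R : realType.
Implicit Types (D M N J a b s : nat) (x y : R) (f g : nat -> R -> R) (c d : nat -> nat -> R).
Local Notation e := (fun n i => e2 (nats R n) i).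
Local Notation bincoef := (bincoef R).
Local Notation zeta s := (mzv R [:: s%N]).

Let one_weight (j : nat) : R := 1.
Let alt_weight (j : nat) : R := (-1) ^+ j.+1.

Definition wcoef (w : nat -> R) s N b : R :=
  bincoef s b * \sum_(j < N.*2) w j * j.+1%:R ^- (s + b).

Definition diff_coef s N b : R := wcoef alt_weight s N b - (-1) ^+ b * wcoef alt_weight s N b.

Definition main_coef a M N b : R :=
  \sum_(i < a) ((-1) ^+ i * e N i) *
     (wcoef one_weight (a - i).*2.+1 N b + (-1) ^+ b * wcoef one_weight (a - i).*2.+1 N b)
  - (if b is b'.+1 then
       even_coef (fun N b => diff_coef a.*2.+2 N b - ((-1) ^+ a * e N a) * diff_coef 2 N b) N M b'
     else 0).

Lemma apx_defect_main a M : (0 < a)%N -> apx M.*2 (defect_main a) (main_coef a M).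
Proof.
move=> a0.
have ne N i : `|(-1) ^+ i * e N i| <= 2 ^+ i.
  by rewrite normrM normrX normrN1 expr1n !mul1r ger0_norm ?e2_ge0 ?e2_le.
have w1 j : `|one_weight j| <= 1 by rewrite normr1.
have w2 j : `|alt_weight j| <= 1 by rewrite normrX normrN1 expr1n.
have h1 (i : 'I_a) : (2 <= (a - i).*2.+1)%N by have := ltn_ord i; lia.
have A i := apx_wsum M.*2 (h1 i) w1.
have A' := apx_sum (fun i => apxZ (ne^~ i) (apxD (A i) (apx_opp (A i)))).
have B s (s2 : (2 <= s)%N) := apx_wsum M.*2 s2 w2.
have B' s (s2 : (2 <= s)%N) := apxB (B s s2) (apx_opp (B s s2)).
have C := apx_shift1 (apx_sprod (apxB (B' a.*2.+2 isT) (apxZ (ne^~ a) (B' 2%N isT)))).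
apply: apx_ext_fun (apxB A' C) => N y _ /=.
rewrite /defect_main; congr (_ - _).
  apply: eq_bigr => i _; congr (_ * (_ + _)); apply: eq_bigr => j _; by rewrite mul1r.
rewrite mulrA; congr (_ * (_ - _ * _)); rewrite /alt_diff -sumrB;
  by apply: eq_bigr => j _; rewrite mulrBr.
Qed.

(** [zcoef] and [acoef] are the coefficients of y^b in the sum over j >= 1 of (y + j)^-s, plain and
    with sign (-1)^j; 1 - 2^(1-s-b) is the factor between zeta values and alternating ones. *)
Definition zcoef s b : R := bincoef s b * zeta (s + b).
Definition acoef s b : R := - (bincoef s b * ((1 - 2 / 2 ^+ (s + b)) * zeta (s + b))).
Definition diff_lim s b : R := acoef s b - (-1) ^+ b * acoef s b.

Lemma double_cvg (f : nat -> R) (l : R) : f n @[n --> \oo] --> l -> f n.*2 @[n --> \oo] --> l.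
Proof.
move=> h; apply: cvg_comp h; apply/cvgnyPge => A; near=> n.
by apply: leq_trans (_ : n <= _)%N; [near: n; exact: nbhs_infty_ge | lia].
Unshelve. all: by end_near.
Qed.

Lemma zcoef_cvg s b : (2 <= s)%N -> wcoef one_weight s n b @[n --> \oo] --> zcoef s b.
Proof.
move=> s2; apply: cvgMr.
have := double_cvg (@psum_cvg R (s + b) (leq_trans s2 (leq_addr _ _))).
by under eq_fun => n do rewrite psum_ord; under eq_fun => n do under eq_bigr => i _ do rewrite -[_ ^- _]mul1r.
Qed.

Lemma alt_sum N s : \sum_(j < N.*2) alt_weight j * j.+1%:R ^- s =
  2 / 2 ^+ s * psum (nats R N) s - psum (nats R N.*2) s.
Proof.
rewrite !psum_ord mulr_sumr (sum_ord_double (fun j => alt_weight j * j.+1%:R ^- s)).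
rewrite (sum_ord_double (fun j => j.+1%:R ^- s)) -sumrB; apply: eq_bigr => i _.
rewrite /alt_weight !exprS -signr_odd odd_double expr0.
have -> : (i.*2.+2)%:R = 2%:R * i.+1%:R :> R by rewrite -natrM; congr _%:R; lia.
by rewrite exprMn invfM; ring.
Qed.

Lemma acoef_cvg s b : (2 <= s)%N -> wcoef alt_weight s n b @[n --> \oo] --> acoef s b.
Proof.
move=> s2; have s2' : (2 <= s + b)%N := leq_trans s2 (leq_addr _ _).
rewrite /acoef -mulrN; apply: cvgMr; under eq_fun => n do rewrite alt_sum.
rewrite mulrBl mul1r opprB; apply: cvgB; first by apply: cvgMr; apply: psum_cvg.
by have := @double_cvg (fun n => psum (nats R n) (s + b)) _ (@psum_cvg R _ s2').
Qed.

Lemma diff_lim_cvg s b : (2 <= s)%N -> diff_coef s n b @[n --> \oo] --> diff_lim s b.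
Proof. by move=> s2; apply: cvgB; [|apply: cvgMr]; apply: acoef_cvg. Qed.

Definition main_lim a M b : R :=
  \sum_(i < a) ((-1) ^+ i * e2_lim R i) *
     (zcoef (a - i).*2.+1 b + (-1) ^+ b * zcoef (a - i).*2.+1 b)
  - (if b is b'.+1 then
       \sum_(i < M) ((-1) ^+ i * e2_lim R i) * (if (i.*2 <= b')%N then
           diff_lim a.*2.+2 (b' - i.*2) - ((-1) ^+ a * e2_lim R a) * diff_lim 2 (b' - i.*2) else 0)
     else 0).

Lemma main_lim_cvg a M b : main_coef a M n b @[n --> \oo] --> main_lim a M b.
Proof.
have E i : ((-1) ^+ i * e n i) @[n --> \oo] --> (-1) ^+ i * e2_lim R i.
  by apply: cvgMr; apply: e2_cvg.
apply: cvgB.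
  apply: cvgn_sum => i _ _; apply: cvgM => //.
  have s2 : (2 <= (a - i).*2.+1)%N by have := ltn_ord i; lia.
  by apply: cvgD; [|apply: cvgMr]; apply: zcoef_cvg.
case: b => [|b]; first exact: cvg_cst.
apply: cvgn_sum => i _ _; apply: cvgM => //.
case: leqP => _; last exact: cvg_cst.
by apply: cvgB; [|apply: cvgM => //]; apply: diff_lim_cvg.
Qed.

Lemma mzv_poly_sign k : (-1) ^+ k \in @mzv_poly R.
Proof. by rewrite rpredX // rpredN rpred1. Qed.

Lemma mzv_poly_zeta s : (2 <= s)%N -> zeta s \in @mzv_poly R.
Proof. by move=> s2; apply: mzv_in; rewrite /admissible /= s2 andbT ltnW. Qed.

Lemma mzv_poly_bincoef s b : bincoef s b \in @mzv_poly R.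
Proof. by rewrite rpredM ?mzv_poly_sign ?mzv_poly_nat. Qed.

Lemma mzv_poly_zcoef s b : (2 <= s)%N -> zcoef s b \in @mzv_poly R.
Proof. by move=> s2; rewrite rpredM ?mzv_poly_bincoef ?mzv_poly_zeta // ltn_addr. Qed.

Lemma mzv_poly_diff_lim s b : (2 <= s)%N -> diff_lim s b \in @mzv_poly R.
Proof.
move=> s2; have h : acoef s b \in @mzv_poly R.
  rewrite rpredN rpredM ?mzv_poly_bincoef // rpredM ?mzv_poly_zeta // 1?ltn_addr //.
  by rewrite rpredB ?rpred1 // rpredM ?mzv_poly_nat // -exprVn rpredX // mzv_poly_natV.
by rewrite rpredB // rpredM ?mzv_poly_sign.
Qed.

(** Modulo zeta(2) every term with a factor [e2_lim i], i > 0, drops out, so only i = 0 remains in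
    each sum. The first sum gives a plain zeta value, the second an alternating one, whence the
    factor 1 - 4^-(a+b). *)
Lemma main_lim_even a M b : (0 < a)%N -> (0 < M)%N ->
  in_zeta2 (main_lim a M b.*2 -
    2 * ('C((a + b).*2, b.*2)%:R - (1 - 4 ^- (a + b)) * 'C((a + b).*2, a.*2.+1)%:R)
      * zeta (a + b).*2.+1).
Proof.
move=> a0 M0; rewrite /main_lim -signr_odd odd_double expr0.
case: a a0 => // a _; case: M M0 => // M _.
rewrite big_ord_recl /= e2_lim0 !mul1r subn0.
set T := \sum_(i < a) _.
have hT : in_zeta2 T.
  apply: in_zeta2_sum => i _ _; rewrite mulrC; apply: in_zeta2M.
    have s2 : (2 <= (a.+1 - bump 0 i).*2.+1)%N by rewrite /bump; have := ltn_ord i; lia.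
    by rewrite mul1r rpredD ?mzv_poly_zcoef.
  by apply: in_zeta2M; rewrite ?mzv_poly_sign //; apply: e2_lim_in_zeta2.
set U := (X in _ + T - X).
have hU : in_zeta2 (U - 2 * ((1 - 4 ^- (a.+1 + b)) * 'C((a.+1 + b).*2, a.+1.*2.+1)%:R)
      * zeta (a.+1 + b).*2.+1).
  (* For b = 0 the second sum is absent, in agreement with its vanishing binomial coefficient. *)
  rewrite /U; case: b {T hT U} => [|b].
    rewrite addn0 bin_small // mulr0 mulr0 mul0r subrr; exact: in_zeta2_0.
  rewrite [b.+1.*2]doubleS big_ord_recl /= e2_lim0 !mul1r !subn0.
  set V := \sum_(i < M) _.
  have hV : in_zeta2 V.
    apply: in_zeta2_sum => i _ _; rewrite mulrC; apply: in_zeta2M; last first.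
      by apply: in_zeta2M; rewrite ?mzv_poly_sign //; apply: e2_lim_in_zeta2.
    case: ifP => _; last exact: rpred0.
    rewrite rpredB ?mzv_poly_diff_lim // rpredM ?mzv_poly_diff_lim //.
    by rewrite rpredM ?mzv_poly_sign // e2_lim_poly.
  have -> : diff_lim a.+1.*2.+2 b.*2.+1 =
     2 * ((1 - 4 ^- (a.+1 + b.+1)) * 'C((a.+1 + b.+1).*2, a.+1.*2.+1)%:R) * zeta (a.+1 + b.+1).*2.+1.
    rewrite /diff_lim /acoef /bincoef exprS -signr_odd odd_double expr0.
    have -> : (a.+1.*2.+2 + b.*2.+1 = (a.+1 + b.+1).*2.+1)%N by lia.
    have -> : 'C((a.+1 + b.+1).*2.+1.-1, b.*2.+1) = 'C((a.+1 + b.+1).*2, a.+1.*2.+1).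
      by rewrite -bin_sub /=; [congr 'C(_, _)|]; lia.
    have -> : 2 / 2 ^+ (a.+1 + b.+1).*2.+1 = 4 ^- (a.+1 + b.+1) :> R.
      rewrite exprS -mul2n exprM (_ : 2 ^+ 2 = 4 :> R); last by ring.
      by field; rewrite expf_neq0.
    ring.
  set W := 2 * _ * _; set Z := (_ * e2_lim R a.+1) * _.
  rewrite (_ : _ - W = V - Z); last by ring.
  apply: in_zeta2B => //; rewrite /Z mulrC; apply: in_zeta2M; first exact: mzv_poly_diff_lim.
  by apply: in_zeta2M; rewrite ?mzv_poly_sign //; apply: e2_lim_in_zeta2.
have -> : zcoef a.+1.*2.+1 b.*2 = 'C((a.+1 + b).*2, b.*2)%:R * zeta (a.+1 + b).*2.+1.
  rewrite /zcoef /bincoef -signr_odd odd_double mul1r.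
  have -> : (a.+1.*2.+1 + b.*2 = (a.+1 + b).*2.+1)%N by lia.
  by [].
rewrite (_ : _ - _ = T - (U - 2 * ((1 - 4 ^- (a.+1 + b)) * 'C((a.+1 + b).*2, a.+1.*2.+1)%:R)
      * zeta (a.+1 + b).*2.+1)); last by ring.
exact: in_zeta2B.
Qed.

End MainCoefficients.

Section DefectCoefficients.
Local Open Scope classical_set_scope.
Variable R : realType.
Implicit Types (M N a b : nat) (y : R).
Local Notation e := (fun n i => e2 (nats R n) i).
Local Notation zeta s := (mzv R [:: s%N]).

Definition defect_coef a N b : R :=
  (-1) ^+ (a + b) * (ns (nats R N) (idx a b) - e N a * ns (nats R N) (idx 0 b)).

(** For b = 0 the two sums can diverge separately, and the bound comes from the convergence of their
    difference to a regularized value; for b > 0 each is bounded. *)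
Lemma defect_coef_le a :
  exists K : R, forall N b, `|defect_coef a N b| <= K * 2 ^+ b.
Proof.
have [C1 C10 h1] := idx_le R a; have [C2 C20 h2] := idx_le R 0.
have k2 : all (leq 2) (nseq a 2%N) by rewrite all_nseq orbT.
have [M [_ hM]] : bounded_fun (fun n => zn R (rcons (nseq a 2%N) 1%N) n - harm R n * zn R (nseq a 2%N) n).
  have cv := @zreg_cvg R Harmonic _ k2.
  by apply: cvg_seq_bounded; exact: cvgP cv.
have hM1 n : `|zn R (rcons (nseq a 2%N) 1%N) n - harm R n * zn R (nseq a 2%N) n| <= `|M| + 1.
  by apply: (hM (`|M| + 1)) => //; rewrite (le_lt_trans (ler_norm M)) // ltrDl.
pose K : R := `|M| + 1 + C1 + 2 ^+ a * C2; exists K => N [|b].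
  rewrite expr0 mulr1 /defect_coef normrM normrX normrN1 expr1n mul1r.
  have := hM1 N; rewrite -cats1 -/(idx a 0) mulrC.
  have -> : harm R N = ns (nats R N) (idx 0 0) by rewrite harmE.
  move=> h; apply: le_trans h _; rewrite /K -addrA lerDl.
  by rewrite addr_ge0 // mulr_ge0 ?exprn_ge0.
rewrite /defect_coef normrM normrX normrN1 expr1n mul1r.
have p2 : 1 <= 2 ^+ b :> R by rewrite exprn_ege1 // ler1n.
apply: le_trans (ler_normB _ _) _; rewrite normrM !ger0_norm ?e2_ge0 ?zn_ge0 //.
apply: le_trans (_ : C1 * 2 ^+ b + 2 ^+ a * (C2 * 2 ^+ b) <= _).
  by apply: lerD; [exact: h1 | apply: ler_pM; rewrite ?e2_ge0 ?e2_le ?zn_ge0 //; exact: h2].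
rewrite exprS /K; have q : 0 <= 2 ^+ a * C2 :> R by rewrite mulr_ge0 ?exprn_ge0.
rewrite mulrA; move: (2 ^+ a * C2) (2 ^+ b) p2 q (normr_ge0 M) => u v; nra.
Qed.

Lemma apx_idx_defect a M :
  apx M.*2 (idx_defect a) (fun N b => if odd b then 0 else defect_coef a N b./2).
Proof.
have [K hK] := defect_coef_le a.
apply: (@apx_even R M _ (defect_coef a) (fun N => maxn N M) K) => // [N|N y y4].
  by rewrite leq_maxr.
(* Padding with vanishing coefficients provides at least M of them for every N. *)
have E c : idx_poly c N y N = idx_poly c N y (maxn N M).
  have k0 k : (0 < k <= N)%N -> k%:R != 0 :> R by case/andP; rewrite pnatr_eq0 -lt0n.
  have kz k : (0 < k <= N)%N -> (k%:R - y) * (k%:R + y) != 0.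
    move: y4; rewrite ler_norml => /andP[y1 y2] /andP[k1 _].
    have : 1 <= k%:R :> R by rewrite ler1n.
    by move=> k1'; rewrite mulf_neq0 //; apply/eqP; lra.
  by rewrite !idx_polyE // leq_maxl.
rewrite /idx_defect !E /idx_poly mulr_sumr -sumrB; apply: eq_bigr => b _.
by rewrite /defect_coef exprD add0n; ring.
Qed.

Lemma idx_admissible a b : admissible (idx a b.+1).
Proof.
rewrite /admissible /is_index all_cat all_nseq orbT last_cat /=.
by rewrite all_nseq orbT; elim: b.
Qed.

Lemma defect_coef_cvg bul a b : defect_coef a n b @[n --> \oo] -->
  (-1) ^+ (a + b) * (if b is 0 then zreg R bul (idx a 0)
    else zreg R bul (idx a b) - e2_lim R a * zreg R bul (idx 0 b)).
Proof.
apply: cvgMr; case: b => [|b]; last first.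
  rewrite !zreg_admissible ?idx_admissible //.
  by apply: cvgB; [|apply: cvgM; first exact: e2_cvg]; apply: zn_cvg; apply: idx_admissible.
have k2 : all (leq 2) (nseq a 2%N) by rewrite all_nseq orbT.
have := @zreg_cvg R bul _ k2; rewrite -cats1 -/(idx a 0).
by under eq_fun => n do rewrite harmE mulrC.
Qed.

(** The coefficient of zeta(2a + 2b + 1) in the regularized zeta(a, b) modulo zeta(2), before
    symmetrization. *)
Definition zreg_coef a b : rat :=
  (-1) ^+ (a + b) * 2 * ('C((a + b).*2, b.*2)%:R - (1 - 4 ^- (a + b)) * 'C((a + b).*2, a.*2.+1)%:R).

Lemma zreg_idx_pos bul a b : (0 < a)%N ->
  in_zeta2 (zreg R bul (idx a b) - ratr (zreg_coef a b) * zeta (a + b).*2.+1).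
Proof.
move=> a0; pose M := b.+1.
have D y : 0 < y <= 4^-1 -> (idx_defect a n y - defect_main a n y) @[n --> \oo] --> (0 : R).
  move=> /andP[y0 y4]; have [C C0 hC] := defect_approx R a.
  apply/norm_cvg0P; apply: (@squeeze_cvgr _ _ _ _ (fun=> 0) (fun n => C * ((harm R n.*2 + 1) / n%:R))).
  - near=> n; rewrite normr_ge0 /=; apply: hC; last by rewrite ger0_norm ?(ltW y0).
      by near: n; exists 1%N.
    by rewrite gt_eqF.
  - exact: cvg_cst.
  - by rewrite -[X in _ --> X](mulr0 C); apply: cvgMr; apply: harm_double_sublinear.
pose l i : R := (-1) ^+ (a + i) * (if i is 0 then zreg R bul (idx a 0)
    else zreg R bul (idx a i) - e2_lim R a * zreg R bul (idx 0 i)).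
have E : l b = main_lim R a M b.*2.
  have := @apx_unique R _ _ _ _ _ (fun b => if odd b then 0 else l b./2) (main_lim R a M)
    (apx_idx_defect a M) (apx_defect_main R M a0) D.
  move=> /(_ _ _ b.*2); rewrite odd_double doubleK; apply.
  - move=> i _; case: ifP => _; first exact: cvg_cst.
    exact: defect_coef_cvg.
  - by move=> i _; apply: main_lim_cvg.
  - by rewrite /M; lia.
have := main_lim_even R b a0 (ltn0Sn b); rewrite -/M -E.
set t := 2 * _ => h.
have Et : ratr (zreg_coef a b) = (-1) ^+ (a + b) * t :> R.
  rewrite /zreg_coef /t !(rmorphM, rmorphB, rmorphXn, rmorphN, rmorph1, fmorphV) /=.
  by rewrite !ratr_nat mulrA.
have s2 : (-1) ^+ (a + b) * (-1) ^+ (a + b) = 1 :> R by rewrite -expr2 sqrr_sign.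
have -> : zreg R bul (idx a b) = (-1) ^+ (a + b) * l b +
    (if b is 0 then 0 else e2_lim R a * zreg R bul (idx 0 b)).
  by rewrite /l; case: (b) s2 => [|c] s2; rewrite mulrA s2; ring.
rewrite Et (_ : _ - _ = (-1) ^+ (a + b) * (l b - t * zeta (a + b).*2.+1) +
  (if b is 0 then 0 else e2_lim R a * zreg R bul (idx 0 b))); last by ring.
apply: in_zeta2D; first by apply: in_zeta2M h; apply: mzv_poly_sign.
case: (b) => [|c]; first exact: in_zeta2_0.
by rewrite mulrC; apply: in_zeta2M; [exact: zreg_in | exact: e2_lim_in_zeta2].
Unshelve. all: by end_near.
Qed.

End DefectCoefficients.

(** * Symmetric values *)

Lemma sum_bin_parity n : (0 < n)%N ->
  \sum_(i < n.+1) 'C(n.*2, i.*2)%:R = 4 ^+ n / 2 :> rat /\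
  \sum_(i < n.+1) 'C(n.*2, i.*2.+1)%:R = 4 ^+ n / 2 :> rat.
Proof.
move=> n0; set E := \sum_(i < _) _; set O := \sum_(i < _) _.
have sumD (x : rat) : \sum_(j < n.+1.*2) 'C(n.*2, j)%:R * x ^+ j = (1 + x) ^+ n.*2.
  rewrite exprDn doubleS big_ord_recr /= bin_small // mul0r addr0.
  by apply: eq_bigr => i _; rewrite expr1n mul1r mulr_natl.
have S1 : E + O = 4 ^+ n.
  have := sumD 1; rewrite (_ : (1 + 1) ^+ n.*2 = 4 ^+ n); last first.
    by rewrite -mul2n exprM.
  move=> <-; rewrite (sum_ord_double (fun j => 'C(n.*2, j)%:R * 1 ^+ j)) -big_split.
  by apply: eq_bigr => i _; rewrite !expr1n !mulr1.
have S2 : E - O = 0.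
  have Z : (1 - 1) ^+ n.*2 = 0 :> rat by rewrite subrr expr0n double_eq0 gtn_eqF.
  rewrite -[RHS]Z -sumD (sum_ord_double (fun j => 'C(n.*2, j)%:R * (-1) ^+ j)) -sumrB.
  by apply: eq_bigr => i _; rewrite exprS -signr_odd odd_double; ring.
by split; lra.
Qed.

Lemma sum_zreg_coef n : (0 < n)%N -> \sum_(i < n.+1) zreg_coef i (n - i) = (-1) ^+ n.
Proof.
move=> n0; have [SE SO] := sum_bin_parity n0.
rewrite (reindex_inj rev_ord_inj) /=.
transitivity (\sum_(i < n.+1) ((-1) ^+ n * 2 * ('C(n.*2, i.*2)%:R -
   (1 - 4 ^- n) * 'C(n.*2, (n - i).*2.+1)%:R)) : rat).
  apply: eq_bigr => i _; have := leq_ord i; rewrite subSS /zreg_coef => le.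
  by rewrite subKn // subnK.
rewrite -mulr_sumr sumrB SE -mulr_sumr (reindex_inj rev_ord_inj) /=.
under eq_bigr => i _ do rewrite subSS subKn ?leq_ord //.
rewrite SO; have : 4 ^+ n != 0 :> rat by rewrite expf_neq0.
by move: (4 ^+ n) => x x0; field.
Qed.

Lemma coefq_zreg_coef a b : (0 < a + b)%N -> zreg_coef a b - zreg_coef b a = coefq a b.
Proof.
move=> n0; rewrite /zreg_coef /coefq [(b + a)%N]addnC.
have -> : (2 * a + 2 * b + 1 = (a + b).*2.+1)%N by lia.
have -> : 'C((a + b).*2.+1, 2 * a) = ('C((a + b).*2, b.*2.+1) + 'C((a + b).*2, b.*2))%N.
  by rewrite -binS -bin_sub; [congr 'C(_, _)|]; lia.
have -> : 'C((a + b).*2.+1, 2 * b) = ('C((a + b).*2, a.*2.+1) + 'C((a + b).*2, a.*2))%N.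
  by rewrite -binS -bin_sub; [congr 'C(_, _)|]; lia.
have -> : 'C((a + b).*2, b.*2) = 'C((a + b).*2, a.*2).
  by rewrite -bin_sub; [congr 'C(_, _)|]; lia.
by rewrite !natrD; ring.
Qed.

Section SymmetricValues.
Local Open Scope classical_set_scope.
Variable R : realType.
Variable bul : regularization.
Local Notation zeta s := (mzv R [:: s%N]).
Local Notation e2_lim := (e2_lim R).
Local Notation zr a b := (zreg R bul (idx a b)).

Lemma zreg_nseq2 i : zreg R bul (nseq i 2%N) = e2_lim i.
Proof. by rewrite zreg_admissible // admissible_nseq2. Qed.

(** Limit of [sum_ns_idx]: its term i = 0 is the harmonic number times [e2 n], exactly the
    divergence that regularization removes from zeta(n, 0). *)
Lemma sum_zreg_idx n : (0 < n)%N ->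
  \sum_(i < n.+1) zr i (n - i) =
  \sum_(i < n) (-1) ^+ i.+1 * e2_lim (n - i.+1) * zeta (1 + i.+1.*2).
Proof.
move=> n0.
have L : (\sum_(i < n.+1) ns (nats R N) (idx i (n - i)) - harm R N * e2 (nats R N) n) @[N --> \oo] -->
    \sum_(i < n.+1) zr i (n - i).
  rewrite big_ord_recr /= subnn.
  under eq_fun => N do rewrite big_ord_recr /= subnn -addrA.
  apply: cvgD; last first.
    have k2 : all (leq 2) (nseq n 2%N) by rewrite all_nseq orbT.
    by have := @zreg_cvg R bul _ k2; rewrite -cats1.
  apply: cvgn_sum => i _ _; have -> : (n - i = (n - i).-1.+1)%N by have := ltn_ord i; lia.
  rewrite zreg_admissible ?idx_admissible //; apply: zn_cvg; exact: idx_admissible.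
suff L' : (\sum_(i < n.+1) ns (nats R N) (idx i (n - i)) - harm R N * e2 (nats R N) n) @[N --> \oo] -->
    \sum_(i < n) (-1) ^+ i.+1 * e2_lim (n - i.+1) * zeta (1 + i.+1.*2).
  by apply: cvg_unique L L'; apply: norm_hausdorff.
have E N : \sum_(i < n.+1) ns (nats R N) (idx i (n - i)) - harm R N * e2 (nats R N) n =
    \sum_(i < n) (-1) ^+ i.+1 * e2 (nats R N) (n - i.+1) * psum (nats R N) (1 + i.+1.*2).
  by rewrite sum_ns_idx big_ord_recl /= expr0 mul1r subn0 double0 addn0 mulrC addrAC subrr add0r.
under eq_fun => N do rewrite E.
apply: cvgn_sum => i _ _; apply: cvgM; last exact: psum_cvg.
by apply: cvgMr; apply: e2_cvg.
Qed.

(** For a = 0, only the last term (-1)^n zeta(2n + 1) of [sum_zreg_idx] survives modulo zeta(2). By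
    [sum_zreg_coef] the expected coefficients have the same total, which fixes the one still
    missing. *)
Lemma zreg_idx a b : (0 < a + b)%N ->
  in_zeta2 (zr a b - ratr (zreg_coef a b) * zeta (a + b).*2.+1).
Proof.
case: a => [|a]; last by move=> _; apply: zreg_idx_pos.
case: b => // b _; set n := b.+1; rewrite add0n.
have := sum_zreg_idx (ltn0Sn b); rewrite -/n big_ord_recl subn0 [RHS]big_ord_recr /= subnn e2_lim0 mulr1.
set S := \sum_(i < n) _; set T := \sum_(i < b) _ => E.
have hT : in_zeta2 T.
  apply: in_zeta2_sum => i _ _; rewrite mulrC; apply: in_zeta2M.
    by apply: mzv_poly_zeta; lia.
  apply: in_zeta2M; first exact: mzv_poly_sign.
  by apply: e2_lim_in_zeta2; have := ltn_ord i; rewrite /n; lia.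
have hS : in_zeta2 (S - \sum_(i < n) ratr (zreg_coef i.+1 (n - i.+1)) * zeta n.*2.+1).
  rewrite -sumrB; apply: in_zeta2_sum => i _ _; rewrite /bump add1n.
  have := @zreg_idx_pos R bul i.+1 (n - i.+1) isT.
  by have -> : (i.+1 + (n - i.+1) = n)%N by have := ltn_ord i; lia.
have := sum_zreg_coef (ltn0Sn b); rewrite -/n big_ord_recl subn0.
move=> /(congr1 (ratr : rat -> R)); rewrite rmorphD rmorph_sum rmorphXn rmorphN rmorph1 /= => E2.
rewrite (_ : _ - _ = T - (S - \sum_(i < n) ratr (zreg_coef i.+1 (n - i.+1)) * zeta n.*2.+1)).
  exact: in_zeta2B.
have -> : ratr (zreg_coef 0 n) = (-1) ^+ n - \sum_(i < n) ratr (zreg_coef i.+1 (n - i.+1)) :> R.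
  by rewrite -E2 -addrA subrr addr0.
have -> : zr 0 n = T + (-1) ^+ n * zeta (1 + n.*2) - S by rewrite /n -E; ring.
by rewrite -mulr_suml add1n; ring.
Qed.

Lemma lift_zetaS_idx a b : lift_zetaS R bul (idx a b) =
  \sum_(i < b.+1) zr a i * e2_lim (b - i) - \sum_(i < a.+1) e2_lim i * zr b (a - i).
Proof.
have ev i : odd (sumn (nseq i 2%N)) = false by elim: i => //= i ->.
rewrite /lift_zetaS size_idx -addnS -addSn big_split_ord addrC -sumrN; congr (_ + _).
  apply: eq_bigr => i _ /=; have [-> ->] := @take_idx a b i (leq_ord i).
  by rewrite rev_idx zreg_nseq2 -signr_odd /idx sumn_cat /= !oddD !ev mulN1r mulNr.
apply: eq_bigr => i _ /=; have [-> ->] := @drop_idx a b i (leq_ord i).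
by rewrite -signr_odd ev mul1r rev_nseq zreg_nseq2.
Qed.

Lemma lift_zetaS_idx_equiv a b : in_zeta2 (lift_zetaS R bul (idx a b) - (zr a b - zr b a)).
Proof.
rewrite lift_zetaS_idx big_ord_recr [X in _ - X - _]big_ord_recl /= subnn subn0 e2_lim0 mulr1 mul1r.
set S := \sum_(i < b) _; set T := \sum_(i < a) _.
rewrite (_ : _ - _ = S - T); last by ring.
apply: in_zeta2B; apply: in_zeta2_sum => i _ _.
  apply: in_zeta2M; first exact: zreg_in.
  by apply: e2_lim_in_zeta2; have := ltn_ord i; lia.
by rewrite mulrC; apply: in_zeta2M; [exact: zreg_in|exact: e2_lim_in_zeta2].
Qed.

Lemma zetaZE k : admissible [:: k] -> mzv_val (zetaZ R k) = zeta k.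
Proof. by rewrite /zetaZ; case: {-}_ / boolP => // /negP. Qed.

Lemma lift_zetaS_value a b : in_zeta2 (lift_zetaS R bul (idx a b) -
   ratr (coefq a b) * mzv_val (zetaZ R (2 * a + 2 * b + 1))).
Proof.
have -> : (2 * a + 2 * b + 1 = (a + b).*2.+1)%N by lia.
(* The case of zeta(1): the coefficient is 0, and the symmetrization cancels the single value
   against itself. *)
have [n0|n0] := posnP (a + b).
  have [-> ->] : a = 0%N /\ b = 0%N by lia.
  have -> : coefq 0 0 = 0 by rewrite /coefq subrr mulr0.
  rewrite rmorph0 mul0r subr0.
  by have := lift_zetaS_idx_equiv 0 0; rewrite subrr subr0.
have -> : mzv_val (zetaZ R (a + b).*2.+1) = zeta (a + b).*2.+1.
  have ad : admissible [:: (a + b).*2.+1] by rewrite /admissible /=; lia.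
  exact: zetaZE.
rewrite -coefq_zreg_coef // rmorphB /=.
have h1 := zreg_idx n0; have h2 := @zreg_idx b a; rewrite [(b + a)%N]addnC in h2.
have := in_zeta2D (lift_zetaS_idx_equiv a b) (in_zeta2B h1 (h2 n0)).
by congr in_zeta2; ring.
Qed.

(** Merging positive entries creates no new 1, so each merge of [idx a b] has at most one and
    [lift_zetaS_cvg] applies to it. *)
Lemma merges_index k l : is_index k -> l \in merges k ->
  is_index l && (count_mem 1%N l <= count_mem 1%N k)%N.
Proof.
case: k => [|x k]; first by move=> _; rewrite inE => /eqP ->.
elim: k x l => [|y k IH] x l /=; first by move=> ix; rewrite inE => /eqP ->; rewrite [is_index _]ix /= leqnn.
move=> /andP[x0 /andP[y0 ik]]; rewrite mem_cat => /orP[/mapP[l' l'P ->]|lP].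
  have /andP[il h] : is_index l' && (count_mem 1%N l' <= count_mem 1%N (y :: k))%N.
    by apply: IH => //; apply/andP.
  by rewrite [is_index _](_ : _ = true) /= ?leq_add2l //; apply/andP.
have /andP[-> h] /= : is_index l && (count_mem 1%N l <= count_mem 1%N (x + y :: k)%N)%N.
  by apply: IH => //; apply/andP; rewrite addn_gt0 x0.
by apply: leq_trans h _; case: x x0 {lP} => [|[|x]] //= _; case: y y0 => [|[|y]] //= _; lia.
Qed.

Definition lift_zetaS_star k : R := \sum_(l <- merges k) lift_zetaS R bul l.

Lemma lift_zetaS_star_cvg a b :
  nst (symlist (nats R n)) (idx a b) @[n --> \oo] --> lift_zetaS_star (idx a b).
Proof.
under eq_fun => n do rewrite -sum_merges.
apply: cvgn_sum => l lP _.
have ik : is_index (idx a b) by rewrite /is_index all_cat /= !all_nseq !orbT.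
have /andP[il cl] := merges_index ik lP; apply: lift_zetaS_cvg => //.
apply: leq_trans cl _; rewrite count_cat /= !count_nseq /=; lia.
Qed.

Definition e2_sym_lim i : R := \sum_(j < i.+1) e2_lim j * e2_lim (i - j).

Lemma e2_sym_cvg i : e2 (symlist (nats R n)) i @[n --> \oo] --> e2_sym_lim i.
Proof.
under eq_fun => n do rewrite e2_symlist.
by apply: cvgn_sum => j _ _; apply: cvgM; apply: e2_cvg.
Qed.

Lemma e2_sym_lim0 : e2_sym_lim 0 = 1.
Proof. by rewrite /e2_sym_lim big_ord1 subnn e2_lim0 mulr1. Qed.

Lemma e2_sym_lim_in_zeta2 i : (0 < i)%N -> in_zeta2 (e2_sym_lim i).
Proof.
move=> i0; apply: in_zeta2_sum => j _ _; case: (posnP j) => [->|j0].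
  by rewrite subn0; apply: in_zeta2M; [exact: e2_lim_poly|exact: e2_lim_in_zeta2].
by rewrite mulrC; apply: in_zeta2M; [exact: e2_lim_poly|exact: e2_lim_in_zeta2].
Qed.

Lemma lift_zetaS_poly l : lift_zetaS R bul l \in @mzv_poly R.
Proof.
apply: rpred_sum => i _; rewrite rpredM ?rpredM ?zreg_in //; exact: mzv_poly_sign.
Qed.

Lemma sum_lift_zetaS_star a b :
  \sum_(i < a.+1) \sum_(j < b.+1)
     (-1) ^+ i * (-1) ^+ j * e2_sym_lim i * e2_sym_lim j * lift_zetaS_star (idx (a - i) (b - j)) =
  (-1) ^+ (a + b) * lift_zetaS R bul (idx b a).
Proof.
have L1 : (\sum_(i < a.+1) \sum_(j < b.+1)
     (-1) ^+ i * (-1) ^+ j * e2 (symlist (nats R n)) i * e2 (symlist (nats R n)) j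
       * nst (symlist (nats R n)) (idx (a - i) (b - j))) @[n --> \oo] -->
   \sum_(i < a.+1) \sum_(j < b.+1)
     (-1) ^+ i * (-1) ^+ j * e2_sym_lim i * e2_sym_lim j * lift_zetaS_star (idx (a - i) (b - j)).
  apply: cvgn_sum => i _ _; apply: cvgn_sum => j _ _.
  apply: cvgM; last exact: lift_zetaS_star_cvg.
  by apply: cvgM; [apply: cvgMr|]; apply: e2_sym_cvg.
move: L1; under eq_fun => n do rewrite sum_nst_idx.
move=> L1; apply: cvg_unique L1 _; first exact: norm_hausdorff.
apply: (@cvgMr R _ _ _ (fun n => ns (symlist (nats R n)) (idx b a))); apply: lift_zetaS_cvg; first by rewrite /is_index all_cat /= !all_nseq !orbT.
by rewrite count_cat /= !count_nseq.
Qed.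

(** In the limit identity [sum_lift_zetaS_star], each term other than i = j = 0 contains
    [e2_sym_lim] at a positive argument, a multiple of zeta(2). *)
Lemma lift_zetaS_star_equiv a b :
  in_zeta2 (lift_zetaS_star (idx a b) - (-1) ^+ (a + b) * lift_zetaS R bul (idx b a)).
Proof.
rewrite -sum_lift_zetaS_star big_ord_recl [X in _ - (X + _)]big_ord_recl /= !subn0 e2_sym_lim0 !mul1r.
set S := \sum_(i < b) _; set T := \sum_(i < a) _.
rewrite (_ : _ - _ = - (S + T)); last by ring.
have star_poly k : lift_zetaS_star k \in @mzv_poly R.
  by apply: rpred_sum => l _; apply: lift_zetaS_poly.
have e_poly i : e2_sym_lim i \in @mzv_poly R.
  by apply: rpred_sum => j _; rewrite rpredM ?e2_lim_poly.
apply: in_zeta2N; apply: in_zeta2D; apply: in_zeta2_sum => i _ _.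
  rewrite mulrAC; apply: in_zeta2M; last exact: e2_sym_lim_in_zeta2.
  by rewrite !rpredM ?mzv_poly_sign ?rpred1.
apply: in_zeta2_sum => j _ _.
rewrite (_ : _ * _ = ((-1) ^+ bump 0 i * (-1) ^+ j * e2_sym_lim j
    * lift_zetaS_star (idx (a - bump 0 i) (b - j))) * e2_sym_lim (bump 0 i)); last by ring.
by apply: in_zeta2M; rewrite ?rpredM ?mzv_poly_sign //; exact: e2_sym_lim_in_zeta2.
Qed.

Lemma Zbar_eq (u v : mzv_ring R) : in_zeta2 (val u - val v) -> Zbar_of u = Zbar_of v.
Proof.
move=> [y yP E]; apply/qclassP; exists (MzvRing yP); apply: val_inj.
rewrite rmorphB rmorphM /= E; congr (_ * _).
by rewrite zetaZE.
Qed.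

Lemma zetaS_idx a b : zetaS R bul (idx a b) = ratS R (coefq a b) * ZfrakS R (2 * a + 2 * b + 1).
Proof.
rewrite /ratS /ZfrakS -rmorphM; apply: Zbar_eq.
have := lift_zetaS_value a b; congr (in_zeta2 (_ - _)).
by rewrite rmorph_sum; apply: eq_bigr => i _; rewrite !rmorphM rmorphXn rmorphN rmorph1.
Qed.

Lemma zetaS_star_idx a b : zetaS_star R bul (idx a b) =
  ratS R ((-1) ^+ (a + b) * coefq b a) * ZfrakS R (2 * a + 2 * b + 1).
Proof.
rewrite /zetaS_star /zetaS -rmorph_sum /ratS /ZfrakS -rmorphM; apply: Zbar_eq.
have h1 := lift_zetaS_star_equiv a b; have h2 := in_zeta2M (mzv_poly_sign R (a + b)) (lift_zetaS_value b a).
have := in_zeta2D h1 h2; rewrite [(2 * b + 2 * a)%N]addnC; congr in_zeta2.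
rewrite mulrBr addrA subrK mulrA; congr (_ - _).
  rewrite rmorph_sum; apply: eq_bigr => l _.
  by rewrite rmorph_sum; apply: eq_bigr => i _; rewrite !rmorphM rmorphXn rmorphN rmorph1.
by rewrite -ratr_signM [RHS]rmorphM.
Qed.

End SymmetricValues.

Theorem theorem3p11 (R : realType) (F : setting) (a b : nat) :
  zeta_F R F (nseq a 2%N ++ 1%N :: nseq b 2%N) =
    rat_F R F (4 * (-1) ^+ (a + b) * ((a%:R - b%:R) / (2 * a%:R + 1))
               * (1 - 1 / 4 ^+ (a + b)) * 'C(2 * a + 2 * b + 1, 2 * b + 1)%:R)
    * Zfrak_F R F (2 * a + 2 * b + 1)
  /\
  zeta_star_F R F (nseq a 2%N ++ 1%N :: nseq b 2%N) =
    rat_F R F (4 * (b%:R - a%:R) / (2 * a%:R + 1)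
               * (1 - 1 / 4 ^+ (a + b)) * 'C(2 * a + 2 * b + 1, 2 * b + 1)%:R)
    * Zfrak_F R F (2 * a + 2 * b + 1).
Proof.
rewrite coefqE coefq_starE.
case: F => [|bul]; first exact: zetaA_idx.
by split; [exact: zetaS_idx | exact: zetaS_star_idx].
Qed.
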